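(* Let $P$ be a discrete, countable, cancellative semigroup with identity $e$, let $B$ be a separable $C^*$-algebra and let $\mathcal{E}$ be a countably generated full Hilbert $B$-module. Let $\alpha=\{\alpha_s\}_{s\in P}$ be an $E_0$-semigroup over $P$ on $\mathcal{L}_B(\mathcal{E})$, and let $X$ be the product system over $P^{op}$ associated with $\alpha$. Suppose that $\alpha$ is of compact type. Then the reduced $C^*$-algebra $C^*_{red}(X)$ and the reduced crossed product $\mathcal{K}_B(\mathcal{E})\rtimes_{red}P$ of the semigroup dynamical system $(\mathcal{K}_B(\mathcal{E}),P,\alpha)$ are Morita equivalent.
   Context: $\mathcal{L}_B(\mathcal{E})$ and $\mathcal{K}_B(\mathcal{E})$ denote the adjointable and the compact operators on the Hilbert $B$-module $\mathcal{E}$; for $x,y\in\mathcal{E}$, $xy^*$ is the operator $z\mapsto x\langle y|z\rangle$. $P^{op}$ is $P$ with the opposite multiplication. Morita equivalence is in the sense of Rieffel (existence of an imprimitivity bimodule). $\mathcal{E}^*=\{x^*:x\in\mathcal{E}\}$ is the Hilbert $\mathcal{K}_B(\mathcal{E})$-module with $\langle x^*|y^*\rangle=xy^*$ and $x^*\cdot T=(T^*x)^*$, with left action of $B$ given by $b\cdot x^*=(xb^* )^*$. An $E_0$-semigroup over $P$ on $\mathcal{L}_B(\mathcal{E})$ is a family $\alpha=\{\alpha_s\}_{s\in P}$ of unital $*$-endomorphisms of $\mathcal{L}_B(\mathcal{E})$ with $\alpha_s\circ\alpha_t=\alpha_{st}$, $\alpha_e=\mathrm{id}$, such that each $\alpha_s$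 is strictly continuous on norm bounded sets (equivalently, $\alpha_s|_{\mathcal{K}_B(\mathcal{E})}$ is non-degenerate). It is of compact type if $\alpha_s(\mathcal{K}_B(\mathcal{E}))\subset\mathcal{K}_B(\mathcal{E})$ for all $s\in P$. A product system over a semigroup $Q$ with coefficient algebra $B$ is a semigroup $X$ with a surjective homomorphism $p:X\to Q$ whose fibres $X_s=p^{-1}(s)$ are $B$-$B$ $C^*$-correspondences (Hilbert $B$-modules with a left action of $B$ by adjointable operators), such that $X_e=B$, for all $s,t$ the multiplication induces a unitary bimodule map $X_s\otimes_B X_t\to X_{st}$, and multiplication by $X_e=B$ on the left and on the right is the left, respectively right, action of $B$. The product system associated with $\alpha$ is the product system $X=\coprod_{s\in P}X_s$ over $P^{op}$ with $X_s:=\mathcal{E}^*\otimes_{\mathcal{K}_B(\mathcal{E})}\mathcal{E}$ (internal tensor product with $\mathcal{K}_B(\mathcal{E})$ acting on the second factor $\mathcal{E}$ via $\alpha_s$), left $B$-action coming from $\mathcal{E}^*$, and multiplication $X_s\otimes_B X_t\to X_{ts}$, $(x^*\otimes y)\otimes(z^*\otimes u)\mapsto x^*\otimes\alpha_t(yz^* )u$. ($X_e$ is identified with $B$.) The reduced $C^*$-algebra $C^*_{red}(X)$ of a product system $X$ over $Q$ is the $C^*$-algebra generated by the left creation operators $\phi(x)$, $x\in X_s$, $s\in Q$, on the Hilbert $B$-module $\bigoplus_{s\in Q}X_s$, where $\phi(x)(y\otimes\delta_t)=xy\otimes\delta_{st}$ for $y\in X_t$ (product $st$ in $Q$; $y\otimes\delta_t$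 is the vector with entry $y$ at coordinate $t$ and $0$ elsewhere). A semigroup dynamical system $(A,P,\alpha)$ consists of a $C^*$-algebra $A$ and endomorphisms $\alpha_s$ of $A$ ($s\in P$) with $\alpha_s\circ\alpha_t=\alpha_{st}$, $\alpha_e=\mathrm{id}$, $\overline{\alpha_s(A)A}=A$. Its reduced crossed product $A\rtimes_{red}P$ is the $C^*$-algebra of adjointable operators on the Hilbert $A$-module $\ell^2(P)\otimes A$ generated by $\{V_s\pi(x):x\in A,s\in P\}$, where $\pi(x)(\delta_t\otimes y)=\delta_t\otimes\alpha_t(x)y$ and $V_s(\delta_t\otimes y)=\delta_{ts}\otimes y$. If $\alpha$ is an $E_0$-semigroup of compact type on $\mathcal{L}_B(\mathcal{E})$, then its restriction gives the semigroup dynamical system $(\mathcal{K}_B(\mathcal{E}),P,\alpha)$. *)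

(* Defs.v *)
From HB Require Import structures.
From mathcomp Require Import all_boot all_order all_algebra.
From mathcomp Require Import all_classical all_reals all_analysis.
From mathcomp Require Import complex.

Set Implicit Arguments.
Unset Strict Implicit.
Unset Printing Implicit Defensive.

Import Order.TTheory GRing.Theory Num.Theory.
Import numFieldNormedType.Exports.

Local Open Scope classical_set_scope.
Local Open Scope ring_scope.

Reserved Notation "a ** b" (at level 40, left associativity).
Reserved Notation "a ^†" (at level 8, format "a ^†").
Reserved Notation "x <* b" (at level 40, left associativity).
Reserved Notation "<< x | y >>" (at level 0, x, y at level 200,
  format "<<  x  |  y  >>").
Reserved Notation "''L' ( E )" (at level 8, format "''L' ( E )").

(******************************************************************************)
(* All structures are over K : numClosedFieldType, to be read as the complex  *)
(* field (K := R[i] with R : realType); inner products are linear in the      *)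
(* second variable.                                                           *)
(*                                                                            *)
(*    starAlgType K == complex *-algebra, not necessarily unital, with        *)
(*                     product a ** b and involution a^†                      *)
(*   cstarAlgType K == C*-algebra, not necessarily unital                     *)
(* hilbertModType B == (right) Hilbert B-module, with right action x <* b and *)
(*                     inner product << x | y >> : B                          *)
(*           'L(E)  == adjointable operators on the Hilbert module E          *)
(******************************************************************************)

HB.mixin Record isStarAlgebra (K : numClosedFieldType) A
    of GRing.Lmodule K A := {
  amul : A -> A -> A;
  astar : A -> A;
  amulA : associative amul;
  amul_linearl : forall b, linear (amul ^~ b);
  amul_linearr : forall a, linear (amul a);
  astarK : involutive astar;
  astarM : forall a b, astar (amul a b) = amul (astar b) (astar a);
  astarP : forall k a b, astar (k *: a + b) = k^* *: astar a + astar b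
}.

#[short(type="starAlgType")]
HB.structure Definition StarAlgebra (K : numClosedFieldType) :=
  {A of isStarAlgebra K A & GRing.Lmodule K A}.

Notation "a ** b" := (amul a b) : ring_scope.
Notation "a ^†" := (astar a) : ring_scope.

HB.mixin Record isCstarAlgebra (K : numClosedFieldType) A
    of StarAlgebra K A & CompleteNormedModule K A := {
  cnormM : forall a b : A, `|a ** b| <= `|a| * `|b|;
  cnorm_star : forall a : A, `|a^† ** a| = `|a| ^+ 2
}.

#[short(type="cstarAlgType")]
HB.structure Definition CstarAlgebra (K : numClosedFieldType) :=
  {A of isCstarAlgebra K A & StarAlgebra K A & CompleteNormedModule K A}.

Definition cpositive (K : numClosedFieldType) (A : cstarAlgType K) (a : A) :=
  exists c : A, a = c^† ** c.

Definition star_hom (K : numClosedFieldType) (A D : starAlgType K)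
    (f : A -> D) :=
  [/\ linear f, forall a b, f (a ** b) = f a ** f b
    & forall a, f a^† = (f a)^†].

(* Linearity and B-antilinearity in the first variable follow from the
   symmetry of the inner product, definiteness from hnormE. *)
HB.mixin Record isHilbertModule (K : numClosedFieldType) (B : cstarAlgType K) E
    of CompleteNormedModule K E := {
  hact : E -> B -> E;
  hinner : E -> E -> B;
  hact_linearl : forall b, linear (hact ^~ b);
  hact_linearr : forall x, linear (hact x);
  hactA : forall x a b, hact x (a ** b) = hact (hact x a) b;
  hinner_linearr : forall x, linear (hinner x);
  hinner_act : forall x y b, hinner x (hact y b) = hinner x y ** b;
  hinner_star : forall x y, (hinner x y)^† = hinner y x;
  hinner_ge0 : forall x, cpositive (hinner x x);
  hnormE : forall x : E, `|x| ^+ 2 = `|hinner x x|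
}.

HB.structure Definition HilbertModule (K : numClosedFieldType)
    (B : cstarAlgType K) :=
  {E of isHilbertModule K B E & CompleteNormedModule K E}.

Notation hilbertModType B := (@HilbertModule.type _ B).
Notation "x <* b" := (hact x b) : ring_scope.
Notation "<< x | y >>" := (hinner x y) : ring_scope.

Definition regular_module (K : numClosedFieldType) (B : cstarAlgType K) : Type
  := B.

Section RegularModule.
Context (K : numClosedFieldType) (B : cstarAlgType K).

HB.instance Definition _ :=
  CompleteNormedModule.copy (regular_module B) (B : Type).

Let act (x : regular_module B) (b : B) : regular_module B := (x : B) ** b.
Let inner (x y : regular_module B) : B := (x : B)^† ** (y : B).

Fact regular_actA x a b : act x (a ** b) = act (act x a) b.
Proof. exact: amulA. Qed.

Fact regular_inner_act x y b : inner x (act y b) = inner x y ** b.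
Proof. exact: amulA. Qed.

Fact regular_inner_star x y : (inner x y)^† = inner y x.
Proof. by rewrite /inner astarM astarK. Qed.

Fact regular_inner_ge0 x : cpositive (inner x x).
Proof. by exists x. Qed.

Fact regular_normE (x : regular_module B) : `|x| ^+ 2 = `|inner x x|.
Proof. by rewrite /inner cnorm_star. Qed.

HB.instance Definition _ := isHilbertModule.Build K B (regular_module B)
  (@amul_linearl K B) (@amul_linearr K B) regular_actA
  (fun x => @amul_linearr K B (x : B)^†) regular_inner_act regular_inner_star
  regular_inner_ge0 regular_normE.

End RegularModule.

Definition lspan (K : numClosedFieldType) (V : lmodType K) (S : set V) : set V :=
  [set v | exists n (c : 'I_n -> K) (w : 'I_n -> V),
     (forall i, S (w i)) /\ v = \sum_(i < n) c i *: w i].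

Definition densely_spans (K : numClosedFieldType) (V : normedModType K) (S : set V) :=
  closure (lspan S) = [set: V].

Definition separable (T : topologicalType) :=
  exists2 S : set T, countable S & closure S = [set: T].

Section HilbertModuleNotions.
Context (K : numClosedFieldType) (B : cstarAlgType K) (E : hilbertModType B).

Definition full_module :=
  densely_spans [set b : B | exists x y : E, b = << x | y >>].

Definition countably_generated :=
  exists2 S : set E, countable S &
    densely_spans [set x : E | exists y b, S y /\ x = y <* b].

End HilbertModuleNotions.

(* Linearity, B-linearity and boundedness of an adjointable operator are
   automatic; the adjoint is unique. *)
Structure adjointable (K : numClosedFieldType) (B : cstarAlgType K)
    (E : hilbertModType B) := Adjointable {
  adj_fun :> E -> E;
  adj_op : E -> E;
  adj_opP : forall x y, << adj_fun x | y >> = << x | adj_op y >>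
}.

Notation "''L' ( E )" := (adjointable E) : type_scope.

Section AdjointableOperators.
Context (K : numClosedFieldType) (B : cstarAlgType K) (E : hilbertModType B).
Implicit Types (x y z : E) (S T U : 'L(E)).

Lemma hinnerDr x y z : << x | y + z >> = << x | y >> + << x | z >>.
Proof. by have := hinner_linearr x 1 y z; rewrite !scale1r. Qed.

Lemma hinnerBr x y z : << x | y - z >> = << x | y >> - << x | z >>.
Proof.
by have := hinner_linearr x (-1) z y; rewrite !scaleN1r ![- _ + _]addrC.
Qed.

Lemma hinner0r x : << x | 0 >> = 0.
Proof. by rewrite -(subrr 0) hinnerBr subrr. Qed.

Lemma hinnerZr k x y : << x | k *: y >> = k *: << x | y >>.
Proof. by have := hinner_linearr x k y 0; rewrite !addr0 hinner0r addr0. Qed.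

Lemma astarD (A : starAlgType K) (a b : A) : (a + b)^† = a^† + b^†.
Proof. by have := astarP 1 a b; rewrite rmorph1 !scale1r. Qed.

Lemma astar0 (A : starAlgType K) : (0 : A)^† = 0.
Proof. by apply: (addrI (0 : A)^†); rewrite -astarD !addr0. Qed.

Lemma astarZ (A : starAlgType K) k (a : A) : (k *: a)^† = k^* *: a^†.
Proof. by have := astarP k a 0; rewrite !addr0 astar0 addr0. Qed.

Lemma hinnerDl x y z : << x + y | z >> = << x | z >> + << y | z >>.
Proof. by rewrite -hinner_star hinnerDr astarD !hinner_star. Qed.

Lemma hinnerZl k x y : << k *: x | y >> = k^* *: << x | y >>.
Proof. by rewrite -hinner_star hinnerZr astarZ hinner_star. Qed.

Lemma hinner_eq0 x : << x | x >> = 0 -> x = 0.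
Proof.
by move=> x0; apply/eqP; rewrite -normr_eq0 -sqrf_eq0 hnormE x0 normr0.
Qed.

Lemma hinner_inj y z : (forall x, << x | y >> = << x | z >>) -> y = z.
Proof.
move=> yz; apply/eqP; rewrite -subr_eq0; apply/eqP/hinner_eq0.
by rewrite hinnerBr yz subrr.
Qed.

Lemma adjointable_eq S T : S =1 T -> S = T.
Proof.
case: S T => [f f' fP] [g g' gP] /= /funext fg; rewrite fg in fP *.
have f'g' : f' = g'.
  by apply/funext => y; apply: hinner_inj => x; rewrite -fP -gP.
by rewrite f'g' in fP *; congr Adjointable; exact: Prop_irrelevance.
Qed.

Lemma adj_opPl T x y : << adj_op T x | y >> = << x | T y >>.
Proof. by rewrite -hinner_star -adj_opP hinner_star. Qed.

HB.instance Definition _ := gen_eqMixin 'L(E).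
HB.instance Definition _ := gen_choiceMixin 'L(E).

Definition adj_id : 'L(E) := @Adjointable _ _ E id id (fun x y => erefl).

Fact adj_zero_subproof x y : << (0 : E) | y >> = << x | 0 >>.
Proof. by rewrite -hinner_star !hinner0r astar0. Qed.
Definition adj_zero : 'L(E) :=
  @Adjointable _ _ E (fun=> 0) (fun=> 0) adj_zero_subproof.

Fact adj_add_subproof S T x y :
  << S x + T x | y >> = << x | adj_op S y + adj_op T y >>.
Proof. by rewrite hinnerDl hinnerDr !adj_opP. Qed.
Definition adj_add S T : 'L(E) := Adjointable (adj_add_subproof S T).

Fact adj_scale_subproof k T x y :
  << k *: T x | y >> = << x | k^* *: adj_op T y >>.
Proof. by rewrite hinnerZl hinnerZr adj_opP. Qed.
Definition adj_scale k T : 'L(E) := Adjointable (adj_scale_subproof k T).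

Definition adj_opp T := adj_scale (-1) T.

Fact adj_comp_subproof S T x y :
  << S (T x) | y >> = << x | adj_op T (adj_op S y) >>.
Proof. by rewrite !adj_opP. Qed.
Definition adj_comp S T : 'L(E) := Adjointable (adj_comp_subproof S T).

Definition adj_star T : 'L(E) := Adjointable (adj_opPl T).

Fact adj_addA : associative adj_add.
Proof. by move=> S T U; apply: adjointable_eq => x /=; rewrite addrA. Qed.
Fact adj_addC : commutative adj_add.
Proof. by move=> S T; apply: adjointable_eq => x /=; rewrite addrC. Qed.
Fact adj_add0 : left_id adj_zero adj_add.
Proof. by move=> S; apply: adjointable_eq => x /=; rewrite add0r. Qed.
Fact adj_addN : left_inverse adj_zero adj_opp adj_add.
Proof.
by move=> S; apply: adjointable_eq => x /=; rewrite scaleN1r addNr.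
Qed.

HB.instance Definition _ :=
  GRing.isZmodule.Build 'L(E) adj_addA adj_addC adj_add0 adj_addN.

Fact adj_scaleA k l T : adj_scale k (adj_scale l T) = adj_scale (k * l) T.
Proof. by apply: adjointable_eq => x /=; rewrite scalerA. Qed.
Fact adj_scale1 : left_id 1 adj_scale.
Proof. by move=> T; apply: adjointable_eq => x /=; rewrite scale1r. Qed.
Fact adj_scaleDr : right_distributive adj_scale +%R.
Proof. by move=> k S T; apply: adjointable_eq => x /=; rewrite scalerDr. Qed.
Fact adj_scaleDl T : {morph adj_scale^~ T : k l / k + l}.
Proof. by move=> k l; apply: adjointable_eq => x /=; rewrite scalerDl. Qed.

HB.instance Definition _ := GRing.Zmodule_isLmodule.Build K 'L(E)
  adj_scaleA adj_scale1 adj_scaleDr adj_scaleDl.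

Lemma adj_funP T k x y : T (k *: x + y) = k *: T x + T y.
Proof.
apply: hinner_inj => z.
by rewrite hinnerDr hinnerZr -!adj_opPl hinnerDr hinnerZr.
Qed.

Fact adj_compA : associative adj_comp.
Proof. by move=> S T U; exact: adjointable_eq. Qed.
Fact adj_comp_linearl T : linear (adj_comp ^~ T).
Proof. by move=> k S U; exact: adjointable_eq. Qed.
Fact adj_comp_linearr T : linear (adj_comp T).
Proof. by move=> k S U; apply: adjointable_eq => x /=; rewrite adj_funP. Qed.
Fact adj_starK : involutive adj_star.
Proof. by move=> T; exact: adjointable_eq. Qed.
Fact adj_starM S T :
  adj_star (adj_comp S T) = adj_comp (adj_star T) (adj_star S).
Proof. exact: adjointable_eq. Qed.
Fact adj_starP k S T :
  adj_star (k *: S + T) = k^* *: adj_star S + adj_star T.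
Proof. exact: adjointable_eq. Qed.

HB.instance Definition _ := isStarAlgebra.Build K 'L(E)
  adj_compA adj_comp_linearl adj_comp_linearr adj_starK adj_starM adj_starP.

Definition opnorm_le T (c : K) := forall x, `|T x| <= c * `|x|.

Definition is_opnorm T (c : K) :=
  [/\ 0 <= c, opnorm_le T c & forall d, 0 <= d -> opnorm_le T d -> c <= d].

Definition opnorm_closure (D : set 'L(E)) : set 'L(E) :=
  [set T | forall e, 0 < e -> exists2 S, D S & opnorm_le (T - S) e].

(* rank_one x y is the operator x y^* *)
Fact rank_one_subproof x y z u :
  << x <* << y | z >> | u >> = << z | y <* << x | u >> >>.
Proof.
by rewrite -hinner_star !hinner_act astarM !hinner_star.
Qed.
Definition rank_one x y : 'L(E) := Adjointable (rank_one_subproof x y).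

Definition compacts : set 'L(E) :=
  opnorm_closure (lspan [set T | exists x y, T = rank_one x y]).

Definition cstar_subalgebra (D : set 'L(E)) :=
  [/\ lspan D `<=` D, (forall S T, D S -> D T -> D (S ** T)),
      (forall T, D T -> D T^†) & opnorm_closure D `<=` D].

Definition cstar_generated (G : set 'L(E)) : set 'L(E) :=
  [set T | forall D, cstar_subalgebra D -> G `<=` D -> D T].

(* On bounded sets this is the strict topology of 'L(E), the multiplier
   algebra of the compact operators. *)
Definition strict_cvg (F : set_system 'L(E)) T :=
  forall x, (S x @[S --> F] --> T x) /\ (adj_op S x @[S --> F] --> adj_op T x).

Definition strictly_continuous_on_bounded (f : 'L(E) -> 'L(E)) :=
  forall (F : set_system 'L(E)) (FF : ProperFilter F) c T,
    F [set S | opnorm_le S c] -> opnorm_le T c ->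
    strict_cvg F T -> strict_cvg (f @ F) (f T).

End AdjointableOperators.

Arguments compacts {K B} E _.
Arguments adj_id {K B} E.

(* A copy, as an abstract C*-algebra with the operator norm, of a set D of
   adjointable operators which is a C*-subalgebra. *)
Record realization (K : numClosedFieldType) (B : cstarAlgType K)
    (E : hilbertModType B) (D : set 'L(E)) := Realization {
  real_alg :> cstarAlgType K;
  real_op : real_alg -> 'L(E);
  real_op_hom : star_hom real_op;
  real_op_norm : forall a, is_opnorm (real_op a) `|a|;
  real_op_range : range real_op = D
}.

(* The Hilbert module direct sum of a family, up to unitary equivalence. *)
Record direct_sum (K : numClosedFieldType) (B : cstarAlgType K) (I : Type)
    (X : I -> hilbertModType B) := DirectSum {
  dsum :> hilbertModType B;
  dsum_in : forall i, X i -> dsum;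
  dsum_in_inner : forall i (x y : X i),
    << dsum_in x | dsum_in y >> = << x | y >>;
  dsum_in_orth : forall i j (x : X i) (y : X j), i <> j ->
    << dsum_in x | dsum_in y >> = 0;
  dsum_in_total : densely_spans [set v | exists i (x : X i), v = dsum_in x]
}.

(* The map (x, y) |-> t x y exhibits Z as the interior tensor product of U and F
   over A, where A acts on F through lambda. The left factor enters only through
   its A-valued inner product ip, so that U may be the set of the vectors x^*,
   x in E. Bilinearity and balancedness of t follow from the inner product
   formula. *)
Definition is_interior_tensor (K : numClosedFieldType) (A : starAlgType K)
    (U : Type) (ip : U -> U -> A) (B : cstarAlgType K)
    (F : hilbertModType B) (lambda : A -> 'L(F))
    (Z : hilbertModType B) (t : U -> F -> Z) :=
  (forall x y x' y', << t x y | t x' y' >> = << y | lambda (ip x x') y' >>)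
  /\ densely_spans [set z | exists x y, z = t x y].

Definition opposite (P : Type) : Type := P.

Section OppositeMonoid.
Context (P : monoidType).
Let mulop (s t : opposite P) : opposite P := ((t : P) * (s : P))%g.
HB.instance Definition _ := Choice.copy (opposite P) P.
Fact mulopA : associative mulop.
Proof. by move=> s t u; rewrite /mulop mulgA. Qed.
Fact mulop1l : left_id (1%g : P) mulop.
Proof. by move=> s; rewrite /mulop mulg1. Qed.
Fact mulop1r : right_id (1%g : P) mulop.
Proof. by move=> s; rewrite /mulop mul1g. Qed.
HB.instance Definition _ :=
  isMonoid.Build (opposite P) mulopA mulop1l mulop1r.
End OppositeMonoid.

(* The underlying semigroup is the total space {s : Q & X s}; ps_unit is the
   identification of B with the fibre over the identity, and ps_tensor says that
   the product induces a unitary from the interior tensor product of X s and X t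
   over B onto X (s * t). *)
Record product_system (K : numClosedFieldType) (B : cstarAlgType K)
    (Q : monoidType) := ProductSystem {
  ps_fibre :> Q -> hilbertModType B;
  ps_left : forall s, B -> 'L(ps_fibre s);
  ps_left_hom : forall s, star_hom (ps_left s);
  ps_mul : forall s t, ps_fibre s -> ps_fibre t -> ps_fibre (s * t)%g;
  ps_mulA : forall s t u (x : ps_fibre s) (y : ps_fibre t) (z : ps_fibre u),
    Tagged ps_fibre (ps_mul (ps_mul x y) z) =
    Tagged ps_fibre (ps_mul x (ps_mul y z));
  ps_tensor : forall s t,
    is_interior_tensor (@hinner K B (ps_fibre s)) (ps_left t) (@ps_mul s t);
  ps_mul_left : forall s t b (x : ps_fibre s) (y : ps_fibre t),
    ps_left (s * t)%g b (ps_mul x y) = ps_mul (ps_left s b x) y;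
  ps_unit : B -> ps_fibre 1%g;
  ps_unit_inner : forall a b, << ps_unit a | ps_unit b >> = a^† ** b;
  ps_unit_surj : forall x, exists b, x = ps_unit b;
  ps_unit_left : forall a b, ps_left 1%g a (ps_unit b) = ps_unit (a ** b);
  ps_unit_act : forall a b, ps_unit a <* b = ps_unit (a ** b);
  ps_mul_unitl : forall s b (x : ps_fibre s),
    Tagged ps_fibre (ps_mul (ps_unit b) x) = Tagged ps_fibre (ps_left s b x);
  ps_mul_unitr : forall s b (x : ps_fibre s),
    Tagged ps_fibre (ps_mul x (ps_unit b)) = Tagged ps_fibre (x <* b)
}.

(* An operator on F is determined by its values on the vectors dsum_in F y; the
   left creation operator by x exists (is adjointable) as soon as Q is left
   cancellative. *)
Definition reduced_algebra (K : numClosedFieldType) (B : cstarAlgType K)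
    (Q : monoidType) (X : product_system B Q) (F : direct_sum X) : set 'L(F) :=
  cstar_generated [set T | exists s (x : X s), forall t (y : X t),
    T (dsum_in F y) = dsum_in F (ps_mul x y)].
Arguments reduced_algebra {K B Q X} F _.

Record E0_semigroup (K : numClosedFieldType) (B : cstarAlgType K)
    (E : hilbertModType B) (P : monoidType) (alpha : P -> 'L(E) -> 'L(E)) :
    Prop := E0Semigroup {
  E0_hom : forall s, star_hom (alpha s);
  E0_unital : forall s, alpha s (adj_id E) = adj_id E;
  E0_comp : forall s t T, alpha s (alpha t T) = alpha (s * t)%g T;
  E0_one : forall T, alpha 1%g T = T;
  E0_strict : forall s, strictly_continuous_on_bounded (alpha s)
}.

Definition compact_type (K : numClosedFieldType) (B : cstarAlgType K)
    (E : hilbertModType B) (P : Type) (alpha : P -> 'L(E) -> 'L(E)) :=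
  forall s T, compacts E T -> compacts E (alpha s T).

(* tau s x y is the vector x^* (x) y of X s; the left action of b takes it to
   (b . x^* ) (x) y = (x b^* )^* (x) y. *)
Definition associated_product_system (K : numClosedFieldType)
    (B : cstarAlgType K) (E : hilbertModType B) (P : monoidType)
    (alpha : P -> 'L(E) -> 'L(E)) (X : product_system B (opposite P)) :=
  exists tau : forall s, E -> E -> X s,
  [/\ forall s, is_interior_tensor (@rank_one K B E) (alpha s) (tau s),
      forall s b x y, ps_left X s b (tau s x y) = tau s (x <* b^†) y,
      forall s t x y z u, ps_mul (tau s x y) (tau t z u) =
        tau (s * t)%g x (alpha t (rank_one y z) u)
    & forall x y, tau 1%g x y = ps_unit X << x | y >>].

Definition crossed_product (K : numClosedFieldType) (A : cstarAlgType K)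
    (P : monoidType) (alpha : P -> A -> A)
    (F : direct_sum (fun _ : P => regular_module A : hilbertModType A)) :
    set 'L(F) :=
  cstar_generated [set T | exists s a (V Pi : 'L(F)),
    [/\ forall t y, V (dsum_in F (i := t) y) = dsum_in F (i := (t * s)%g) y,
        forall t (y : A),
          Pi (dsum_in F (i := t) y) = dsum_in F (i := t) (alpha t a ** y)
      & T = V ** Pi]].
Arguments crossed_product {K A P} alpha F _.

Record imprimitivity_bimodule (K : numClosedFieldType) (A B : cstarAlgType K) :=
    ImprimitivityBimodule {
  imp_mod :> hilbertModType B;
  imp_full : full_module imp_mod;
  imp_act : A -> imp_mod -> imp_mod;
  imp_inner : imp_mod -> imp_mod -> A;
  imp_act_linearl : forall x, linear (imp_act ^~ x);
  imp_act_linearr : forall a, linear (imp_act a);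
  imp_actA : forall a b x, imp_act (a ** b) x = imp_act a (imp_act b x);
  imp_inner_linearl : forall y, linear (imp_inner ^~ y);
  imp_inner_act : forall a x y, imp_inner (imp_act a x) y = a ** imp_inner x y;
  imp_inner_star : forall x y, (imp_inner x y)^† = imp_inner y x;
  imp_inner_ge0 : forall x, cpositive (imp_inner x x);
  imp_normE : forall x : imp_mod, `|x| ^+ 2 = `|imp_inner x x|;
  imp_inner_full : densely_spans [set a : A | exists x y, a = imp_inner x y];
  imp_actC : forall a x b, imp_act a (x <* b) = imp_act a x <* b;
  imp_adjl : forall a x y, << imp_act a x | y >> = << x | imp_act a^† y >>;
  imp_adjr : forall x y b, imp_inner (x <* b) y = imp_inner x (y <* b^†);
  imp_compat : forall x y z, imp_act (imp_inner x y) z = x <* << y | z >>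
}.

Definition morita_equivalent (K : numClosedFieldType) (A B : cstarAlgType K) :=
  inhabited (imprimitivity_bimodule A B).

(* Main.v *)
Require Import Defs.
From HB Require Import structures.
From mathcomp Require Import all_boot all_order all_algebra.
From mathcomp Require Import all_classical all_reals all_analysis.
From mathcomp Require Import complex ring lra.

(** Let K be the algebra of compact operators on E, D its reduced crossed product,
    C the reduced algebra of X, and F the direct sum of the fibres of X. The
    operator V_s pi(k) acts on l^2(P) (x) K, and by a (x) 1 on the Hilbert B-module
    H = (l^2(P) (x) K) (x)_K E, a direct sum of copies of E indexed by P. Each x in
    E gives an operator Theta_x : H -> F that takes v in the copy of E at t to
    x^* (x) v in the fibre at t. Computations on elementary tensors give
      Theta_x^* Theta_y = pi(x y^* ),
      phi(x^* (x) y) Theta_z = Theta_x V_s pi(y z^* ),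
      phi(x^* (x) y)^* Theta_z = Theta_y (V_s pi(alpha_s(z x^* )))^*,
    where phi(x^* (x) y) is the creation operator of x^* (x) y in the fibre at s.

    The equivalence bimodule M is the closed span of the operators Theta_x d with d
    in D. It is a Hilbert D-module with inner product m^* n, and C acts on it from
    the left by the second and third relations (kappa_closure). The inner products
    span a dense subspace of D by the first relation and the density of
    alpha_s(K) K in K, which is how strict continuity of alpha enters
    (E0_nondegenerate, right_full).

    The other inner product is m n^*, and the point is that it belongs to C. This
    is clear for Theta_x Theta_y^*, which is the creation operator of x^* (x) y in
    the fibre at the identity (left_gram_Th). In general it is enough that M is
    also the closed span of C Theta_E. The set of those d in D for which every
    Theta_x d belongs to that span is a closed subalgebra; it contains the
    generators by the second relation, and their adjoints by the third relation
    and the density of alpha_s(K) K (stable_all). Conversely these inner products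
    span C densely, since x is a limit of vectors k x with k in K
    (left_ideal_cr).

    The module H is not constructed. An operator w from H to F is given by its
    values w (xi, u) on elementary tensors, and the element a = w^* v of D is
    determined by [w (xi, u), v (eta, u')] = [u, [xi, a eta] u']. The record
    gram_space isolates what is needed to complete a space of such functions to a
    Hilbert module, and in this model c = m n^* is the element of C that satisfies
    c p = m [n, p] for all p in M.

    The argument rests on the elementary theory of C*-algebras: the positivity of
    c^† c, the Cauchy-Schwarz inequality in Hilbert modules, contractivity of
    *-homomorphisms, and approximate units. In place of spectral theory it uses
    square roots, computed by an iteration (sqrt_one_sub); a self-adjoint operator
    a is called positive if |t - a| <= t for some t >= 0, and the negative part of
    c^† c is excluded by a growth estimate (star_mul_neg_sq). *)

Set Implicit Arguments.
Unset Strict Implicit.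
Unset Printing Implicit Defensive.

Import Order.TTheory GRing.Theory Num.Theory.
Import numFieldNormedType.Exports.

Local Open Scope classical_set_scope.
Local Open Scope ring_scope.
Local Open Scope complex_scope.

(** * Identities in noncommutative rings, by reflection *)

Inductive nc_expr := NcAtom of nat | NcAdd of nc_expr & nc_expr
  | NcOpp of nc_expr | NcMul of nc_expr & nc_expr | NcZero.

(** A normal form is a formal sum of signed monomials; the monomial with letters
    i and s stands for the product of the atom i with the word s. Words are
    nonempty, so that no unit is needed. *)
Definition nc_form := seq (int * (nat * seq nat)).

Fixpoint nc_expand (e : nc_expr) : nc_form :=
  match e with
  | NcAtom i => [:: (1, (i, [::]))]
  | NcAdd e1 e2 => nc_expand e1 ++ nc_expand e2
  | NcOpp e1 => [seq (- p.1, p.2) | p <- nc_expand e1]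
  | NcMul e1 e2 => [seq (p.1 * q.1, (p.2.1, p.2.2 ++ q.2.1 :: q.2.2)) |
      p <- nc_expand e1, q <- nc_expand e2]
  | NcZero => [::]
  end.

Definition nc_coef (s : nc_form) m : int :=
  foldr (fun p a => if p.2 == m then p.1 + a else a) 0 s.

Definition nc_null (s : nc_form) := all (fun p => nc_coef s p.2 == 0) s.

Section NcRing.
Context (V : zmodType) (mul : V -> V -> V).
Hypotheses (mulA : associative mul) (mulDl : left_distributive mul +%R)
  (mulDr : right_distributive mul +%R).
Variable env : seq V.

Fixpoint nc_eval e : V :=
  match e with
  | NcAtom i => nth 0 env i
  | NcAdd e1 e2 => nc_eval e1 + nc_eval e2
  | NcOpp e1 => - nc_eval e1
  | NcMul e1 e2 => mul (nc_eval e1) (nc_eval e2)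
  | NcZero => 0
  end.

Definition nc_word (m : nat * seq nat) : V :=
  foldl (fun x i => mul x (nth 0 env i)) (nth 0 env m.1) m.2.

Definition nc_sum (s : nc_form) : V := \sum_(p <- s) nc_word p.2 *~ p.1.

Let mul0l x : mul 0 x = 0.
Proof. by apply: (addrI (mul 0 x)); rewrite -mulDl !addr0. Qed.
Let mul0r x : mul x 0 = 0.
Proof. by apply: (addrI (mul x 0)); rewrite -mulDr !addr0. Qed.
Let mulNl x y : mul (- x) y = - mul x y.
Proof. by apply: (addrI (mul x y)); rewrite -mulDl !subrr. Qed.
Let mulNr x y : mul x (- y) = - mul x y.
Proof. by apply: (addrI (mul x y)); rewrite -mulDr !subrr. Qed.
Let mulzl x y n : mul (x *~ n) y = mul x y *~ n.
Proof.
have H k : mul (x *+ k) y = mul x y *+ k.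
  by elim: k => [|k IH]; rewrite ?mulr0n // !mulrS mulDl IH.
by case: n => k; rewrite ?NegzE ?mulrNz ?mulNl -!pmulrn H.
Qed.
Let mulzr x y n : mul x (y *~ n) = mul x y *~ n.
Proof.
have H k : mul x (y *+ k) = mul x y *+ k.
  by elim: k => [|k IH]; rewrite ?mulr0n // !mulrS mulDr IH.
by case: n => k; rewrite ?NegzE ?mulrNz ?mulNr -!pmulrn H.
Qed.

Lemma nc_word_cat m n :
  nc_word (m.1, m.2 ++ n.1 :: n.2) = mul (nc_word m) (nc_word n).
Proof.
rewrite /nc_word foldl_cat /=; move: (foldl _ _ m.2) => x.
elim/last_ind: n.2 => [//|s i IH]; first by rewrite !foldl_rcons /= IH mulA.
Qed.

Lemma nc_sumE e : nc_eval e = nc_sum (nc_expand e).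
Proof.
rewrite /nc_sum; elim: e => [i|e1 IH1 e2 IH2|e1 IH1|e1 IH1 e2 IH2|] /=.
- by rewrite big_seq1.
- by rewrite big_cat IH1 IH2.
- by rewrite IH1 big_map -sumrN; apply: eq_bigr => p _; rewrite mulrNz.
- rewrite IH1 IH2 big_allpairs_dep /=.
  rewrite (big_morph (mul ^~ _) (fun x y => mulDl x y _) (mul0l _)).
  apply: eq_bigr => p _; rewrite (big_morph (mul _) (mulDr _) (mul0r _)).
  by apply: eq_bigr => q _; rewrite /= nc_word_cat mulzl mulzr -mulrzA mulrC.
- by rewrite big_nil.
Qed.

Lemma nc_null_eq0 s : nc_null s -> nc_sum s = 0.
Proof.
have coefE t m : nc_coef t m = \sum_(p <- t | p.2 == m) p.1.
  by elim: t => [|p t IH]; rewrite ?big_nil // big_cons /= IH; case: ifP.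
have [n] := ubnP (size s); elim: n s => // n IH [|p s] sn H.
  by rewrite /nc_sum big_nil.
rewrite /nc_sum (bigID (fun q => q.2 == p.2)).
have -> : \sum_(q <- p :: s | q.2 == p.2) nc_word q.2 *~ q.1 = 0.
  have /eqP Hp := allP H p (mem_head _ _).
  rewrite (eq_bigr (fun q => nc_word p.2 *~ q.1)) => [|q /eqP-> //].
  by rewrite -mulrz_sumr -coefE Hp mulr0z.
rewrite Monoid.mul1m -big_filter; apply: IH.
  rewrite /= eqxx /=; apply: leq_ltn_trans (size_subseq (filter_subseq _ _)) _; exact: sn.
apply/allP => q; rewrite mem_filter => /andP[qp qs].
have /eqP Hq := allP H q qs; apply/eqP; rewrite -[RHS]Hq !coefE.
rewrite big_filter_cond; apply: eq_bigl => r.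
by case: (eqVneq r.2 q.2) => [->|]; rewrite ?qp // andbF.
Qed.

Lemma nc_correct e1 e2 :
  nc_null (nc_expand (NcAdd e1 (NcOpp e2))) -> nc_eval e1 = nc_eval e2.
Proof.
move=> /nc_null_eq0; rewrite -nc_sumE /= => /eqP; rewrite subr_eq0 => /eqP.
exact.
Qed.

End NcRing.

(* Equal atoms may carry syntactically different inferred structures, so that
   they are compared up to conversion. *)
Ltac nc_same x y :=
  match constr:(tt) with
  | _ => lazymatch y with x => constr:(true) end
  | _ => let u := match constr:(tt) with _ => unify x y end in constr:(true)
  | _ => constr:(false)
  end.

Ltac nc_mem x l :=
  lazymatch l with
  | nil => constr:(false)
  | ?y :: ?l' => lazymatch nc_same x y with true => constr:(true)
    | false => nc_mem x l' end
  end.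

Ltac nc_index x l :=
  lazymatch l with
  | ?y :: ?l' => lazymatch nc_same x y with true => constr:(0%N)
    | false => let n := nc_index x l' in constr:(S n) end
  end.

Ltac nc_atoms ismul l e :=
  lazymatch e with
  | (?a + ?b)%R => let l' := nc_atoms ismul l a in nc_atoms ismul l' b
  | (- ?a)%R => nc_atoms ismul l a
  | (0)%R => l
  | _ =>
    match constr:(tt) with
    | _ => let p := ismul e in
      lazymatch p with
      | (?a, ?b) => let l' := nc_atoms ismul l a in nc_atoms ismul l' b
      end
    | _ => lazymatch nc_mem e l with
      | true => l
      | false => constr:(e :: l)
      end
    end
  end.

Ltac nc_reify ismul l e :=
  lazymatch e with
  | (?a + ?b)%R => let a' := nc_reify ismul l a in
      let b' := nc_reify ismul l b in constr:(NcAdd a' b')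
  | (- ?a)%R => let a' := nc_reify ismul l a in constr:(NcOpp a')
  | (0)%R => constr:(NcZero)
  | _ =>
    match constr:(tt) with
    | _ => let p := ismul e in
      lazymatch p with
      | (?a, ?b) => let a' := nc_reify ismul l a in
          let b' := nc_reify ismul l b in constr:(NcMul a' b')
      end
    | _ => let n := nc_index e l in constr:(NcAtom n)
    end
  end.

Ltac nc_solve ismul close :=
  lazymatch goal with
  | |- @eq ?T ?e1 ?e2 =>
    let l0 := constr:(@nil T) in
    let l1 := nc_atoms ismul l0 e1 in let l2 := nc_atoms ismul l1 e2 in
    let r1 := nc_reify ismul l2 e1 in let r2 := nc_reify ismul l2 e2 in
    close l2 r1 r2
  end.

Lemma zmod_correct (V : zmodType) (env : seq V) e1 e2 :
  nc_null (nc_expand (NcAdd e1 (NcOpp e2))) ->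
  nc_eval (fun _ _ => 0) env e1 = nc_eval (fun _ _ => 0) env e2.
Proof. by move=> H; apply: nc_correct H => [|x y z|x y z] //; rewrite addr0. Qed.

Lemma ring_correct (V : pzRingType) (env : seq V) e1 e2 :
  nc_null (nc_expand (NcAdd e1 (NcOpp e2))) ->
  nc_eval *%R env e1 = nc_eval *%R env e2.
Proof. by apply: nc_correct; [exact: mulrA|exact: mulrDl|exact: mulrDr]. Qed.

(** [zmod] proves identities of abelian groups, [ncring] identities that hold in
    all (not necessarily commutative) rings. *)
Ltac zmod_mul e := fail.
Ltac zmod_close l e1 e2 := exact (@zmod_correct _ l e1 e2 isT).
Ltac ring_mul e := lazymatch e with (?a * ?b)%R => constr:((a, b)) end.
Ltac ring_close l e1 e2 := exact (@ring_correct _ l e1 e2 isT).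
Ltac zmod := nc_solve zmod_mul zmod_close.
Ltac ncring :=
  rewrite ?expr2 ?(mulrDl, mulrDr, mulNr, mulrN, mulr1, mul1r);
  nc_solve ring_mul ring_close.

(** * Real-valued norms and sequences *)

Lemma ltr0C (R : realType) (r : R) : (0 < r%:C) = (0 < r).
Proof. exact: (ltcR 0 r). Qed.

Section RealNorm.
Context (R : realType) (V : normedModType R[i]).
Implicit Types (x y : V) (k : R[i]) (r : R).

(** The norm of a complex normed space takes complex values; nrm is this norm
    with values in the ordered field R. *)
Definition nrm x : R := complex.Re `|x|.

Lemma nrmE x : `|x| = (nrm x)%:C.
Proof.
rewrite /nrm; have := normr_ge0 x; case: (`|x|) => a b.
by rewrite lecE /= => /andP[/eqP-> _]; exact: complexr0.
Qed.

Lemma nrm_ge0 x : 0 <= nrm x.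
Proof. by rewrite -ler0c -nrmE normr_ge0. Qed.

Lemma nrm_le x r : (`|x| <= r%:C) = (nrm x <= r).
Proof. by rewrite nrmE lecR. Qed.

Lemma nrm0 : nrm 0 = 0.
Proof. by rewrite /nrm normr0. Qed.

Lemma nrm0_eq0 x : nrm x = 0 -> x = 0.
Proof. by move=> x0; apply/eqP; rewrite -normr_eq0 nrmE x0. Qed.

Lemma nrmD x y : nrm (x + y) <= nrm x + nrm y.
Proof. by rewrite -lecR rmorphD /= -!nrmE ler_normD. Qed.

Lemma nrmN x : nrm (- x) = nrm x.
Proof. by rewrite /nrm normrN. Qed.

Lemma nrmC x y : nrm (x - y) = nrm (y - x).
Proof. by rewrite -nrmN opprB. Qed.

Lemma nrmB x y : nrm (x - y) <= nrm x + nrm y.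
Proof. by rewrite -(nrmN y) nrmD. Qed.

Lemma nrm_trans y x z : nrm (x - z) <= nrm (x - y) + nrm (y - z).
Proof. by rewrite -[x - z](subrKA y) nrmD. Qed.

Lemma nrmZ k x : nrm (k *: x) = complex.Re `|k| * nrm x.
Proof.
by apply: complexI; rewrite rmorphM /= -!nrmE normrZ; congr (_ * _).
Qed.

Lemma nrmZr r x : 0 <= r -> nrm (r%:C *: x) = r * nrm x.
Proof. by move=> r0; rewrite nrmZ ger0_norm ?ler0c. Qed.

Lemma nrm_le0 x : nrm x <= 0 -> x = 0.
Proof.
by move=> x0; apply: nrm0_eq0; apply/eqP; rewrite eq_le x0 nrm_ge0.
Qed.

Lemma nrm_eps_eq0 x c : (forall e, 0 < e -> nrm x <= c * e) -> x = 0.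
Proof.
move=> H; apply: nrm_le0; apply/ler_addgt0Pr => e e0; rewrite add0r.
have c0 : 0 < `|c| + 1 by rewrite ltr_wpDl.
apply: le_trans (H (e / (`|c| + 1)) _) _; first by rewrite divr_gt0.
rewrite mulrCA ler_piMr //; first exact: ltW.
rewrite ler_pdivrMr // mul1r; apply: le_trans (ler_norm _) _.
by rewrite lerDl.
Qed.

(** Convergence of sequences in its elementary form, which lets all the limit
    arguments below be carried out in the ordered field of scalars. *)
Definition tends (u : nat -> V) l :=
  forall e : R, 0 < e -> exists N, forall n, (N <= n)%N -> nrm (u n - l) <= e.

Definition cauchyseq (u : nat -> V) := forall e : R, 0 < e ->
  exists N, forall n m, (N <= n)%N -> (N <= m)%N -> nrm (u n - u m) <= e.

Lemma tends_unique u l l' : tends u l -> tends u l' -> l = l'.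
Proof.
move=> ul ul'; apply/eqP; rewrite -subr_eq0; apply/eqP.
apply: (@nrm_eps_eq0 _ 2) => e e0.
have [N HN] := ul _ e0; have [N' HN'] := ul' _ e0.
have := HN (maxn N N') (leq_maxl _ _); have := HN' (maxn N N') (leq_maxr _ _).
have := nrm_trans (u (maxn N N')) l l'; rewrite (nrmC l (u _)) => *; lra.
Qed.

Lemma tends_cauchy u l : tends u l -> cauchyseq u.
Proof.
move=> ul e e0; have [|N HN] := ul (e / 2); first lra.
exists N => n m /HN un /HN um; have := nrm_trans l (u n) (u m).
by rewrite (nrmC l) => ?; lra.
Qed.

Lemma tendsD u v l l' : tends u l -> tends v l' ->
  tends (fun n => u n + v n) (l + l').
Proof.
move=> ul vl e e0; have e2 : 0 < e / 2 by lra.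
have [N HN] := ul _ e2; have [N' HN'] := vl _ e2.
exists (maxn N N') => n; rewrite geq_max => /andP[/HN un /HN' vn].
rewrite opprD addrACA; have := nrmD (u n - l) (v n - l'); lra.
Qed.

Lemma tends_le u l c : tends u l -> (forall n, nrm (u n) <= c) -> nrm l <= c.
Proof.
move=> ul uc; apply/ler_addgt0Pr => e e0; have [N HN] := ul _ e0.
have := HN N (leqnn _); have := uc N; have := nrmD (u N) (l - u N).
rewrite addrC subrK nrmC => *; lra.
Qed.

Lemma tends_cst l : tends (fun=> l) l.
Proof. by move=> e e0; exists 0 => n _; rewrite subrr nrm0 ltW. Qed.

Lemma eq_tends u v l : u =1 v -> tends u l -> tends v l.
Proof. by move=> /funext->. Qed.

Lemma tends_shift u l N : tends u l -> tends (fun n => u (N + n)%N) l.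
Proof.
move=> ul e e0; have [M HM] := ul _ e0; exists M => n Mn.
by apply: HM; apply: leq_trans Mn _; apply: leq_addl.
Qed.

Lemma closure_nrm (S : set V) x :
  closure S x <-> forall e : R, 0 < e -> exists2 y, S y & nrm (x - y) <= e.
Proof.
split=> [Sx e e0|Sx U].
  have : nbhs x (ball x e%:C) by apply: nbhsx_ballx; rewrite ltr0C.
  move=> /Sx[y [Sy]]; rewrite -ball_normE /= => yx; exists y => //.
  by rewrite -nrm_le ltW.
case/nbhs_ballP => e /= e0 xU.
have e0' : 0 < complex.Re e by move: e0; case: (e) => a b; rewrite ltcE => /andP[].
have ee : e = (complex.Re e)%:C.
  by move: e0; case: (e) => a b; rewrite ltcE /= => /andP[/eqP->].
have [|y Sy xy] := Sx (complex.Re e / 2); first lra.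
exists y; split=> //; apply: xU; rewrite -ball_normE /= ee nrmE ltcR; lra.
Qed.

Lemma densely_spansP (S : set V) : densely_spans S <->
  forall x (e : R), 0 < e -> exists2 y, lspan S y & nrm (x - y) <= e.
Proof.
split=> [SV x|SV]; first by apply/closure_nrm; rewrite SV.
by rewrite /densely_spans -subTset => x _; apply/closure_nrm/SV.
Qed.

End RealNorm.

Lemma tendsZ (R : realType) (V : normedModType R[i]) k (u : nat -> V) l :
  tends u l -> tends (fun n => k *: u n) (k *: l).
Proof.
move=> ul e e0; have k0 : 0 <= complex.Re `|k|.
  by rewrite normc_def /= sqrtr_ge0.
have [|N HN] := ul (e / (complex.Re `|k| + 1)); first by rewrite divr_gt0 //; lra.
exists N => n /HN; rewrite ler_pdivlMr; last lra.
rewrite -scalerBr nrmZ; have := nrm_ge0 (u n - l); nra.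
Qed.

Lemma archi_inv (R : realType) (e : R) : 0 < e -> exists n, n.+1%:R^-1 <= e.
Proof.
move=> e0; exists (Num.truncn e^-1); rewrite invf_ple ?posrE //.
by rewrite ltW // truncnS_gt.
Qed.

Lemma archi_seq (R : realType) (e : R) : 0 < e ->
  exists N, forall n, (N <= n)%N -> n.+1%:R^-1 <= e.
Proof.
move=> /archi_inv[N HN]; exists N => n Nn; apply: le_trans HN.
by rewrite lef_pV2 ?posrE // ler_nat.
Qed.

Lemma ltC_realP (R : realType) (e : R[i]) :
  0 < e -> exists2 r : R, 0 < r & e = r%:C.
Proof.
case: e => a b; rewrite ltcE /= => /andP[/eqP-> a0].
by exists a => //; rewrite complexr0.
Qed.

Section Complete.
Context (R : realType).

Lemma complete_seq (V : completeNormedModType R[i]) (u : nat -> V) :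
  cauchyseq u -> exists l, tends u l.
Proof.
move=> cu.
have /cvg_ex[/= l ul] : cvg (u @ \oo).
  apply: cauchy_cvg; apply: cauchy_exP => _ /ltC_realP[e e0 ->].
  have [|N HN] := cu (e / 2); first lra.
  exists (u N); exists N => // n Nn; rewrite -ball_normE /= nrmE ltcR.
  have := HN N n (leqnn _) Nn; lra.
exists l => e e0.
have : nbhs l (ball l e%:C) by apply: nbhsx_ballx; rewrite ltr0C.
move=> /ul[N _ HN]; exists N => n /HN; rewrite -ball_normE /= nrmE ltcR nrmC.
exact: ltW.
Qed.

(** Completeness may be tested on sequences: a Cauchy filter contains balls of
    radius 1 / (n + 1), and the centers of such balls form a Cauchy sequence
    with the same limit. *)
Lemma seq_complete (V : normedModType R[i]) :
  (forall u : nat -> V, cauchyseq u -> exists l, tends u l) ->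
  forall F : set_system V, ProperFilter F -> cauchy F -> cvg F.
Proof.
move=> sV F FF /cauchyP cF.
have /choice[u Hu] n : exists x, F (ball x (n.+1%:R^-1 : R)%:C).
  by apply: cF; rewrite ltr0C.
have [|l ul] := sV u.
  move=> e e0; have [N HN] := @archi_seq _ (e / 2) ltac:(lra); exists N => n m.
  move=> Nn Nm; have [x []] := filter_ex (filterI (Hu n) (Hu m)).
  rewrite -ball_normE /= !nrmE !ltcR => xn xm.
  have := lt_le_trans xn (HN _ Nn); have := lt_le_trans xm (HN _ Nm).
  have := nrm_trans x (u n) (u m); rewrite (nrmC x); lra.
apply/cvg_ex; exists l => U /nbhs_ballP[_ /ltC_realP[e e0 ->] lU].
have [N HN] := ul (e / 2) ltac:(lra); have [M HM] := @archi_seq _ (e / 3) ltac:(lra).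
apply: filterS (Hu (maxn N M)) => x; rewrite -ball_normE /= nrmE ltcR => ux.
apply: lU; rewrite -ball_normE /= nrmE ltcR.
have := lt_le_trans ux (HM _ (leq_maxr N M)).
have := HN _ (leq_maxl N M); have := nrm_trans (u (maxn N M)) l x.
rewrite (nrmC l (u _)); lra.
Qed.

End Complete.

(** * The algebra of adjointable operators *)

Section OperatorRing.
Context (R : realType) (B : cstarAlgType R[i]) (E : hilbertModType B).
Implicit Types S T U : 'L(E).

Fact adj_comp1l : left_id (adj_id E) (@adj_comp _ B E).
Proof. by move=> T; exact: adjointable_eq. Qed.
Fact adj_comp1r : right_id (adj_id E) (@adj_comp _ B E).
Proof. by move=> T; exact: adjointable_eq. Qed.
Fact adj_compDl : left_distributive (@adj_comp _ B E) +%R.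
Proof. by move=> S T U; exact: adjointable_eq. Qed.
Fact adj_compDr : right_distributive (@adj_comp _ B E) +%R.
Proof.
move=> S T U; apply: adjointable_eq => x /=.
by have := adj_funP S 1 (T x) (U x); rewrite !scale1r.
Qed.

HB.instance Definition _ := GRing.Zmodule_isPzRing.Build 'L(E)
  (@adj_compA _ B E) adj_comp1l adj_comp1r adj_compDl adj_compDr.

Lemma opD S T x : (S + T) x = S x + T x. Proof. by []. Qed.
Lemma opZ k T x : (k *: T) x = k *: T x. Proof. by []. Qed.
Lemma opN T x : (- T) x = - T x. Proof. exact: scaleN1r. Qed.
Lemma opB S T x : (S - T) x = S x - T x. Proof. by rewrite opD opN. Qed.
Lemma opM S T x : (S * T) x = S (T x). Proof. by []. Qed.
Lemma op1 x : (1 : 'L(E)) x = x. Proof. by []. Qed.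
Lemma op0 x : (0 : 'L(E)) x = 0. Proof. by []. Qed.

Lemma op_add T x y : T (x + y) = T x + T y.
Proof. by have := adj_funP T 1 x y; rewrite !scale1r. Qed.
Lemma op_0 T : T 0 = 0.
Proof. by apply: (addrI (T 0)); rewrite -op_add !addr0. Qed.
Lemma op_scale T k x : T (k *: x) = k *: T x.
Proof. by have := adj_funP T k x 0; rewrite !addr0 op_0 addr0. Qed.
Lemma op_opp T x : T (- x) = - T x.
Proof. by rewrite -[- x]scaleN1r op_scale scaleN1r. Qed.
Lemma op_sub T x y : T (x - y) = T x - T y.
Proof. by rewrite op_add op_opp. Qed.
Lemma op_sum T n (f : 'I_n -> E) : T (\sum_(i < n) f i) = \sum_(i < n) T (f i).
Proof. by apply: (big_morph T (op_add T) (op_0 T)). Qed.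

Lemma opZl k S T : (k *: S) * T = k *: (S * T).
Proof. exact: adjointable_eq. Qed.
Lemma opZr k S T : S * (k *: T) = k *: (S * T).
Proof. by apply: adjointable_eq => x; rewrite opM !opZ op_scale. Qed.

Lemma starM S T : (S * T)^† = T^† * S^†. Proof. exact: astarM. Qed.
Lemma starD S T : (S + T)^† = S^† + T^†. Proof. exact: adjointable_eq. Qed.
Lemma star1 : (1 : 'L(E))^† = 1. Proof. exact: adjointable_eq. Qed.
Lemma star0 : (0 : 'L(E))^† = 0. Proof. exact: adjointable_eq. Qed.
Lemma starZ k T : (k *: T)^† = k^*%R *: T^†. Proof. exact: adjointable_eq. Qed.
Lemma conjrC (r : R) : (r%:C)^*%R = r%:C.
Proof. by apply/CrealP; rewrite complex_real. Qed.
Lemma starZr (r : R) T : (r%:C *: T)^† = r%:C *: T^†.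
Proof. by rewrite starZ conjrC. Qed.
Lemma starN T : (- T)^† = - T^†.
Proof. by rewrite -[- T]scaleN1r starZ rmorphN rmorph1 scaleN1r. Qed.
Lemma starB S T : (S - T)^† = S^† - T^†. Proof. by rewrite starD starN. Qed.
Lemma starKop T : T^†^† = T. Proof. exact: adjointable_eq. Qed.
Lemma starX T n : T^† = T -> (T ^+ n)^† = T ^+ n.
Proof.
move=> Tsa; elim: n => [|n IH]; first by rewrite expr0 star1.
by rewrite exprS starM IH Tsa -exprSr exprS.
Qed.

Lemma op_starP T x y : << T x | y >> = << x | T^† y >>.
Proof. exact: adj_opP. Qed.
Lemma op_starPl T x y : << T^† x | y >> = << x | T y >>.
Proof. exact: adj_opPl. Qed.

Lemma hinnerNl (x y : E) : << - x | y >> = - << x | y >>.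
Proof. by rewrite -[- x]scaleN1r hinnerZl rmorphN rmorph1 scaleN1r. Qed.
Lemma hinnerNr (x y : E) : << x | - y >> = - << x | y >>.
Proof. by rewrite -[- y]scaleN1r hinnerZr scaleN1r. Qed.
Lemma hinnerBl (x y z : E) : << x - y | z >> = << x | z >> - << y | z >>.
Proof. by rewrite hinnerDl hinnerNl. Qed.
Lemma hinner0l (x : E) : << 0 | x >> = 0.
Proof. by rewrite -(subrr 0) hinnerBl subrr. Qed.

(** The relation opnorm_le with a real constant, so that estimates take place in an
    ordered field. *)
Definition Nb T (c : R) := forall x, nrm (T x) <= c * nrm x.

Lemma NbP T c : opnorm_le T c%:C <-> Nb T c.
Proof.
by split=> Tc x; have := Tc x; rewrite !nrmE -rmorphM /= lecR.
Qed.

Lemma Nbw T c d : c <= d -> Nb T c -> Nb T d.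
Proof.
by move=> cd Tc x; apply: le_trans (Tc x) _; rewrite ler_wpM2r // nrm_ge0.
Qed.

Lemma NbD S T c d : Nb S c -> Nb T d -> Nb (S + T) (c + d).
Proof.
move=> Sc Td x; rewrite opD mulrDl; apply: le_trans (nrmD _ _) _.
exact: lerD.
Qed.

Lemma NbN T c : Nb T c -> Nb (- T) c.
Proof. by move=> Tc x; rewrite opN nrmN. Qed.

Lemma NbB S T c d : Nb S c -> Nb T d -> Nb (S - T) (c + d).
Proof. by move=> Sc /NbN; exact: NbD. Qed.

Lemma NbC S T c : Nb (S - T) c -> Nb (T - S) c.
Proof. by move=> /NbN; rewrite opprB. Qed.

Lemma NbM S T c d : 0 <= c -> Nb S c -> Nb T d -> Nb (S * T) (c * d).
Proof.
move=> c0 Sc Td x; rewrite opM -mulrA; apply: le_trans (Sc _) _.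
by rewrite ler_wpM2l.
Qed.

Lemma NbZ k T c : Nb T c -> Nb (k *: T) (complex.Re `|k| * c).
Proof.
move=> Tc x; rewrite opZ nrmZ -mulrA ler_wpM2l //.
by rewrite normc_def /= sqrtr_ge0.
Qed.

Lemma NbZr (r : R) T c : 0 <= r -> Nb T c -> Nb (r%:C *: T) (r * c).
Proof. by move=> r0 /NbZ - /(_ r%:C); rewrite ger0_norm ?ler0c. Qed.

Lemma Nb1 : Nb 1 1.
Proof. by move=> x; rewrite op1 mul1r. Qed.

Lemma Nb0 c : 0 <= c -> Nb 0 c.
Proof. by move=> c0 x; rewrite op0 nrm0 mulr_ge0 // nrm_ge0. Qed.

Lemma NbX T c n : 0 <= c -> Nb T c -> Nb (T ^+ n) (c ^+ n).
Proof.
move=> c0 Tc; elim: n => [|n IH]; first by rewrite !expr0; exact: Nb1.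
by rewrite !exprS; apply: NbM.
Qed.

Lemma Nb_eq0 T : (forall e, 0 < e -> Nb T e) -> T = 0.
Proof.
move=> T0; apply: adjointable_eq => x; rewrite op0.
by apply: (@nrm_eps_eq0 _ _ _ (nrm x)) => e /T0/(_ x); rewrite mulrC.
Qed.

Lemma opnorm_closureP (D : set 'L(E)) T : opnorm_closure D T <->
  forall e : R, 0 < e -> exists2 S, D S & Nb (T - S) e.
Proof.
split=> [DT e e0|DT _ /ltC_realP[e e0 ->]].
  have [|S DS /NbP TS] := DT e%:C; first by rewrite ltr0C.
  by exists S.
by have [S DS /NbP TS] := DT e e0; exists S.
Qed.

Section Lspan.
Context (V : lmodType R[i]) (D : set V).
Hypothesis HD : lspan D `<=` D.

Lemma lspan_lin k x y : D x -> D y -> D (k *: x + y).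
Proof.
move=> Dx Dy; apply: HD; exists 2, (fun i => if i == ord0 then k else 1).
exists (fun i => if i == ord0 then x else y); split=> [i|].
  by case: ifP.
by rewrite big_ord_recl big_ord1 /= scale1r.
Qed.
Lemma lspan_0 : D 0.
Proof.
apply: HD; exists 0, (fun=> 0), (fun=> 0); split=> [[]//|].
by rewrite big_ord0.
Qed.
Lemma lspan_D x y : D x -> D y -> D (x + y).
Proof. by move=> Dx Dy; rewrite -[x]scale1r; exact: lspan_lin. Qed.
Lemma lspan_Z k x : D x -> D (k *: x).
Proof. by move=> Dx; rewrite -[_ *: _]addr0; apply: lspan_lin lspan_0. Qed.
Lemma lspan_N x : D x -> D (- x).
Proof. by rewrite -scaleN1r; exact: lspan_Z. Qed.
Lemma lspan_B x y : D x -> D y -> D (x - y).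
Proof. by move=> Dx /lspan_N; exact: lspan_D. Qed.
End Lspan.

Lemma lin_lspan (V : lmodType R[i]) (D : set V) :
  D 0 -> (forall k x y, D x -> D y -> D (k *: x + y)) -> lspan D `<=` D.
Proof.
move=> D0 DP _ [n [c [w [Dw ->]]]].
elim: n c w Dw => [|n IH] c w Dw; first by rewrite big_ord0.
by rewrite big_ord_recl; apply: DP => //; apply: IH => i; exact: Dw.
Qed.

Lemma sub_lspan (V : lmodType R[i]) (D : set V) : D `<=` lspan D.
Proof.
move=> x Dx; exists 1, (fun=> 1), (fun=> x); split => //.
by rewrite big_ord1 scale1r.
Qed.

Lemma lspan_idem (V : lmodType R[i]) (D : set V) : lspan (lspan D) `<=` lspan D.
Proof.
apply: lin_lspan.
  by exists 0, (fun=> 0), (fun=> 0); split=> [[]//|]; rewrite big_ord0.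
move=> k _ _ [n [c [w [Dw ->]]]] [m [d [v [Dv ->]]]].
exists (n + m)%N.
exists (fun i => match fintype.split i with inl j => k * c j | inr j => d j end).
exists (fun i => match fintype.split i with inl j => w j | inr j => v j end).
split=> [i|]; first by case: (fintype.split i).
rewrite big_split_ord scaler_sumr /=; congr (_ + _); apply: eq_bigr => i _.
  by rewrite (unsplitK (inl i)) scalerA.
by rewrite (unsplitK (inr i)).
Qed.

End OperatorRing.

(** * Square roots and positivity of operators *)

(** The value at the scalar 1 of the iteration that computes square roots; it
    majorizes the iteration at every element of norm at most 1, and makes the
    rate of convergence explicit. *)
Fixpoint sqrt_iter1 (R : realType) (n : nat) : R :=
  if n is m.+1 then (1 + sqrt_iter1 R m ^+ 2) / 2 else 0.

Section SqrtIter1.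
Context (R : realType).
Local Notation tt := (sqrt_iter1 R).

Lemma sqrt_iter1_itv n : 0 <= tt n <= 1.
Proof. by elim: n => [|n /andP[? ?]] /=; apply/andP; split; nra. Qed.

Lemma sqrt_iter1_rate n : (1 - tt n) * n.+2%:R <= 2.
Proof.
elim: n => [|n IH] /=; first lra.
have /andP[t0 t1] := sqrt_iter1_itv n.
move: IH; rewrite -[n.+3%:R]natr1 -[n.+2%:R]natr1 -[n.+1%:R]natr1.
have : (0 : R) <= n%:R by [].
move: (n%:R : R) => N n0; set e := 1 - tt n => IH.
have -> : tt n = 1 - e by rewrite /e; lra.
have e0 : 0 <= e by rewrite /e; lra.
have e1 : e <= 1 by rewrite /e; lra.
(* 1 - tt n.+1 = e - e ^+ 2 / 2, which increases with e on [0, 1] *)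
nra.
Qed.

Lemma sqrt_iter1_cvg e : 0 < e -> exists N, 1 - tt N <= e.
Proof.
move=> e0; have [|N HN] := @archi_inv _ (e / 2); first lra.
exists N; have := sqrt_iter1_rate N; have /andP[_ t1] := sqrt_iter1_itv N.
have n0 : 0 < N.+1%:R :> R by [].
have n1 : N.+2%:R = N.+1%:R + 1 :> R by rewrite -natr1.
rewrite n1; move: HN; rewrite -[_^-1]mul1r ler_pdivrMr //; nra.
Qed.

End SqrtIter1.

Section OperatorNorm.
Context (R : realType) (B : cstarAlgType R[i]) (E : hilbertModType B).
(** Up to the positivity of c^† c the Cauchy-Schwarz inequality is a hypothesis.
    It is immediate for a C*-algebra as a module over itself; the results obtained
    there yield the general case, hilbert_CS. *)
Hypothesis CS : forall x y : E, nrm << x | y >> <= nrm x * nrm y.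
Implicit Types S T U : 'L(E).
Local Notation half := ((2^-1 : R)%:C).
Local Notation tt := (sqrt_iter1 R).

Lemma nrm_inner (x : E) : nrm << x | x >> = nrm x ^+ 2.
Proof. by apply: complexI; rewrite rmorphXn /= -!nrmE hnormE. Qed.

Lemma op_half_double T : half *: (T + T) = T.
Proof.
rewrite scalerDr -scalerDl -rmorphD /= (_ : 2^-1 + 2^-1 = 1) ?scale1r //; lra.
Qed.

Lemma Nb_star_mul T c : 0 <= c -> Nb (T^† * T) (c ^+ 2) -> Nb T c.
Proof.
move=> c0 Tc x; rewrite -(@ler_pXn2r _ 2) ?nnegrE ?mulr_ge0 ?nrm_ge0 //.
rewrite -nrm_inner op_starP exprMn.
apply: le_trans (CS _ _) _; have := Tc x; rewrite opM.
have := nrm_ge0 x; nra.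
Qed.

Lemma Nb_star T c : 0 <= c -> Nb T c -> Nb T^† c.
Proof.
move=> c0 Tc x; have := CS x (T (T^† x)); rewrite -op_starPl nrm_inner.
have := Tc (T^† x); have := nrm_ge0 x; have := nrm_ge0 (T^† x).
set a := nrm (T^† x); set b := nrm x => a0 b0 H1 H2.
have [->|an] := eqVneq a 0; first by rewrite mulr_ge0.
have ap : 0 < a by rewrite lt_def an.
rewrite -(ler_pM2r ap); nra.
Qed.

Lemma Nb_sq T c : 0 <= c -> T^† = T -> Nb (T * T) (c ^+ 2) -> Nb T c.
Proof. by move=> c0 Tsa H; apply: Nb_star_mul => //; rewrite Tsa. Qed.

(** Operators that form a Cauchy sequence converge; the adjoints converge with
    them, which makes the limit adjointable. *)
Lemma op_complete (T : nat -> 'L(E)) (e : nat -> R) :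
  (forall n, 0 <= e n) -> (forall d, 0 < d -> exists N, e N <= d) ->
  (forall n m, (n <= m)%N -> Nb (T m - T n) (e n)) ->
  exists T0, forall n, Nb (T0 - T n) (e n).
Proof.
move=> e0 ecvg Tc.
have cau (U : nat -> 'L(E)) x : (forall n m, (n <= m)%N -> Nb (U m - U n) (e n)) ->
    cauchyseq (fun n => U n x).
  move=> Uc d d0; have x0 := nrm_ge0 x.
  have [|N HN] := ecvg (d / 2 / (nrm x + 1)).
    by rewrite divr_gt0 //; lra.
  exists N => n m Nn Nm.
  have := Uc _ _ Nn x; have := Uc _ _ Nm x; rewrite !opB.
  have := nrm_trans (U N x) (U n x) (U m x); rewrite (nrmC (U N x) (U m x)).
  move: HN; rewrite ler_pdivlMr; last lra.
  have := e0 N; nra.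
have Tsc n m : (n <= m)%N -> Nb ((T m)^† - (T n)^†) (e n).
  by move=> nm; rewrite -starB; apply: Nb_star => //; exact: Tc.
have /choice[f Hf] x : exists l, tends (fun n => T n x) l.
  by apply: complete_seq; exact: cau.
have /choice[g Hg] x : exists l, tends (fun n => (T n)^† x) l.
  by apply: complete_seq; exact: (cau (fun n => (T n)^†)).
have fP x y : << f x | y >> = << x | g y >>.
  apply/eqP; rewrite -subr_eq0; apply/eqP.
  apply: (@nrm_eps_eq0 _ _ _ (nrm x + nrm y)) => d d0.
  have [N HN] := Hf x _ d0; have [M HM] := Hg y _ d0.
  have /HN := leq_maxl N M; have /HM := leq_maxr N M.
  set n := maxn N M => H1 H2.
  have -> : << f x | y >> - << x | g y >> =
      << f x - T n x | y >> + << x | (T n)^† y - g y >>.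
    by rewrite hinnerBl hinnerBr op_starP subrKA.
  apply: le_trans (nrmD _ _) _; have := CS (f x - T n x) y.
  have := CS x ((T n)^† y - g y); rewrite (nrmC (f x)).
  have := nrm_ge0 x; have := nrm_ge0 y; nra.
exists (Adjointable fP) => n x; rewrite opB /=.
apply: (@tends_le _ _ (fun m => T (n + m)%N x - T n x)) => [|m].
  by apply: tendsD; [exact: (@tends_shift _ _ (fun m => T m x))|exact: tends_cst].
by have := Tc _ _ (leq_addr m n) x; rewrite opB.
Qed.

(** T lies in the bicommutant of S. *)
Definition comm_all S T := forall U, U * S = S * U -> U * T = T * U.

(** The limit y solves y = (b + y ^+ 2) / 2, that is (1 - y) ^+ 2 = 1 - b. *)
Fixpoint sqrt_iter (b : 'L(E)) (n : nat) : 'L(E) :=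
  if n is m.+1 then half *: (b + sqrt_iter b m * sqrt_iter b m) else 0.

Section SqrtIter.
Variable b : 'L(E).
Hypotheses (b_sa : b^† = b) (b1 : Nb b 1).
Local Notation y := (sqrt_iter b).

Lemma sqrt_iter_sa n : (y n)^† = y n.
Proof.
by elim: n => [|n IH] /=; rewrite ?star0 // starZr starD starM IH b_sa.
Qed.

Lemma sqrt_iter_comm n : comm_all b (y n).
Proof.
move=> U Ub; elim: n => [|n IH] /=; first by rewrite mulr0 mul0r.
by rewrite opZl opZr mulrDl mulrDr Ub mulrA IH -mulrA IH mulrA.
Qed.

Lemma sqrt_iter_bound n : Nb (y n) (tt n).
Proof.
have t0 n' := proj1 (andP (sqrt_iter1_itv R n')).
elim: n => [|n IH] /=; first exact: Nb0.
by rewrite mulrC; apply: NbZr => //; apply: NbD => //; rewrite expr2; apply: NbM.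
Qed.

Lemma sqrt_iter_step n : Nb (y n.+1 - y n) (tt n.+1 - tt n).
Proof.
have t0 n' := proj1 (andP (sqrt_iter1_itv R n')).
elim: n => [|n IH].
  rewrite /= mulr0 addr0 !subr0 expr0n addr0 mulrC mulr1 -[X in Nb _ X]mulr1.
  exact: NbZr.
rewrite [y n.+2]/= [X in _ - X]/= -scalerBr opprD addrACA subrr add0r.
have -> : y n.+1 * y n.+1 - y n * y n =
    (y n.+1 - y n) * y n.+1 + y n * (y n.+1 - y n).
  by rewrite mulrBl mulrBr addrA subrK.
have -> : tt n.+2 - tt n.+1 = 2^-1 * ((tt n.+1 - tt n) * tt n.+1 +
    tt n * (tt n.+1 - tt n)).
  rewrite [tt n.+2]/= [X in _ - X]/= -[tt n.+1]/((1 + tt n ^+ 2) / 2); lra.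
have tinc : 0 <= tt n.+1 - tt n by have := sqrt_iter1_itv R n => /= /andP[]; nra.
apply: NbZr => //; apply: NbD; first by apply: NbM => //; exact: sqrt_iter_bound.
by apply: NbM => //; exact: sqrt_iter_bound.
Qed.

Lemma sqrt_iter_cauchy n m : (n <= m)%N -> Nb (y m - y n) (1 - tt n).
Proof.
move=> /subnKC <-; have /andP[_ t1] := sqrt_iter1_itv R (n + (m - n)).
apply: (@Nbw _ _ _ _ (tt (n + (m - n)) - tt n)); first lra.
elim: (m - n)%N => [|k IH]; first by rewrite addn0 !subrr; exact: Nb0.
rewrite addnS -(subrKA (y (n + k))) -(subrKA (tt (n + k))).
by apply: NbD => //; exact: sqrt_iter_step.
Qed.

End SqrtIter.

End OperatorNorm.

Section Positivity.
Context (R : realType) (B : cstarAlgType R[i]) (E : hilbertModType B).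
Hypothesis CS : forall x y : E, nrm << x | y >> <= nrm x * nrm y.
Implicit Types S T U a b p q : 'L(E).
Local Notation half := ((2^-1 : R)%:C).
Local Notation tt := (sqrt_iter1 R).

Definition opc (r : R) : 'L(E) := r%:C *: (1 : 'L(E)).

Lemma opcD r s : opc (r + s) = opc r + opc s.
Proof. by rewrite /opc rmorphD scalerDl. Qed.
Lemma opcB r s : opc (r - s) = opc r - opc s.
Proof. by rewrite opcD /opc rmorphN scaleNr. Qed.
Lemma opc1 : opc 1 = 1. Proof. by rewrite /opc rmorph1 scale1r. Qed.
Lemma opc0 : opc 0 = 0. Proof. by rewrite /opc rmorph0 scale0r. Qed.
Lemma opc_sa r : (opc r)^† = opc r. Proof. by rewrite /opc starZr star1. Qed.
Lemma opc_comm r T : opc r * T = T * opc r.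
Proof. by rewrite /opc opZl opZr mul1r mulr1. Qed.
Lemma opcZ r s : r%:C *: opc s = opc (r * s).
Proof. by rewrite /opc scalerA rmorphM. Qed.
Lemma opc_mulE r T : opc r * T = r%:C *: T.
Proof. by rewrite /opc opZl mul1r. Qed.
Lemma Nb_opc r : 0 <= r -> Nb (opc r) r.
Proof. by move=> r0; rewrite -[X in Nb _ X]mulr1; apply: NbZr r0 (@Nb1 _ _ _). Qed.

Definition bd T := exists2 c, 0 <= c & Nb T c.

Lemma bdD S T : bd S -> bd T -> bd (S + T).
Proof.
by move=> [c c0 Sc] [d d0 Td]; exists (c + d); [lra|exact: NbD].
Qed.
Lemma bdM S T : bd S -> bd T -> bd (S * T).
Proof.
by move=> [c c0 Sc] [d d0 Td]; exists (c * d); [nra|exact: NbM].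
Qed.
Lemma bdZ k T : bd T -> bd (k *: T).
Proof.
move=> [c c0 Tc]; exists (complex.Re `|k| * c); last exact: NbZ.
by rewrite mulr_ge0 // normc_def /= sqrtr_ge0.
Qed.
Lemma bdN T : bd T -> bd (- T).
Proof. by move=> [c c0 Tc]; exists c => //; exact: NbN. Qed.
Lemma bdB S T : bd S -> bd T -> bd (S - T).
Proof. by move=> Sb /bdN; exact: bdD. Qed.
Lemma bd_star T : bd T -> bd T^†.
Proof. by move=> [c c0 Tc]; exists c => //; exact: Nb_star. Qed.

Lemma Nb_lim T c : (forall e, 0 < e -> Nb T (c + e)) -> Nb T c.
Proof.
move=> Tc x; apply/ler_addgt0Pr => e e0; have x0 := nrm_ge0 x.
have e1 : 0 < e / (nrm x + 1) by rewrite divr_gt0 //; lra.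
apply: le_trans (Tc _ e1 x) _; rewrite mulrDl lerD2l.
rewrite -mulrA ler_piMr //; first exact: ltW.
by rewrite mulrC ler_pdivrMr; lra.
Qed.

(** A square root 1 - y of 1 - b, from the iteration sqrt_iter. The iterates are
    polynomials without constant term in b, so that y remains in a C*-subalgebra
    that contains b; in terms of 1 - b they are such polynomials up to a scalar,
    so that 1 - y remains in a C*-subalgebra that contains 1 - b. This
    covers subalgebras without unit. *)
Lemma sqrt_one_sub b : b^† = b -> Nb b 1 ->
  exists y, [/\ y^† = y, Nb y 1, (1 - y) * (1 - y) = 1 - b, comm_all b y &
    forall D, cstar_subalgebra D -> (D b -> D y) /\ (D (1 - b) -> D (1 - y))].
Proof.
move=> bsa b1; pose y := sqrt_iter b.
have t01 n := sqrt_iter1_itv R n.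
have [|d d0|n m nm|y0 Hy0] := @op_complete _ _ _ CS y (fun n => 1 - tt n).
- by move=> n; have /andP[] := t01 n; lra.
- exact: sqrt_iter1_cvg.
- exact: sqrt_iter_cauchy.
have apx e : 0 < e -> exists n, [/\ 1 - tt n <= e, Nb (y0 - y n) e & Nb (y0 - y n.+1) e].
  move=> e0; have [n Hn] := sqrt_iter1_cvg e0; exists n; split=> //.
    exact: Nbw (Hy0 n).
  apply: Nbw (Hy0 n.+1) => /=; have /andP[] := t01 n; nra.
have y0b : Nb y0 1 by have := Hy0 0; rewrite !subr0.
have ysa : y0^† = y0.
  apply/eqP; rewrite -subr_eq0; apply/eqP; apply: Nb_eq0 => e e0.
  have [|n [_ Hn _]] := apx (e / 2); first lra.
  rewrite -(subrKA (y n)) (_ : e = e / 2 + e / 2); last lra.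
  apply: NbD; last exact: NbC.
  have <- : (y n)^† = y n by exact: sqrt_iter_sa.
  by rewrite -starB; apply: Nb_star => //; lra.
have yeq : half *: (b + y0 * y0) = y0.
  apply/eqP; rewrite -subr_eq0; apply/eqP; apply: Nb_eq0 => e e0.
  have [|n [_ Hn Hn1]] := apx (e / 2); first lra.
  rewrite -(subrKA (y n.+1)) (_ : e = e / 2 + e / 2); last lra.
  apply: NbD; last exact: NbC.
  rewrite /y /= -/y -scalerBr opprD addrACA subrr add0r.
  have -> : y0 * y0 - y n * y n = (y0 - y n) * y0 + y n * (y0 - y n).
    by rewrite mulrBl mulrBr addrA subrK.
  rewrite (_ : e / 2 = 2^-1 * (e / 2 * 1 + 1 * (e / 2))); last lra.
  apply: NbZr; first lra; apply: NbD; apply: NbM => //; first lra.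
  apply: Nbw (sqrt_iter_bound b1 n).
  by have /andP[] := t01 n.
exists y0; split=> //.
- have : y0 + y0 = b + y0 * y0 by rewrite -(op_half_double (b + y0 * y0)) scalerDr yeq.
  move=> H; have -> : b = y0 + y0 - y0 * y0 by rewrite H addrK.
  by ncring.
- move=> U Ub; apply: adjointable_eq => x; apply: hinner_inj => z.
  rewrite !opM; apply/eqP; rewrite -subr_eq0; apply/eqP.
  apply: (@nrm_eps_eq0 _ _ _ (nrm (U^† z) * nrm x + nrm z * nrm (U x))) => e e0.
  have [n [_ Hn _]] := apx e e0.
  (* U need not be bounded; the approximation happens inside the inner product *)
  have -> : << z | U (y0 x) >> - << z | y0 (U x) >> =
      << U^† z | (y0 - y n) x >> - << z | (y0 - y n) (U x) >>.
    have yU : U * y n = y n * U by exact: sqrt_iter_comm.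
    by rewrite !opB !hinnerBr !op_starPl -[U (y n x)]opM yU opM; zmod.
  apply: le_trans (nrmB _ _) _; rewrite mulrDl; apply: lerD.
    apply: le_trans (CS _ _) _; rewrite -mulrA ler_wpM2l ?nrm_ge0 //.
    by rewrite mulrC; exact: Hn.
  apply: le_trans (CS _ _) _; rewrite -mulrA ler_wpM2l ?nrm_ge0 //.
  by rewrite mulrC; exact: Hn.
- move=> D [Dlin Dmul Dstar Dcl]; split=> [Db|D1b].
    apply: Dcl; apply/opnorm_closureP => e e0; have [n [_ Hn _]] := apx e e0.
    exists (y n) => //; elim: n {Hn} => [|n IH] /=; first exact: lspan_0.
    by apply: (lspan_Z Dlin); apply: (lspan_D Dlin) => //; exact: Dmul.
  apply: Dcl; apply/opnorm_closureP => e e0.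
  have [|n [Hn Hn' _]] := apx (e / 2); first lra.
  exists (opc (tt n) - y n); last first.
    rewrite (_ : _ - _ = opc (1 - tt n) + (y n - y0)); last first.
      by rewrite opcB opc1; zmod.
    rewrite (_ : e = e / 2 + e / 2); last lra.
    apply: NbD; last exact: NbC.
    by apply: Nbw Hn (Nb_opc _); have /andP[] := t01 n; lra.
  elim: n {Hn Hn'} => [|n IH]; first by rewrite /= opc0 subrr; exact: lspan_0.
  move Ec: (opc (tt n) - y n) IH => c IH.
  rewrite (_ : _ - _ = half *: (1 - b + ((tt n)%:C *: c + (tt n)%:C *: c) - c * c)).
    apply: (lspan_Z Dlin); apply: (lspan_B Dlin); last exact: Dmul.
    by do ![apply: (lspan_D Dlin) => //]; exact: (lspan_Z Dlin).
  rewrite -[(tt n)%:C *: c]opc_mulE -(op_half_double (opc (tt n.+1))) /y /= -/y -scalerBr.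
  congr (_ *: _); rewrite -opcD.
  have -> : opc (sqrt_iter1 R n.+1 + sqrt_iter1 R n.+1) = 1 + opc (tt n) * opc (tt n).
    by rewrite opc_mulE opcZ -opc1 -opcD /=; congr opc; lra.
  have -> : y n = opc (tt n) - c by rewrite -Ec; zmod.
  rewrite mulrBr !mulrBl -(opc_comm (tt n) c); ncring.
Qed.

End Positivity.

Arguments opc {R B E} r.

Section Kaplansky.
Context (R : realType) (B : cstarAlgType R[i]) (E : hilbertModType B).
Hypothesis CS : forall x y : E, nrm << x | y >> <= nrm x * nrm y.
Implicit Types S T U p q v w : 'L(E).
Local Notation half := ((2^-1 : R)%:C).

(** Positive operators, characterized by a norm inequality: this form is visibly
    stable under sums, and it is the hypothesis under which the square root
    iteration converges. *)
Definition posop T := T^† = T /\ exists2 t : R, 0 <= t & Nb (opc t - T) t.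

Lemma posop_sa T : posop T -> T^† = T. Proof. by case. Qed.

Lemma posopD S T : posop S -> posop T -> posop (S + T).
Proof.
move=> [Ssa [s s0 Ss]] [Tsa [t t0 Tt]]; split; first by rewrite starD Ssa Tsa.
exists (s + t); first lra.
by rewrite opcD (_ : _ - _ = opc s - S + (opc t - T)); [exact: NbD|zmod].
Qed.

Lemma posopZ (r : R) T : 0 <= r -> posop T -> posop (r%:C *: T).
Proof.
move=> r0 [Tsa [t t0 Tt]]; split; first by rewrite starZr Tsa.
exists (r * t); first nra.
by rewrite -opcZ -scalerBr; exact: NbZr.
Qed.

Lemma posop_bound T c : 0 <= c -> T^† = T -> Nb T c -> posop (opc c - T).
Proof.
move=> c0 Tsa Tc; split; first by rewrite starB opc_sa Tsa.
by exists c => //; rewrite opprB addrCA subrr addr0.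
Qed.

Lemma posop_bd T : posop T -> bd T.
Proof.
move=> [_ [t t0 Tt]]; exists (t + t); first lra.
rewrite (_ : T = opc t - (opc t - T)); last zmod.
by apply: NbB => //; exact: Nb_opc.
Qed.

Lemma posop0 : posop 0.
Proof. by split; [exact: star0|exists 0 => //; rewrite opc0 subrr; exact: Nb0]. Qed.

(** A square root of T is sqrt t (1 - y), where (1 - y) ^+ 2 = 1 - b with
    b = 1 - T / t. *)
Lemma posop_sqrt T : posop T -> exists S, [/\ S^† = S, S * S = T, comm_all T S,
  forall D, cstar_subalgebra D -> D T -> D S & posop S].
Proof.
move=> [Tsa [t0 t00 Tt0]]; pose t := t0 + 1; have tp : 0 < t by rewrite /t; lra.
have Tt : Nb (opc t - T) t.
  rewrite /t opcD addrAC; apply: NbD => //; exact: Nb_opc.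
have ti : 0 <= t^-1 by rewrite invr_ge0 ltW.
pose b := 1 - t^-1%:C *: T.
have bsa : b^† = b by rewrite /b starB star1 starZr Tsa.
have b1 : Nb b 1.
  rewrite /b -(mulVf (lt0r_neq0 tp)) -opc1 -(mulVf (lt0r_neq0 tp)) -opcZ -scalerBr.
  exact: NbZr.
have [y [ysa y1 yy ycomm yD]] := sqrt_one_sub CS bsa b1.
pose s := Num.sqrt t; have ss : s * s = t by rewrite -expr2 sqr_sqrtr // ltW.
have s0 : 0 <= s by exact: sqrtr_ge0.
have posy : posop (1 - y).
  by rewrite -opc1; apply: posop_bound.
exists (s%:C *: (1 - y)); split.
- by rewrite starZr starB star1 ysa.
- rewrite opZl opZr scalerA yy -rmorphM ss /b opprB addrCA subrr addr0 scalerA.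
  by rewrite -rmorphM mulfV ?scale1r // lt0r_neq0.
- move=> U UT; rewrite opZl opZr; congr (_ *: _).
  have /ycomm yU : U * b = b * U by rewrite /b mulrBl mulrBr opZl opZr UT mulr1 mul1r.
  by rewrite mulrBl mulrBr yU mulr1 mul1r.
- move=> D Dc DT; have [Dlin _ _ _] := Dc; apply: (lspan_Z Dlin); apply: (yD D Dc).2.
  by rewrite /b opprB addrCA subrr addr0; exact: (lspan_Z Dlin).
- exact: posopZ.
Qed.

(** Two commuting self-adjoint operators are the real and imaginary parts of a
    normal operator u, and u^† u is the sum of their squares. *)
Lemma Nb_sum_sq p q c : 0 <= c -> p^† = p -> q^† = q -> p * q = q * p ->
  Nb (p * p + q * q) (c ^+ 2) -> Nb p c.
Proof.
move=> c0 psa qsa pq pqc; pose u := p + 'i%C *: q.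
have us : u^† = p - 'i%C *: q.
  rewrite /u starD starZ psa qsa -scaleNr; congr (_ + _ *: _).
  by apply/eqP; rewrite eq_complex /= !oppr0 !eqxx.
have ii : 'i%C * 'i%C = -1 :> R[i] by rewrite -expr2 sqr_i.
have uc : Nb u c.
  apply: (Nb_star_mul CS c0); rewrite us (_ : _ * _ = p * p + q * q) //.
  rewrite /u mulrDr !mulrBl opZr opZl opZl opZr scalerA ii scaleN1r pq opprK.
  by ncring.
have uc' := Nb_star CS c0 uc.
rewrite -(op_half_double p) (_ : p + p = u + u^†); last by rewrite us /u; zmod.
have -> : c = 2^-1 * (c + c) by lra.
by apply: NbZr; [lra|exact: NbD].
Qed.

(** Scale p to norm at most 1, and let (1 - y) ^+ 2 = 1 - p ^+ 2. The squares of
    the commuting operators p and 1 - y add up to 1, so that 1 - y has norm at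
    most 1, and so has 1 - p ^+ 2. *)
Lemma posop_sq p : p^† = p -> bd p -> posop (p * p).
Proof.
move=> psa [c c0 pc]; split; first by rewrite starM psa.
pose d := c + 1; have dp : 0 < d by rewrite /d; lra.
have di : 0 <= d^-1 by rewrite invr_ge0 ltW.
pose a := d^-1%:C *: p.
have asa : a^† = a by rewrite /a starZr psa.
have a1 : Nb a 1.
  rewrite -(mulVf (lt0r_neq0 dp)); apply: NbZr => //; apply: Nbw pc.
  rewrite /d; lra.
have aa1 : Nb (a * a) 1 by rewrite -[X in Nb _ X]mulr1; exact: NbM.
have aasa : (a * a)^† = a * a by rewrite starM asa.
have [y [ysa y1 yy ycomm _]] := sqrt_one_sub CS aasa aa1.
have ay : a * y = y * a by apply: ycomm; rewrite mulrA.
have H : Nb (1 - y) 1.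
  apply: (@Nb_sum_sq _ a) => //; first by rewrite starB star1 ysa.
    by rewrite mulrBl mulrBr mulr1 mul1r ay.
  by rewrite yy subrK expr1n; exact: Nb1.
have : Nb ((1 - y) * (1 - y)) 1 by rewrite -[X in Nb _ X]mulr1; exact: NbM.
rewrite yy /a opZl opZr scalerA -rmorphM => /(NbZr (sqr_ge0 d)) K.
exists (d ^+ 2); first exact: sqr_ge0.
move: K; rewrite scalerBr scalerA -rmorphM mulr1 -invfM -expr2 mulfV ?scale1r //.
by rewrite expf_neq0 // lt0r_neq0.
Qed.

(** With T = k ^+ 2 and c - T = v ^+ 2, the squares of the commuting operators k
    and v add up to c. *)
Lemma posop_le T c : 0 <= c -> posop T -> posop (opc c - T) -> Nb T c.
Proof.
move=> c0 Tp cTp; have [k [ksa kk kcomm _ _]] := posop_sqrt Tp.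
have [v [vsa vv vcomm _ _]] := posop_sqrt cTp.
pose r := Num.sqrt c; have rr : r ^+ 2 = c by rewrite sqr_sqrtr.
rewrite -rr -kk expr2; have r0 : 0 <= r by exact: sqrtr_ge0.
have kr : Nb k r; last exact: NbM.
apply: (@Nb_sum_sq _ v) => //.
  apply: vcomm; rewrite mulrBl mulrBr -(opc_comm c) -kk; ncring.
by rewrite kk vv addrCA subrr addr0 rr; exact: Nb_opc.
Qed.

Lemma posop_mono S T c : 0 <= c -> posop T -> posop (S - T) -> Nb S c -> Nb T c.
Proof.
move=> c0 Tp STp Sc; apply: posop_le => //.
rewrite (_ : _ - _ = (opc c - S) + (S - T)); last zmod.
apply: posopD => //; apply: posop_bound => //.
have /posop_sa := posopD STp Tp; rewrite subrK //.
Qed.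

Lemma bd_sa_sq_eq0 w : w^† = w -> w * w = 0 -> w = 0.
Proof.
move=> wsa ww; apply: Nb_eq0 => e e0; apply: (Nb_star_mul CS); first exact: ltW.
by rewrite wsa ww; apply: Nb0; rewrite exprn_ge0 // ltW.
Qed.

(** For self-adjoint b the norm of b ^+ 2 is the square of the norm of b. *)
Lemma Nb_root (b : 'L(E)) r j : 0 <= r -> b^† = b ->
  Nb (b ^+ (2 ^ j)) (r ^+ (2 ^ j)) -> Nb b r.
Proof.
move=> r0 bsa; elim: j => [|j IH]; first by rewrite !expr1.
rewrite expnS mul2n -addnn !exprD => H; apply: IH.
by apply: (Nb_sq CS); [exact: exprn_ge0|exact: starX|rewrite expr2].
Qed.

Lemma exp_dominates (C e : R) : 0 <= C -> 0 < e ->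
  exists j, 1 + (2 ^ j)%:R * C <= (1 + e) ^+ (2 ^ j).
Proof.
move=> C0 e0; have [|i Hi] := @archi_inv _ (e ^+ 2 / (2 * C + 1)).
  by rewrite divr_gt0 ?exprn_gt0 //; lra.
have m0 : i.+1%:R <= (2 ^ i.+1)%:R :> R by rewrite ler_nat ltnW // ltn_expl.
exists i.+2; rewrite expnS mulnC exprM natrM.
have bern n : 1 + n%:R * e <= (1 + e) ^+ n.
  elim: n => [|n IH]; first by rewrite expr0; lra.
  rewrite exprSr -natr1; have n0 : (0 : R) <= n%:R by [].
  have := ler_wpM2r (_ : 0 <= 1 + e) IH; nra.
have := bern (2 ^ i.+1)%N; move: ((2 ^ i.+1)%:R : R) m0 => m m0.
move: ((1 + e) ^+ _) => X HX.
have i0 : 0 < i.+1%:R :> R by [].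
have Hm : 2 * C + 1 <= m * e ^+ 2.
  move: Hi; rewrite -[_^-1]mul1r ler_pdivrMr // mulrAC ler_pdivlMr; last lra.
  have e2 : 0 <= e ^+ 2 by exact: sqr_ge0.
  nra.
have : 0 <= m by lra.
have : 0 <= m * e by nra.
move=> me0 mm0; have : (1 + m * e) ^+ 2 <= X ^+ 2 by rewrite ler_pXn2r ?nnegrE //; lra.
nra.
Qed.

(** The essential step in the positivity of c^† c. With d^† d = - w ^+ 2 and
    d d^† positive, the powers of b = 1 + w ^+ 2 / t satisfy
    d^† (1 - d d^† / t) ^+ k d = - w ^+ 2 b ^+ k, so that they grow at most
    linearly; as b is self-adjoint its norm is then at most 1, which makes
    - w ^+ 2 positive as well. *)
Lemma star_mul_neg_sq (d w : 'L(E)) : bd d -> bd w -> w^† = w ->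
  d^† * d = - (w * w) -> w = 0.
Proof.
move=> db wb wsa dd.
have ddp : posop (d * d^†).
  (* p and q are the real and imaginary parts of d, up to scalars; they satisfy
     d d^† + d^† d = (p ^+ 2 + q ^+ 2) / 2 *)
  pose p := d + d^†; pose q := 'i%C *: (d - d^†).
  have ii : 'i%C * 'i%C = -1 :> R[i] by rewrite -expr2 sqr_i.
  have dsb := bd_star CS db.
  have pp : posop (p * p).
    by apply: posop_sq; [rewrite /p starD starKop addrC|exact: bdD].
  have qq : posop (q * q).
    apply: posop_sq; last by apply: bdZ; exact: bdB.
    rewrite /q starZ starB starKop -opprB scalerN -scaleNr; congr (_ *: _).
    by apply/eqP; rewrite eq_complex /= !oppr0 opprK !eqxx.
  have ww := posop_sq wsa wb.
  have h0 : (0 : R) <= 2^-1 by lra.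
  have -> : d * d^† = half *: (p * p + q * q) + w * w; last first.
    by apply: posopD => //; apply: posopZ => //; exact: posopD.
  have -> : p * p + q * q = (d * d^† - w * w) + (d * d^† - w * w).
    rewrite -dd /q opZl opZr scalerA ii scaleN1r /p; ncring.
  by rewrite op_half_double subrK.
have [_ [t0 t00 Tt0]] := ddp; pose t := t0 + 1; have tp : 0 < t by rewrite /t; lra.
have Tt : Nb (opc t - d * d^†) t.
  rewrite /t opcD addrAC; apply: NbD => //; exact: Nb_opc.
have ti : 0 <= t^-1 by rewrite invr_ge0 ltW.
pose g := 1 - t^-1%:C *: (d * d^†); pose b := 1 + t^-1%:C *: (w * w).
have g1 : Nb g 1.
  rewrite /g -(mulVf (lt0r_neq0 tp)) -opc1 -(mulVf (lt0r_neq0 tp)) -opcZ -scalerBr.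
  exact: NbZr.
have gd : g * d = d * b.
  rewrite /g /b mulrBl mulrDr mul1r mulr1 opZl opZr -mulrA dd mulrN scalerN.
  by rewrite opprK.
have gdk k : g ^+ k * d = d * b ^+ k.
  elim: k => [|k IH]; first by rewrite !expr0 mul1r mulr1.
  by rewrite exprS -mulrA IH mulrA gd -mulrA -exprS.
have [c c0 dc] := db.
have wbk k : Nb (w * w * b ^+ k) (c * c).
  rewrite -[w * w]opprK -dd mulNr -mulrA -gdk; apply: NbN; apply: NbM => //.
    exact: Nb_star.
  rewrite -[X in Nb _ X]mul1r; apply: NbM => //.
  by have := NbX k ler01 g1; rewrite expr1n.
pose C := t^-1 * (c * c); have C0 : 0 <= C by rewrite /C; nra.
have bsa : b^† = b by rewrite /b starD star1 starZr starM wsa.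
have bk k : Nb (b ^+ k) (1 + k%:R * C).
  elim: k => [|k IH]; first by rewrite expr0 mul0r addr0; exact: Nb1.
  rewrite exprS {1}/b mulrDl mul1r opZl -natr1 mulrDl mul1r addrA.
  by apply: NbD => //; apply: NbZr.
have b1 : Nb b 1.
  apply: Nb_lim => e e0; have [j Hj] := exp_dominates C0 e0.
  by apply: (@Nb_root b _ j) => //; [lra|exact: Nbw Hj (bk _)].
have [y [ysa y1 yy ycomm _]] := sqrt_one_sub CS bsa b1.
pose s := Num.sqrt t^-1; have ss : s * s = t^-1 by rewrite -expr2 sqr_sqrtr.
have wy : w * y = y * w.
  by apply: ycomm; rewrite /b mulrDr mulrDl mulr1 mul1r opZl opZr mulrA.
have y0 : 1 - y = 0.
  apply: Nb_eq0 => e e0.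
  apply: (@Nb_sum_sq _ (s%:C *: w)); first exact: ltW.
  - by rewrite starB star1 ysa.
  - by rewrite starZr wsa.
  - by rewrite opZl opZr mulrBl mulrBr mul1r mulr1 wy.
  rewrite yy opZl opZr scalerA -rmorphM ss /b opprD addrA subrr add0r addNr.
  by apply: Nb0; rewrite exprn_ge0 // ltW.
apply: bd_sa_sq_eq0 => //.
move: yy; rewrite y0 mul0r /b opprD addrA subrr add0r => /esym/eqP.
rewrite oppr_eq0 => /eqP /(congr1 (fun T => t%:C *: T)).
by rewrite scaler0 scalerA -rmorphM mulfV ?lt0r_neq0 // scale1r.
Qed.

(** With r = |a|, n is twice the negative part of a, and w ^+ 2 = r n ^+ 2. *)
Lemma negative_part (a : 'L(E)) : a^† = a -> bd a -> exists n v w,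
  [/\ [/\ n^† = n, v^† = v & w^† = w], [/\ bd n, bd v & bd w],
      n * a * n = - (w * w), (w = 0 -> a = v * v) &
      forall D, cstar_subalgebra D -> D a -> [/\ D n, D v & D w]].
Proof.
move=> asa ab; have aap := posop_sq asa ab.
have [r [rsa rr rcomm rD rp]] := posop_sqrt aap.
have [v [vsa vv vcomm vD vp]] := posop_sqrt rp.
have ar : a * r = r * a by apply: rcomm; rewrite mulrA.
have va : a * v = v * a by apply: vcomm.
have vr : r * v = v * r by apply: vcomm.
pose n := r - a; have nsa : n^† = n by rewrite /n starB rsa asa.
have nv : n * v = v * n by rewrite /n mulrBl mulrBr va vr.
have nb : bd n by apply: bdB => //; exact: posop_bd.
have vb : bd v by exact: posop_bd.
have nan : n * a = - (r * n).
  by rewrite /n mulrBl mulrBr -rr opprB.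
have ww : v * n * (v * n) = r * n * n by rewrite -vv -!mulrA (mulrA n) nv -!mulrA.
exists n, v, (v * n); split => //.
- by split=> //; rewrite starM vsa nsa nv.
- by split=> //; exact: bdM.
- by rewrite nan ww mulNr.
- move=> w0; have rnn : r * n * n = 0 by rewrite -ww w0 mul0r.
  have nn : n * n = r * n + r * n.
    rewrite /n mulrBl !mulrBr ar rr; ncring.
  have nnn : n * n * n = 0 by rewrite nn mulrDl rnn addr0.
  have n20 : n * n = 0.
    apply: bd_sa_sq_eq0; first by rewrite starM nsa.
    by rewrite mulrA nnn mul0r.
  have /eqP := bd_sa_sq_eq0 nsa n20; rewrite subr_eq0 => /eqP <-.
  by rewrite vv.
- move=> D Dc Da; have [Dlin Dmul _ _] := Dc.
  have Dr : D r by apply: rD => //; exact: Dmul.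
  have Dn : D n by apply: (lspan_B Dlin).
  by split=> //; [exact: vD|apply: Dmul => //; exact: vD].
Qed.

(** For n and w as in negative_part, (c n)^† (c n) = - w ^+ 2, so that w = 0. *)
Lemma posop_star_mul (c : 'L(E)) : bd c -> posop (c^† * c).
Proof.
move=> cb; have asa : (c^† * c)^† = c^† * c by rewrite starM starKop.
have ab : bd (c^† * c) by apply: bdM => //; exact: bd_star.
have [n [v [w [[nsa vsa wsa] [nb vb wb] nan w0 _]]]] := negative_part asa ab.
rewrite w0; first exact: posop_sq.
apply: (@star_mul_neg_sq (c * n)) => //; first exact: bdM.
by rewrite starM nsa -nan !mulrA.
Qed.

Lemma posop_conj T (c : 'L(E)) : posop T -> bd c -> posop (c^† * T * c).
Proof.
move=> Tp cb; have [s [ssa ss _ _ sp]] := posop_sqrt Tp.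
rewrite -ss (_ : _ * c = (s * c)^† * (s * c)); last by rewrite starM ssa !mulrA.
by apply: posop_star_mul; apply: bdM => //; exact: posop_bd.
Qed.

Lemma posop_oppK T : posop T -> posop (- T) -> T = 0.
Proof.
move=> Tp NTp; apply: Nb_eq0 => e e0; apply: Nbw (posop_le (lexx 0) Tp _).
  exact: ltW.
by rewrite opc0 add0r.
Qed.

End Kaplansky.

(** * Positivity in C*-algebras *)

Section StarAlgebraTheory.
Context (K : numClosedFieldType) (A : starAlgType K).
Implicit Types a b c : A.

Lemma amulDl a b c : (a + b) ** c = a ** c + b ** c.
Proof. by have := amul_linearl c 1 a b; rewrite /= !scale1r. Qed.
Lemma amulDr a b c : a ** (b + c) = a ** b + a ** c.
Proof. by have := amul_linearr a 1 b c; rewrite !scale1r. Qed.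
Lemma amul0 a : a ** 0 = 0.
Proof. by apply: (addrI (a ** 0)); rewrite -amulDr !addr0. Qed.
Lemma amul0l a : 0 ** a = 0.
Proof. by apply: (addrI (0 ** a)); rewrite -amulDl !addr0. Qed.
Lemma amulZl k a b : (k *: a) ** b = k *: (a ** b).
Proof. by have := amul_linearl b k a 0; rewrite /= !addr0 amul0l addr0. Qed.
Lemma amulZr k a b : a ** (k *: b) = k *: (a ** b).
Proof. by have := amul_linearr a k b 0; rewrite !addr0 amul0 addr0. Qed.
Lemma astarN a : (- a)^† = - a^†.
Proof. by rewrite -[- a]scaleN1r astarZ rmorphN rmorph1 scaleN1r. Qed.
Lemma astarB a b : (a - b)^† = a^† - b^†.
Proof. by rewrite astarD astarN. Qed.

Lemma amul_correct (env : seq A) e1 e2 :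
  nc_null (nc_expand (NcAdd e1 (NcOpp e2))) ->
  nc_eval (@amul K A) env e1 = nc_eval (@amul K A) env e2.
Proof.
by apply: nc_correct => [a b c|a b c|a b c];
  [exact: amulA|exact: amulDl|exact: amulDr].
Qed.

End StarAlgebraTheory.

(** The analogue of [ncring] for the product of a *-algebra. *)
Ltac star_mul e := lazymatch e with (?a ** ?b)%R => constr:((a, b)) end.
Ltac star_close l e1 e2 := exact (@amul_correct _ _ l e1 e2 isT).
Ltac starring := nc_solve star_mul star_close.

Section StarHom.
Context (R : realType) (A : cstarAlgType R[i]).

Lemma star_homD (D : starAlgType R[i]) (f : A -> D) : star_hom f ->
  forall a b, f (a + b) = f a + f b.
Proof. by case=> fl _ _ a b; have := fl 1 a b; rewrite !scale1r. Qed.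
Lemma star_hom0 (D : starAlgType R[i]) (f : A -> D) : star_hom f -> f 0 = 0.
Proof. by move=> fh; apply: (addrI (f 0)); rewrite -star_homD // !addr0. Qed.
Lemma star_homZ (D : starAlgType R[i]) (f : A -> D) : star_hom f ->
  forall k a, f (k *: a) = k *: f a.
Proof.
move=> fh k a; have [fl _ _] := fh; have := fl k a 0.
by rewrite (star_hom0 fh) !addr0.
Qed.
Lemma star_homN (D : starAlgType R[i]) (f : A -> D) : star_hom f ->
  forall a, f (- a) = - f a.
Proof. by move=> fh a; rewrite -[- a]scaleN1r star_homZ // scaleN1r. Qed.
Lemma star_homB (D : starAlgType R[i]) (f : A -> D) : star_hom f ->
  forall a b, f (a - b) = f a - f b.
Proof. by move=> fh a b; rewrite star_homD // star_homN. Qed.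
Lemma star_homM (D : starAlgType R[i]) (f : A -> D) : star_hom f ->
  forall a b, f (a ** b) = f a ** f b.
Proof. by case. Qed.
Lemma star_hom_star (D : starAlgType R[i]) (f : A -> D) : star_hom f ->
  forall a, f a^† = (f a)^†.
Proof. by case. Qed.

(** The range is closed because an isometry takes a convergent sequence of its
    values back to a Cauchy sequence. *)
Lemma range_subalgebra (B : cstarAlgType R[i]) (E : hilbertModType B)
    (f : A -> 'L(E)) : star_hom f -> (forall a, Nb (f a) (nrm a)) ->
  (forall a c, 0 <= c -> Nb (f a) c -> nrm a <= c) -> cstar_subalgebra (range f).
Proof.
move=> fh fb bf; split.
- apply: lin_lspan; first by exists 0; rewrite ?star_hom0.
  move=> k _ _ [a _ <-] [b _ <-]; exists (k *: a + b) => //.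
  by rewrite star_homD // star_homZ.
- by move=> _ _ [a _ <-] [b _ <-]; exists (a ** b); rewrite ?star_homM.
- by move=> _ [a _ <-]; exists a^†; rewrite ?star_hom_star.
move=> T /opnorm_closureP HT.
have /choice[u Hu] n : exists a, Nb (T - f a) n.+1%:R^-1.
  by have [|_ [a _ <-] ?] := HT n.+1%:R^-1; [|exists a].
have uT e : 0 < e -> exists N, forall n, (N <= n)%N -> Nb (T - f (u n)) e.
  move=> e0; have [N HN] := archi_seq e0; exists N => n Nn.
  exact: Nbw (HN n Nn) (Hu n).
have [|a ua] := @complete_seq _ A u.
  move=> e e0; have [|N HN] := uT (e / 2); first lra.
  exists N => n m /HN un /HN um; apply: bf; first exact: ltW.
  rewrite star_homB // (_ : _ - _ = (T - f (u m)) - (T - f (u n))); last zmod.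
  by apply: Nbw (NbB um un); lra.
exists a => //; apply/eqP; rewrite -subr_eq0; apply/eqP; apply: Nb_eq0 => e e0.
have [|N HN] := uT (e / 2); first lra.
have [|N' HN'] := ua (e / 2); first lra.
pose n := maxn N N'.
rewrite -(subrKA (f (u n))) addrC (_ : e = e / 2 + e / 2); last lra.
apply: NbD; first by apply: NbC; apply: HN; exact: leq_maxl.
rewrite -star_homB //; apply: Nbw (fb _); rewrite nrmC; apply: HN'.
exact: leq_maxr.
Qed.

End StarHom.

Section LeftMultiplication.
Context (R : realType) (A : cstarAlgType R[i]).
Implicit Types a b x : A.
Local Notation M := (regular_module A : hilbertModType A).

Lemma nrmM a b : nrm (a ** b) <= nrm a * nrm b.
Proof. by rewrite -lecR rmorphM /= -!nrmE cnormM. Qed.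

Lemma nrm_star_mul a : nrm (a^† ** a) = nrm a ^+ 2.
Proof. by apply: complexI; rewrite rmorphXn /= -!nrmE cnorm_star. Qed.

Lemma nrm_star a : nrm a^† = nrm a.
Proof.
have H b : nrm b <= nrm b^†.
  have [->|b0] := eqVneq (nrm b) 0; first exact: nrm_ge0.
  have bp : 0 < nrm b by rewrite lt_def b0 nrm_ge0.
  by rewrite -(ler_pM2r bp) -expr2 -nrm_star_mul nrmM.
by apply/eqP; rewrite eq_le H andbT; have := H a^†; rewrite astarK.
Qed.

Lemma regular_CS (x y : M) : nrm << x | y >> <= nrm x * nrm y.
Proof. by rewrite -(nrm_star (x : A)); exact: (nrmM (x : A)^† (y : A)). Qed.

Fact lmul_subproof a (x y : M) : << (a ** x : M) | y >> = << x | (a^† ** y : M) >>.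
Proof. by rewrite /hinner /= astarM amulA. Qed.

(** Left multiplication represents A on itself; it supplies the unit that A may
    lack. *)
Definition lmul a : 'L(M) := Adjointable (lmul_subproof a).

Lemma lmulE a (x : M) : lmul a x = (a ** x : A). Proof. by []. Qed.
Lemma lmulM a b : lmul (a ** b) = lmul a * lmul b.
Proof. by apply: adjointable_eq => x; rewrite opM !lmulE amulA. Qed.
Lemma lmulP k a b : lmul (k *: a + b) = k *: lmul a + lmul b.
Proof. by apply: adjointable_eq => x; rewrite opD opZ !lmulE amulDl amulZl. Qed.
Lemma lmulD a b : lmul (a + b) = lmul a + lmul b.
Proof. by have := lmulP 1 a b; rewrite !scale1r. Qed.
Lemma lmulZ k a : lmul (k *: a) = k *: lmul a.
Proof. by apply: adjointable_eq => x; rewrite opZ !lmulE amulZl. Qed.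
Lemma lmulN a : lmul (- a) = - lmul a.
Proof. by rewrite -[- a]scaleN1r lmulZ scaleN1r. Qed.
Lemma lmulB a b : lmul (a - b) = lmul a - lmul b.
Proof. by rewrite lmulD lmulN. Qed.
Lemma lmul_star a : lmul a^† = (lmul a)^†.
Proof. exact: adjointable_eq. Qed.

Lemma Nb_lmul a : Nb (lmul a) (nrm a).
Proof. by move=> x; exact: (nrmM a (x : A)). Qed.

Lemma lmul_Nb a (c : R) : 0 <= c -> Nb (lmul a) c -> nrm a <= c.
Proof.
move=> c0 /(_ (a^† : M)); rewrite lmulE.
have -> : nrm (a ** a^† : M) = nrm (a ** a^†) by [].
have -> : nrm (a^† : M) = nrm a^† by [].
rewrite -{1}(astarK a) nrm_star_mul nrm_star expr2.
have := nrm_ge0 a; have [->//|a0 ?] := eqVneq (nrm a) 0.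
by rewrite ler_pM2r // lt_def a0.
Qed.

Lemma lmul_inj a b : lmul a = lmul b -> a = b.
Proof.
move=> ab; apply/eqP; rewrite -subr_eq0; apply/eqP/nrm_le0.
by apply: lmul_Nb => //; rewrite lmulB ab subrr; exact: Nb0.
Qed.

Lemma lmul0 : lmul 0 = 0.
Proof. by apply: adjointable_eq => x; rewrite lmulE amul0l. Qed.

Lemma bd_lmul a : bd (lmul a).
Proof. by exists (nrm a); [exact: nrm_ge0|exact: Nb_lmul]. Qed.

Lemma lmul_hom : star_hom lmul.
Proof.
by split=> [k a b|a b|a]; [exact: lmulP|rewrite lmulM|rewrite lmul_star].
Qed.

Lemma range_lmul_subalgebra : cstar_subalgebra (range lmul).
Proof. exact: range_subalgebra lmul_hom Nb_lmul lmul_Nb. Qed.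

(** Square roots remain in the range of lmul, so that a positive lmul a has a
    square root in A. *)
Lemma cpos_posop a : cpositive a <-> posop (lmul a).
Proof.
split=> [[c ->]|ap].
  rewrite lmulM lmul_star; apply: (posop_star_mul regular_CS).
  exact: bd_lmul.
have [s [ssa ss _ sD _]] := posop_sqrt regular_CS ap.
have [|c _ cs] := sD _ range_lmul_subalgebra; first by exists a.
exists c; apply: lmul_inj; rewrite lmulM lmul_star cs ssa //.
Qed.

Lemma cpos_sa a : cpositive a -> a^† = a.
Proof. by move=> [c ->]; rewrite astarM astarK. Qed.

Lemma cpos_star_mul a : cpositive (a^† ** a). Proof. by exists a. Qed.

Lemma cposD a b : cpositive a -> cpositive b -> cpositive (a + b).
Proof. by rewrite !cpos_posop lmulD; exact: posopD. Qed.

Lemma cposZ (r : R) a : 0 <= r -> cpositive a -> cpositive (r%:C *: a).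
Proof. by rewrite !cpos_posop lmulZ; exact: posopZ. Qed.

Lemma cpos_oppK a : cpositive a -> cpositive (- a) -> a = 0.
Proof.
rewrite !cpos_posop lmulN => ap Nap; apply: lmul_inj; rewrite lmul0.
exact: (posop_oppK regular_CS).
Qed.

Lemma cpos_mono a b : cpositive a -> cpositive (b - a) -> nrm a <= nrm b.
Proof.
rewrite !cpos_posop lmulB => ap bap; apply: lmul_Nb; first exact: nrm_ge0.
apply: (posop_mono regular_CS) ap bap _; first exact: nrm_ge0.
exact: Nb_lmul.
Qed.

(** In the unitization r - a is positive, and so is c^† (r - a) c. *)
Lemma cpos_bound a (c : A) (r : R) : cpositive a -> nrm a <= r ->
  cpositive (r%:C *: (c^† ** c) - c^† ** a ** c).
Proof.
move=> ap ar; apply/cpos_posop.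
have r0 : 0 <= r by apply: le_trans ar; exact: nrm_ge0.
have rap : posop (opc r - lmul a).
  apply: posop_bound => //; last by apply: Nbw ar (Nb_lmul _).
  by rewrite -lmul_star cpos_sa.
have := posop_conj regular_CS rap (bd_lmul c).
rewrite mulrBr mulrBl -lmul_star -(opc_comm r) opc_mulE opZl -!lmulM -lmulZ.
by rewrite -lmulB.
Qed.

(** Take z = c / r, and use c^† a c <= r c^† c. *)
Lemma cs_alg_pos a b (c : A) (r : R) : 0 < r -> cpositive a -> nrm a <= r ->
  (forall z, cpositive (z^† ** a ** z - z^† ** c - c^† ** z + b)) ->
  cpositive (r%:C *: b - c^† ** c).
Proof.
move=> r0 ap ar /(_ (r^-1%:C *: c)).
rewrite astarZ conjrC !amulZl !amulZr => H1.
have H2 := cpos_bound c ap ar.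
have -> : r%:C *: b - c^† ** c = r%:C *: (r^-1%:C *: (r^-1%:C *: (c^† ** a ** c)) -
    r^-1%:C *: (c^† ** c) - r^-1%:C *: (c^† ** c) + b) +
    r^-1%:C *: (r%:C *: (c^† ** c) - c^† ** a ** c).
  rewrite !scalerDr !scalerN !scalerA -!rmorphM mulfV ?lt0r_neq0 // mul1r.
  rewrite mulVf ?lt0r_neq0 // rmorph1 !scale1r; zmod.
by apply: cposD; apply: cposZ => //; rewrite ?invr_ge0 ltW.
Qed.

Lemma cs_alg a b (c : A) : cpositive a ->
  (forall z, cpositive (z^† ** a ** z - z^† ** c - c^† ** z + b)) ->
  nrm c ^+ 2 <= nrm a * nrm b.
Proof.
move=> ap H; have a0 := nrm_ge0 a; have b0 := nrm_ge0 b.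
have K r : nrm a < r -> nrm c ^+ 2 <= r * nrm b.
  move=> ar; have r0 : 0 < r by apply: le_lt_trans ar.
  rewrite -nrm_star_mul -nrmZr; last exact: ltW.
  apply: cpos_mono; first exact: cpos_star_mul.
  by apply: cs_alg_pos H => //; exact: ltW.
apply/ler_addgt0Pr => e e0.
have e1 : 0 < e / (nrm b + 1) by rewrite divr_gt0 //; lra.
apply: le_trans (K (nrm a + e / (nrm b + 1)) _) _; first lra.
by rewrite mulrDl lerD2l mulrAC ler_pdivrMr; nra.
Qed.

Lemma alg_negative_part a : a^† = a -> exists n v w,
  [/\ n^† = n, v^† = v, w^† = w, n ** a ** n = - (w ** w) & (w = 0 -> a = v ** v)].
Proof.
move=> asa; have asa' : (lmul a)^† = lmul a by rewrite -lmul_star asa.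
have [N [V [W [[nsa vsa wsa] _ nan w0 HD]]]] :=
  negative_part regular_CS asa' (bd_lmul a).
have [|[n _ En] [v _ Ev] [w _ Ew]] := HD _ range_lmul_subalgebra; first by exists a.
exists n, v, w; split; try by apply: lmul_inj; rewrite lmul_star ?En ?Ev ?Ew.
  by apply: lmul_inj; rewrite lmulN !lmulM En Ew.
by move=> w00; apply: lmul_inj; rewrite lmulM Ev; apply: w0; rewrite -Ew w00 lmul0.
Qed.

(** In the unitization, (r - q) ^+ 2 = r ^+ 2 - c^† c. *)
Lemma defect (c : A) (r : R) : nrm c <= r -> exists q,
  q^† = q /\ c^† ** c = r%:C *: (q + q) - q ** q.
Proof.
move=> cr; have := nrm_ge0 c; have [r0 c0|r1 c0] := eqVneq r 0.
  exists 0; rewrite astar0 addr0 scaler0 amul0 subr0.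
  by rewrite (@nrm_le0 _ _ c) ?amul0 // -r0.
have rp : 0 < r by rewrite lt_def r1; lra.
have ri : 0 <= r^-1 by rewrite invr_ge0 ltW.
pose d := r^-1%:C *: c.
have d1 : nrm d <= 1 by rewrite nrmZr // mulrC ler_pdivrMr // mul1r.
have [||y [ysa y1 yy _ yD]] := @sqrt_one_sub _ _ _ regular_CS (lmul (d^† ** d)).
- by rewrite -lmul_star astarM astarK.
- apply: Nbw (Nb_lmul _); rewrite nrm_star_mul; have := nrm_ge0 d; nra.
have [|q _ Eq] := (yD _ range_lmul_subalgebra).1; first by exists (d^† ** d).
exists (r%:C *: q); split.
  by apply: lmul_inj; rewrite lmul_star lmulZ Eq starZr ysa.
have qq : d^† ** d = q + q - q ** q.
  apply: lmul_inj; rewrite lmulB lmulD lmulM Eq.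
  apply: (addrI (- 1)); rewrite addrC -[LHS]opprB -yy; ncring.
have -> : c = r%:C *: d by rewrite scalerA -rmorphM mulfV // scale1r.
clearbody d.
rewrite astarZ conjrC !amulZl !amulZr qq !scalerBr !scalerDr; zmod.
Qed.

End LeftMultiplication.

Section HilbertCS.
Context (R : realType) (A : cstarAlgType R[i]) (E : hilbertModType A).
Implicit Types x y : E.

Lemma hactDr x (a b : A) : x <* (a + b) = x <* a + x <* b.
Proof. by have := hact_linearr x 1 a b; rewrite !scale1r. Qed.
Lemma hact0 x : x <* (0 : A) = 0.
Proof. by apply: (addrI (x <* 0)); rewrite -hactDr !addr0. Qed.
Lemma hactZr x k (a : A) : x <* (k *: a) = k *: (x <* a).
Proof. by have := hact_linearr x k a 0; rewrite !addr0 hact0 addr0. Qed.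
Lemma hinner_actl x y (a : A) : << x <* a | y >> = a^† ** << x | y >>.
Proof. by rewrite -hinner_star hinner_act astarM hinner_star. Qed.

Lemma inner_cs_pos x y (z : A) :
  cpositive (z^† ** << x | x >> ** z - z^† ** << x | y >> -
    << x | y >>^† ** z + << y | y >>).
Proof.
have -> : z^† ** << x | x >> ** z - z^† ** << x | y >> -
    << x | y >>^† ** z + << y | y >> = << x <* z - y | x <* z - y >>.
  rewrite hinner_star !hinnerBl !hinnerBr !hinner_act !hinner_actl; starring.
exact: hinner_ge0.
Qed.

Lemma hilbert_CS x y : nrm << x | y >> <= nrm x * nrm y.
Proof.
rewrite -(@ler_pXn2r _ 2) ?nnegrE ?mulr_ge0 ?nrm_ge0 // exprMn -!nrm_inner.
by apply: cs_alg (inner_cs_pos x y); exact: hinner_ge0.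
Qed.

Lemma nrm_act x (a : A) : nrm (x <* a) <= nrm x * nrm a.
Proof.
rewrite -(@ler_pXn2r _ 2) ?nnegrE ?mulr_ge0 ?nrm_ge0 // exprMn -nrm_inner.
rewrite hinner_act hinner_actl; apply: le_trans (nrmM _ _) _.
rewrite expr2 mulrA; apply: ler_wpM2r; first exact: nrm_ge0.
apply: le_trans (nrmM _ _) _; rewrite nrm_star nrm_inner mulrC.
by rewrite -mulrA.
Qed.

End HilbertCS.

(** * Consequences for operators and representations *)

Section OperatorConsequences.
Context (R : realType) (B : cstarAlgType R[i]) (E : hilbertModType B).
Implicit Types S T : 'L(E).
Local Notation CS := (@hilbert_CS R B E).

(** S is the square root of r ^+ 2 - T^† T. *)
Lemma op_defect T r : 0 <= r -> Nb T r -> exists S,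
  forall x y, << T x | T y >> + << S x | S y >> = (r * r)%:C *: << x | y >>.
Proof.
move=> r0 Tr.
have [|S [Ssa SS _ _ _]] := posop_sqrt CS (T := opc (r * r) - T^† * T).
  apply: posop_bound; [nra|by rewrite starM starKop|].
  by apply: NbM => //; exact: Nb_star CS _ _ _ _.
exists S => x y; rewrite -{1}Ssa op_starPl -[S (S y)]opM SS opB opM hinnerBr.
by rewrite -(op_starP T) addrCA subrr addr0 /opc opZ op1 hinnerZr.
Qed.

Lemma cpos_nrm (F G H : hilbertModType B) (x : F) (s : G) (v : H) r :
  0 <= r -> << x | x >> + << s | s >> = (r * r)%:C *: << v | v >> ->
  nrm x <= r * nrm v.
Proof.
move=> r0 xsv; rewrite -(@ler_pXn2r _ 2) ?nnegrE ?mulr_ge0 ?nrm_ge0 //.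
rewrite exprMn -!nrm_inner expr2 -nrmZr ?mulr_ge0 // -xsv.
by apply: cpos_mono; [exact: hinner_ge0|rewrite addrC addKr; exact: hinner_ge0].
Qed.

(** An operator is positive if its quadratic form is: test it on the range of
    its negative part. *)
Lemma posop_inner T : T^† = T -> bd T -> (forall x, cpositive << x | T x >>) ->
  posop T.
Proof.
move=> Tsa Tb Tp; have [n [v [w [[nsa vsa wsa] [nb vb wb] nTn w0 _]]]] :=
  negative_part CS Tsa Tb.
rewrite w0; first exact: (posop_sq CS).
apply: adjointable_eq => x; rewrite op0; apply: hinner_eq0; apply: cpos_oppK.
  exact: hinner_ge0.
rewrite -{1}wsa op_starPl -[w (w x)]opM -hinnerNr -opN -nTn !opM -{1}nsa -op_starP.
exact: Tp.
Qed.

Lemma Nb_rank_one (x y : E) : Nb (rank_one x y) (nrm x * nrm y).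
Proof.
move=> z; rewrite -mulrA; apply: le_trans (nrm_act _ _) _.
by apply: ler_wpM2l; [exact: nrm_ge0|exact: hilbert_CS].
Qed.

Lemma bd_rank_one (x y : E) : bd (rank_one x y).
Proof.
by exists (nrm x * nrm y); [rewrite mulr_ge0 ?nrm_ge0|exact: Nb_rank_one].
Qed.

Lemma rank_one_star (x y : E) : (rank_one x y)^† = rank_one y x.
Proof. exact: adjointable_eq. Qed.

Lemma rank_one_mull T (x y : E) : T * rank_one x y = rank_one (T x) y.
Proof.
apply: adjointable_eq => z; rewrite opM /=; apply: hinner_inj => u.
by rewrite -op_starPl !hinner_act op_starPl.
Qed.

Lemma rank_one_mulr T (x y : E) : rank_one x y * T = rank_one x (T^† y).
Proof. by apply: adjointable_eq => z; rewrite opM /= op_starPl. Qed.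

Lemma posop_rank_one (x : E) : posop (rank_one x x).
Proof.
apply: posop_inner; [exact: rank_one_star|exact: bd_rank_one|move=> y /=].
by rewrite hinner_act -(hinner_star x y); exact: cpos_star_mul.
Qed.

Lemma rank_one_Nb (x : E) c : 0 <= c -> Nb (rank_one x x) c -> nrm x ^+ 2 <= c.
Proof.
move=> c0 xc; have := le_trans (hilbert_CS x (rank_one x x x)) _.
move=> /(_ _ (ler_wpM2l (nrm_ge0 x) (xc x))); rewrite /= hinner_act.
rewrite -{1}(hinner_star x x) nrm_star_mul nrm_inner.
have [->|x0 H] := eqVneq (nrm x) 0; first by rewrite expr0n.
have xp : 0 < nrm x ^+ 2 by rewrite exprn_gt0 // lt_def x0 nrm_ge0.
rewrite -(ler_pM2r xp) -expr2; suff -> : c * nrm x ^+ 2 = nrm x * (c * nrm x) by [].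
by ring.
Qed.

(** Approximate units. For h = c (x_1 x_1^* + ... + x_n x_n^* ) with
    0 <= h <= 1 the powers of s = 1 - h satisfy m s^m h s^m <= 1, since
    s^k h s^k decreases with k and is at most s^(2k) - s^(2k+2); so the
    operators 1 - s^m approximate the identity at every x_i. *)
Lemma approximate_unit (D : set 'L(E)) (xs : seq E) (e : R) :
  cstar_subalgebra D -> (forall x, D (rank_one x x)) -> 0 < e ->
  exists u, [/\ D u, u^† = u, Nb u 1 & forall x, x \in xs -> nrm (u x - x) <= e].
Proof.
move=> [Dlin Dmul _ _] Dr e0.
have hx0 x : x \in xs -> posop (\sum_(y <- xs) rank_one y y - rank_one x x).
  elim: xs => // y ys IH; rewrite inE big_cons => /predU1P[->|/IH xp].
    rewrite addrC addKr; elim: ys {IH} => [|z zs IH].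
      by rewrite big_nil; exact: posop0.
    by rewrite big_cons; apply: posopD => //; exact: posop_rank_one.
  by rewrite -addrA; apply: posopD => //; exact: posop_rank_one.
have h0p : posop (\sum_(y <- xs) rank_one y y).
  apply: big_ind; [exact: posop0|exact: posopD|].
  by move=> *; exact: posop_rank_one.
have h0D : D (\sum_(y <- xs) rank_one y y).
  by apply: big_ind => [|S T|*]; [exact: lspan_0|exact: lspan_D|exact: Dr].
have [C C0 h0C] := posop_bd h0p.
pose c := (C + 1)^-1; have cp : 0 < c by rewrite invr_gt0; lra.
have c0 := ltW cp; have cC : c * C <= 1 by rewrite mulrC ler_pdivrMr; lra.
pose h := c%:C *: \sum_(y <- xs) rank_one y y.
have hp : posop h by exact: posopZ.
have h1 : Nb h 1 by apply: Nbw cC _; exact: NbZr.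
have Dh : D h by exact: lspan_Z.
have hxs x : x \in xs -> posop (h - c%:C *: rank_one x x).
  by move=> /hx0; rewrite /h -scalerBr; exact: posopZ.
clearbody h; pose s := 1 - h; have hs : h = 1 - s by rewrite /s; zmod.
have sp : posop s by rewrite /s -opc1; apply: posop_bound => //; exact: posop_sa.
have ssa := posop_sa sp; have hsa := posop_sa hp.
have s1 : Nb s 1 by apply: (posop_le CS ler01 sp); rewrite opc1 -hs.
have hhp : posop (h - h * h).
  have [k [ksa kk kcomm _ kp]] := posop_sqrt CS hp.
  have kh : h * k = k * h by rewrite -kk mulrA.
  have := posop_conj CS sp (posop_bd kp); rewrite ksa (_ : k * s * k = h - h * h) //.
  by rewrite /s mulrBr mulr1 mulrBl kk -kh -mulrA kk.
have hshs : posop (h - s * h * s).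
  rewrite (_ : _ - _ = h * (1 + s) * h).
    rewrite -{1}hsa; apply: (posop_conj CS _ (posop_bd hp)); apply: posopD => //.
    by rewrite -opc1 -[opc 1]subr0; apply: posop_bound; rewrite ?star0 //; exact: Nb0.
  rewrite /s; ncring.
pose G n := s ^+ n * s ^+ n; pose g n := s ^+ n * h * s ^+ n.
have snb n : bd (s ^+ n).
  by exists 1 => //; have := NbX n ler01 s1; rewrite expr1n.
have sX n := starX n ssa.
have gp n : posop (g n) by rewrite /g -{1}(sX n); exact: (posop_conj CS).
have Gp n : posop (G n) by apply: (posop_sq CS).
have step n : posop (G n - G n.+1 - g n).
  rewrite (_ : _ - _ = s ^+ n * (h - h * h) * s ^+ n).
    by rewrite -{1}(sX n); exact: (posop_conj CS).
  rewrite /G /g {1}exprSr exprS hs; ncring.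
have gdec n : posop (g n - g n.+1).
  rewrite (_ : _ - _ = s ^+ n * (h - s * h * s) * s ^+ n).
    by rewrite -{1}(sX n); exact: (posop_conj CS).
  rewrite /g {1}exprSr exprS; ncring.
have tele n : posop (1 - G n - n%:R%:C *: g n).
  elim: n => [|n IH].
    by rewrite /G expr0 mulr1 subrr scale0r subr0; exact: posop0.
  rewrite (_ : _ - _ = (1 - G n - n%:R%:C *: g n) + (G n - G n.+1 - g n) +
    n.+1%:R%:C *: (g n - g n.+1)).
    by apply: posopD; [exact: posopD|apply: posopZ => //; exact: gdec].
  have -> : (n.+1%:R : R)%:C = n%:R%:C + 1 by rewrite -natr1 rmorphD rmorph1.
  rewrite !scalerBr !scalerDl !scale1r; zmod.
have gn n : Nb (n%:R%:C *: g n) 1.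
  apply: (posop_le CS ler01); first exact: posopZ.
  rewrite opc1 (_ : _ - _ = (1 - G n - n%:R%:C *: g n) + G n); last zmod.
  exact: posopD.
have small n x : x \in xs -> n%:R * c * nrm ((s ^+ n) x) ^+ 2 <= 1.
  move=> xxs; have nc : 0 <= n%:R * c by rewrite mulr_ge0.
  have H : Nb ((n%:R * c)%:C *: rank_one ((s ^+ n) x) ((s ^+ n) x)) 1.
    apply: (posop_mono CS ler01 _ _ (gn n)).
      by apply: posopZ => //; exact: posop_rank_one.
    rewrite rmorphM -scalerA -scalerBr; apply: posopZ => //.
    rewrite (_ : _ - _ = s ^+ n * (h - c%:C *: rank_one x x) * s ^+ n).
      by rewrite -{1}(sX n); apply: (posop_conj CS) => //; exact: hxs.
    by rewrite mulrBr mulrBl opZr opZl rank_one_mull rank_one_mulr sX.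
  move: H; have [->|r0] := eqVneq (n%:R * c) 0; first by rewrite mul0r.
  move: (n%:R * c) nc r0 => r r0 rn0; have rp : 0 < r by rewrite lt_def rn0.
  have ri : 0 <= r^-1 by rewrite invr_ge0.
  move=> /(NbZr ri); rewrite scalerA -rmorphM mulVf // scale1r mulr1.
  by move=> /(rank_one_Nb ri); rewrite -[r^-1]mul1r ler_pdivlMr // mulrC.
have [n Hn] : exists n, forall x, x \in xs -> nrm ((s ^+ n) x) <= e.
  have [|n Hn] := @archi_inv _ (c * e ^+ 2); first by rewrite mulr_gt0 // exprn_gt0.
  exists n.+1 => x /(small n.+1) H; rewrite -(@ler_pXn2r _ 2) ?nnegrE ?nrm_ge0 //.
    rewrite -(ler_pM2l cp); apply: le_trans Hn.
    by rewrite -[_^-1]mul1r ler_pdivlMr // mulrC mulrA.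
  exact: ltW.
exists (1 - s ^+ n); split.
- elim: n {Hn} => [|n IH]; first by rewrite expr0 subrr; exact: lspan_0.
  rewrite (_ : _ - _ = (1 - s ^+ n) + h - h * (1 - s ^+ n)).
    by apply: (lspan_B Dlin); [exact: (lspan_D Dlin)|exact: Dmul].
  rewrite exprS /s; ncring.
- by rewrite starB star1 sX.
- have snp : posop (s ^+ n).
    have [r [rsa rr _ _ rp]] := posop_sqrt CS sp.
    have -> : s ^+ n = r ^+ n * r ^+ n by rewrite -exprD addnn -mul2n exprM expr2 rr.
    apply: (posop_sq CS); first exact: starX.
    have [d d0 rd] := posop_bd rp; exists (d ^+ n); [exact: exprn_ge0|exact: NbX].
  apply: (posop_le CS ler01); last by rewrite opc1 opprB addrCA subrr addr0.
  rewrite -[X in posop (X - _)]opc1; apply: posop_bound => //.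
  by have := NbX n ler01 s1; rewrite expr1n.
- by move=> x /Hn; rewrite opB op1 addrC addKr nrmN.
Qed.

End OperatorConsequences.

Section Realization.
Context (R : realType) (B : cstarAlgType R[i]) (E : hilbertModType B).
Variables (D : set 'L(E)) (r : realization D).

Lemma Nb_real (a : r) : Nb (real_op a) (nrm a).
Proof. by have [_ H _] := real_op_norm a; apply/NbP; rewrite -nrmE. Qed.

Lemma real_Nb (a : r) c : 0 <= c -> Nb (real_op a) c -> nrm a <= c.
Proof.
by move=> c0 /NbP H; have [_ _ K] := real_op_norm a; rewrite -nrm_le K ?ler0c.
Qed.

Lemma bd_real (a : r) : bd (real_op a).
Proof. by exists (nrm a); [exact: nrm_ge0|exact: Nb_real]. Qed.

Lemma real_inj (a b : r) : real_op a = real_op b -> a = b.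
Proof.
move=> ab; apply/eqP; rewrite -subr_eq0; apply/eqP/nrm_le0/real_Nb => //.
by rewrite (star_homB (real_op_hom r)) ab subrr; exact: Nb0.
Qed.

Lemma real_ex T : D T -> exists a : r, real_op a = T.
Proof.
move=> DT; have : range (@real_op _ _ _ _ r) T by rewrite real_op_range.
by case=> a _ <-; exists a.
Qed.

Lemma real_in (a : r) : D (real_op a).
Proof.
have : range (@real_op _ _ _ _ r) (real_op a) by exists a.
by rewrite real_op_range.
Qed.

Lemma real_subalgebra : cstar_subalgebra D.
Proof.
have := range_subalgebra (real_op_hom r) Nb_real real_Nb.
by rewrite real_op_range.
Qed.

End Realization.

(** The defect r ^+ 2 - a^† a is the square of r - q, which need not belong to A
    but acts in every representation of A. *)
Lemma rep_defect (R : realType) (A B : cstarAlgType R[i])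
    (E : hilbertModType B) (f : A -> 'L(E)) a q (r : R) : star_hom f ->
  q^† = q -> a^† ** a = r%:C *: (q + q) - q ** q -> forall x y,
  << f a x | f a y >> + << r%:C *: x - f q x | r%:C *: y - f q y >> =
  (r * r)%:C *: << x | y >>.
Proof.
move=> fh qsa aq x y.
have Qs z u : << f q z | u >> = << z | f q u >>.
  by rewrite op_starP -(star_hom_star fh) qsa.
rewrite op_starP -(star_hom_star fh).
have -> : (f a^†) (f a y) = f (a^† ** a) y by rewrite (star_homM fh).
rewrite aq (star_homB fh) (star_homZ fh) (star_homD fh) (star_homM fh).
rewrite opB opZ opD -[_ ** _]/(f q * f q) opM scalerDr.
rewrite !(hinnerBl, hinnerBr, hinnerDr, hinnerZl, hinnerZr) conjrC !Qs.
by rewrite scalerA -rmorphM; zmod.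
Qed.

Lemma rep_contractive (R : realType) (A B : cstarAlgType R[i])
    (E : hilbertModType B) (f : A -> 'L(E)) :
  star_hom f -> forall a, Nb (f a) (nrm a).
Proof.
move=> fh a x; have [q [qsa aq]] := defect (lexx (nrm a)).
exact: cpos_nrm (nrm_ge0 a) (rep_defect fh qsa aq x x).
Qed.

Lemma star_hom_contractive (R : realType) (A D : cstarAlgType R[i]) (f : A -> D) :
  star_hom f -> forall a, nrm (f a) <= nrm a.
Proof.
move=> fh a; apply: lmul_Nb; first exact: nrm_ge0.
apply: (rep_contractive (f := @lmul _ D \o f)).
split=> [k b c|b c|b] /=.
- by rewrite (star_homD fh) (star_homZ fh) lmulP.
- by rewrite (star_homM fh) lmulM.
- by rewrite (star_hom_star fh) lmul_star.
Qed.

(** * Bounded linear maps and dense subspaces *)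

Section BoundedLinear.
Context (R : realType).
Implicit Types V W : normedModType R[i].

Definition blin V W (f : V -> W) :=
  (forall k x y, f (k *: x + y) = k *: f x + f y) /\
  exists2 C, 0 <= C & forall x, nrm (f x) <= C * nrm x.

Lemma blinD V W (f g : V -> W) : blin f -> blin g -> blin (fun x => f x + g x).
Proof.
move=> [fl [C C0 fC]] [gl [D D0 gD]]; split.
  by move=> k x y; rewrite fl gl scalerDr; zmod.
exists (C + D) => [|x]; first lra.
by apply: le_trans (nrmD _ _) _; rewrite mulrDl lerD.
Qed.

Lemma blinZ V W (f : V -> W) k : blin f -> blin (fun x => k *: f x).
Proof.
move=> [fl [C C0 fC]]; split.
  by move=> l x y; rewrite fl scalerDr !scalerA mulrC.
exists (complex.Re `|k| * C).
  by rewrite mulr_ge0 // normc_def /= sqrtr_ge0.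
move=> x; rewrite nrmZ -mulrA ler_wpM2l // normc_def /= sqrtr_ge0 //.
Qed.

Lemma blinB V W (f g : V -> W) : blin f -> blin g -> blin (fun x => f x - g x).
Proof.
move=> fb /(blinZ (-1)) gb; have := blinD fb gb.
by under [X in blin X]eq_fun do rewrite scaleN1r.
Qed.

Lemma blin_comp V W (U : normedModType R[i]) (f : V -> W) (g : W -> U) :
  blin f -> blin g -> blin (g \o f).
Proof.
move=> [fl [C C0 fC]] [gl [D D0 gD]]; split; first by move=> k x y /=; rewrite fl gl.
exists (D * C) => [|x /=]; first nra.
by apply: le_trans (gD _) _; rewrite -mulrA ler_wpM2l.
Qed.

Lemma blin_0 V W (f : V -> W) : blin f -> f 0 = 0.
Proof. by move=> [fl _]; have := fl (-1) 0 0; rewrite scaler0 addr0 scaleN1r addNr. Qed.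

Lemma blin_add V W (f : V -> W) : blin f -> forall x y, f (x + y) = f x + f y.
Proof. by move=> [fl _] x y; have := fl 1 x y; rewrite !scale1r. Qed.

Lemma blin_scale V W (f : V -> W) : blin f -> forall k x, f (k *: x) = k *: f x.
Proof. by move=> fb k x; have := fb.1 k x 0; rewrite (blin_0 fb) !addr0. Qed.

Lemma blin_sub V W (f : V -> W) : blin f -> forall x y, f (x - y) = f x - f y.
Proof.
by move=> fb x y; rewrite (blin_add fb) -[- y]scaleN1r (blin_scale fb) scaleN1r.
Qed.

Lemma blin_tends V W (f : V -> W) u l : blin f -> tends u l ->
  tends (f \o u) (f l).
Proof.
move=> fb ul e e0; have [_ [C C0 fC]] := fb.
have [|N HN] := ul (e / (C + 1)); first by rewrite divr_gt0 //; lra.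
exists N => n /HN; rewrite ler_pdivlMr /=; last lra.
rewrite -(blin_sub fb); have := fC (u n - l); have := nrm_ge0 (u n - l); nra.
Qed.

(** The closure of the graph on finite combinations is the graph of the
    extension. *)
Lemma extend_bounded V (W : completeNormedModType R[i]) (I : Type)
    (v : I -> V) (w : I -> W) (C : R) : 0 <= C -> densely_spans (range v) ->
  (forall n (c : 'I_n -> R[i]) (i : 'I_n -> I),
    nrm (\sum_(j < n) c j *: w (i j)) <= C * nrm (\sum_(j < n) c j *: v (i j))) ->
  exists T : V -> W, [/\ forall k x y, T (k *: x + y) = k *: T x + T y,
    forall x, nrm (T x) <= C * nrm x & forall i, T (v i) = w i].
Proof.
move=> C0 /densely_spansP vd wv.
pose S : set (V * W)%type := range (fun i => (v i, w i)).
have Sb p : lspan S p -> nrm p.2 <= C * nrm p.1.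
  move=> [n [c [q [Sq ->]]]].
  have /choice[i Hi] j : exists i, q j = (v i, w i).
    by have [i _ <-] := Sq j; exists i.
  have E1 : (\sum_(j < n) c j *: q j).1 = \sum_(j < n) c j *: v (i j).
    rewrite (big_morph (fun p : V * W => p.1) (id1 := 0) (op1 := +%R)) //.
    by apply: eq_bigr => j _; rewrite Hi.
  have E2 : (\sum_(j < n) c j *: q j).2 = \sum_(j < n) c j *: w (i j).
    rewrite (big_morph (fun p : V * W => p.2) (id1 := 0) (op1 := +%R)) //.
    by apply: eq_bigr => j _; rewrite Hi.
  by rewrite E1 E2; exact: wv.
pose G x z := forall e, 0 < e -> exists p, [/\ lspan S p, nrm (x - p.1) <= e &
  nrm (z - p.2) <= e].
have lS := @lspan_idem R (V * W)%type S.
have Glin k x y z u : G x z -> G y u -> G (k *: x + y) (k *: z + u).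
  move=> Gx Gy e e0; pose K := complex.Re `|k|.
  have K0 : 0 <= K by rewrite /K normc_def /= sqrtr_ge0.
  have d0 : 0 < e / (K + 1) by rewrite divr_gt0 //; lra.
  have de : K * (e / (K + 1)) + e / (K + 1) = e.
    by rewrite -[X in _ + X]mul1r -mulrDl mulrCA mulfV ?mulr1 //; lra.
  have [p [Sp xp zp]] := Gx _ d0; have [q [Sq yq uq]] := Gy _ d0.
  exists (k *: p + q); split; first exact: lspan_lin.
    rewrite (_ : _ - _ = k *: (x - p.1) + (y - q.1)); last first.
      by rewrite /= scalerBr; zmod.
    apply: le_trans (nrmD _ _) _; rewrite nrmZ -de; apply: lerD => //.
    exact: ler_wpM2l.
  rewrite (_ : _ - _ = k *: (z - p.2) + (u - q.2)); last first.
    by rewrite /= scalerBr; zmod.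
  apply: le_trans (nrmD _ _) _; rewrite nrmZ -de; apply: lerD => //.
  exact: ler_wpM2l.
have Gb x z : G x z -> nrm z <= C * nrm x.
  move=> Gx; apply/ler_addgt0Pr => e e0.
  have d0 : 0 < e / (C + 1) by rewrite divr_gt0 //; lra.
  have [p [/Sb Sp xp zp]] := Gx _ d0.
  have de : C * (e / (C + 1)) + e / (C + 1) = e.
    by rewrite -[X in _ + X]mul1r -mulrDl mulrCA mulfV ?mulr1 //; lra.
  have := nrmD (z - p.2) p.2; rewrite subrK.
  have := nrmD (p.1 - x) x; rewrite subrK nrmC.
  move: de; move: (e / (C + 1)) xp zp d0 => d xp zp d0 de H1 H2.
  have := ler_wpM2l C0 H1; have := ler_wpM2l C0 xp; nra.
have Guni x z z' : G x z -> G x z' -> z = z'.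
  move=> Gz Gz'; have := Glin (-1) _ _ _ _ Gz' Gz.
  rewrite !scaleN1r addNr => /Gb; rewrite nrm0 mulr0 addrC => /nrm_le0/eqP.
  by rewrite subr_eq0 => /eqP.
have /choice[T HT] x : exists z, G x z.
  have /choice[p Hp] n : exists p, lspan S p /\ nrm (x - p.1) <= n.+1%:R^-1.
    have [|y vy xy] := vd x (n.+1%:R^-1); first by [].
    move: vy xy => [m [c [q [Sq ->]]]] xy.
    have /choice[i Hi] j : exists i, q j = v i by have [i _ <-] := Sq j; exists i.
    exists (\sum_(j < m) c j *: (v (i j), w (i j))); split.
      by exists m, c, (fun j => (v (i j), w (i j))); split=> // j; exists (i j).
    rewrite (big_morph (fun p : V * W => p.1) (id1 := 0) (op1 := +%R)) //=.
    by rewrite (eq_bigr (fun j => c j *: q j)) // => j _; rewrite Hi.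
  have pN e : 0 < e -> exists N, forall n, (N <= n)%N -> nrm (x - (p n).1) <= e.
    move=> e0; have [N HN] := archi_seq e0; exists N => n Nn.
    exact: le_trans (Hp n).2 (HN n Nn).
  have [|z pz] := @complete_seq _ W (fun n => (p n).2).
    move=> e e0; have [|N HN] := pN (e / 2 / (C + 1)).
      by rewrite divr_gt0 //; lra.
    exists N => n m /HN nx /HN mx.
    have Spq : lspan S (p n - p m) by apply: (lspan_B lS); exact: (Hp _).1.
    have := Sb _ Spq => /= H; apply: le_trans H _.
    have := nrm_trans x (p n).1 (p m).1; rewrite (nrmC _ x).
    move: nx mx; rewrite !ler_pdivlMr; try lra.
    have := nrm_ge0 ((p n).1 - (p m).1); nra.
  exists z => e e0; have [N HN] := pN e e0; have [N' HN'] := pz e e0.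
  exists (p (maxn N N')); split; [exact: (Hp _).1|exact/HN/leq_maxl|].
  by rewrite nrmC; exact/HN'/leq_maxr.
exists T; split=> [k x y|x|i].
- by apply: (Guni (k *: x + y)) => //; exact: Glin.
- exact: Gb.
- apply: (Guni (v i)) => // e e0; exists (v i, w i); split.
  + by apply: sub_lspan; exists i.
  + by rewrite subrr nrm0 ltW.
  + by rewrite subrr nrm0 ltW.
Qed.

End BoundedLinear.

Lemma blin_real (R : realType) (B : cstarAlgType R[i]) (E : hilbertModType B)
    (D : set 'L(E)) (r : realization D) x : blin (fun a : r => real_op a x).
Proof.
split.
  by move=> c a b; rewrite (star_homD (real_op_hom r)) (star_homZ (real_op_hom r)).
exists (nrm x) => [|a]; first exact: nrm_ge0.
by rewrite mulrC; exact: Nb_real.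
Qed.

Lemma lspan_ind (R : realType) (V : lmodType R[i]) (S P : set V) : P 0 ->
  (forall k x y, P x -> P y -> P (k *: x + y)) -> S `<=` P -> lspan S `<=` P.
Proof.
move=> P0 Plin SP _ [n [c [w [Sw ->]]]]; apply: (lin_lspan P0 Plin).
by exists n, c, w; split=> // i; exact/SP/Sw.
Qed.

Section ClosedSpan.
Context (R : realType).
Implicit Types V W : normedModType R[i].

Definition cspan V (S : set V) : set V :=
  [set x | forall e : R, 0 < e -> exists2 y, lspan S y & nrm (x - y) <= e].

Lemma densely_cspan V (S : set V) : densely_spans S <-> forall x, cspan S x.
Proof. by rewrite densely_spansP; split=> H x; [move=> e|move=> e e0]; exact: H. Qed.

Lemma sub_cspan V (S : set V) : S `<=` cspan S.
Proof.
by move=> x Sx e e0; exists x; [exact: sub_lspan|rewrite subrr nrm0 ltW].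
Qed.

Lemma cspan0 V (S : set V) : cspan S 0.
Proof.
move=> e e0; exists 0; last by rewrite subrr nrm0 ltW.
exact: lspan_0 (@lspan_idem R V S).
Qed.

Lemma cspanP V (S : set V) k x y : cspan S x -> cspan S y -> cspan S (k *: x + y).
Proof.
move=> Sx Sy e e0; pose K := complex.Re `|k|.
have K0 : 0 <= K by rewrite /K normc_def /= sqrtr_ge0.
have d0 : 0 < e / (K + 1) by rewrite divr_gt0 //; lra.
have de : e / (K + 1) * (K + 1) = e by rewrite mulfVK //; lra.
have [x' Sx' xx'] := Sx _ d0; have [y' Sy' yy'] := Sy _ d0.
exists (k *: x' + y'); first exact: lspan_lin (@lspan_idem R V S) _ _ _ Sx' Sy'.
rewrite (_ : _ - _ = k *: (x - x') + (y - y')); last by rewrite scalerBr; zmod.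
apply: le_trans (nrmD _ _) _; rewrite nrmZ -/K.
have := ler_wpM2l K0 xx'; lra.
Qed.

Lemma cspan_closed V (S : set V) x :
  (forall e, 0 < e -> exists2 y, cspan S y & nrm (x - y) <= e) -> cspan S x.
Proof.
move=> H e e0; have [|y Sy xy] := H (e / 2); first lra.
have [|z Sz yz] := Sy (e / 2); first lra.
by exists z => //; have := nrm_trans y x z; lra.
Qed.

(** Closed subspaces, with closedness in terms of the norm. *)
Definition cspace V (S : set V) := [/\ S 0,
  forall k x y, S x -> S y -> S (k *: x + y) &
  forall x, (forall e : R, 0 < e -> exists2 y, S y & nrm (x - y) <= e) -> S x].

Lemma cspace_cspan V (S : set V) : cspace (cspan S).
Proof. by split; [exact: cspan0|exact: cspanP|exact: cspan_closed]. Qed.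

Lemma cspace_ind V (S T : set V) : cspace T -> S `<=` T -> cspan S `<=` T.
Proof.
move=> [T0 TP Tc] ST x Sx; apply: Tc => e /Sx[y Sy xy].
exists y => //; exact: (lspan_ind T0 TP ST).
Qed.

Lemma cspace_dense V (S T : set V) : densely_spans S -> cspace T -> S `<=` T ->
  forall x, T x.
Proof. by move=> /densely_cspan Sd cT ST x; exact: (cspace_ind cT ST). Qed.

Lemma cspace_preimage V W (f : V -> W) (S : set W) : blin f -> cspace S ->
  cspace (f @^-1` S).
Proof.
move=> fb [S0 SP Sc]; have [fl [C C0 fC]] := fb; split=> [|k x y Sx Sy|x Hx] /=.
- by rewrite (blin_0 fb).
- by rewrite fl; exact: SP.
apply: Sc => e e0; have [|y Sy xy] := Hx (e / (C + 1)).
  by rewrite divr_gt0 //; lra.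
exists (f y) => //; rewrite -(blin_sub fb); apply: le_trans (fC _) _.
move: xy; rewrite ler_pdivlMr; last lra.
have := nrm_ge0 (x - y); nra.
Qed.

Lemma cspaceI V (S T : set V) : cspace S -> cspace T -> cspace (S `&` T).
Proof.
move=> [S0 SP Sc] [T0 TP Tc]; split; first by split.
- by move=> k x y [Sx Tx] [Sy Ty]; split; [exact: SP|exact: TP].
- by move=> x Hx; split; [apply: Sc|apply: Tc] => e /Hx[y [Sy Ty] xy]; exists y.
Qed.

Lemma cspace0 V : cspace [set 0 : V].
Proof.
split=> // [k _ _ -> ->|x Hx] /=; first by rewrite scaler0 addr0.
by apply: (@nrm_eps_eq0 _ _ _ 1) => e /Hx[_ ->]; rewrite subr0 mul1r.
Qed.

Lemma dense_eq V W (S : set V) (f g : V -> W) : densely_spans S ->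
  blin f -> blin g -> (forall x, S x -> f x = g x) -> forall x, f x = g x.
Proof.
move=> Sd fb gb fg x; apply/eqP; rewrite -subr_eq0; apply/eqP.
apply: (cspace_dense Sd (cspace_preimage (blinB fb gb) (@cspace0 W))) => y Sy /=.
by rewrite fg // subrr.
Qed.

Lemma cspan_blin V W (f : V -> W) (S : set V) (S' : set W) : blin f ->
  (forall x, S x -> cspan S' (f x)) -> forall x, cspan S x -> cspan S' (f x).
Proof.
move=> fb fS; apply: (cspace_ind _ fS).
exact: cspace_preimage fb (cspace_cspan S').
Qed.

Lemma cspace_star (A : cstarAlgType R[i]) (S : set A) : cspace S ->
  cspace [set a | S a^†].
Proof.
case=> S0 SP Sc; split=> [|k a b Sa Sb|a Ha] /=; first by rewrite astar0.
- by rewrite astarP; exact: SP.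
apply: Sc => e /Ha[b Sb ab]; exists b^† => //.
by rewrite -astarB nrm_star.
Qed.

Lemma blin_amull (A : cstarAlgType R[i]) (b : A) : blin (fun a => a ** b).
Proof.
split=> [k a a'|]; first by rewrite amulDl amulZl.
by exists (nrm b) => [|a]; [exact: nrm_ge0|rewrite mulrC; exact: nrmM].
Qed.

Lemma blin_amulr (A : cstarAlgType R[i]) (a : A) : blin (fun b => a ** b).
Proof.
split=> [k b b'|]; first by rewrite amulDr amulZr.
by exists (nrm a) => [|b]; [exact: nrm_ge0|exact: nrmM].
Qed.

Lemma blin_hactr (A : cstarAlgType R[i]) (F : hilbertModType A) (x : F) :
  blin (fun a : A => x <* a).
Proof.
split=> [k a b|]; first by rewrite hactDr hactZr.
by exists (nrm x) => [|a]; [exact: nrm_ge0|exact: nrm_act].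
Qed.

Lemma blin_hactl (A : cstarAlgType R[i]) (F : hilbertModType A) (a : A) :
  blin (fun x : F => x <* a).
Proof.
split=> [k x y|]; first exact: hact_linearl.
by exists (nrm a) => [|x]; [exact: nrm_ge0|rewrite mulrC; exact: nrm_act].
Qed.

End ClosedSpan.

(** This reduces induction over cstar_generated to closed *-subalgebras S of the
    abstract algebra r; an operator in the closure of the image comes from r
    because D is closed, and then from S because r is isometric. *)
Lemma image_subalgebra (R : realType) (B : cstarAlgType R[i]) (E : hilbertModType B)
    (D : set 'L(E)) (r : realization D) (S : set r) : cspace S ->
  (forall a b, S a -> S b -> S (a ** b)) -> (forall a, S a -> S a^†) ->
  cstar_subalgebra [set real_op a | a in S].
Proof.
move=> [S0 SP Sc] SM Sstar; have rh := real_op_hom r; split.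
- apply: lin_lspan => [|k _ _ [a Sa <-] [b Sb <-]].
    by exists 0 => //; exact: star_hom0.
  by exists (k *: a + b); [exact: SP|rewrite (star_homD rh) (star_homZ rh)].
- move=> _ _ [a Sa <-] [b Sb <-]; exists (a ** b); first exact: SM.
  exact: star_homM.
- by move=> _ [a Sa <-]; exists a^†; [exact: Sstar|exact: star_hom_star].
move=> T HT; have [_ _ _ Dc] := real_subalgebra r.
have [a aT] : exists a : r, real_op a = T.
  apply: real_ex; apply: Dc => e /HT[_ [b Sb <-] H].
  by exists (real_op b) => //; exact: real_in.
exists a => //; apply: Sc => e e0.
move/opnorm_closureP: HT => /(_ e e0)[_ [b Sb <-] H].
exists b => //; apply: real_Nb; first exact: ltW.
by rewrite (star_homB rh) aT.
Qed.

Section HilbertDense.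
Context (R : realType) (B : cstarAlgType R[i]).
Implicit Types E F G : hilbertModType B.

Lemma blin_op E (T : 'L(E)) : bd T -> blin T.
Proof. by move=> [c c0 Tc]; split; [exact: adj_funP|exists c]. Qed.

Lemma blin_inner E (x : E) : blin (fun y => << x | y >>).
Proof.
split; first exact: hinner_linearr.
by exists (nrm x); [exact: nrm_ge0|move=> y; exact: hilbert_CS].
Qed.

Lemma tends_inner E (u v : nat -> E) x y : tends u x -> tends v y ->
  tends (fun n => << u n | v n >>) << x | y >>.
Proof.
move=> ux vy e e0; have x0 := nrm_ge0 x; have y0 := nrm_ge0 y.
pose K := nrm x + nrm y + 1; have K0 : 0 < K by rewrite /K; lra.
pose d := Num.min 1 (e / K).
have d0 : 0 < d by rewrite lt_min ltr01 divr_gt0.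
have d1 : d <= 1 by rewrite ge_min lexx.
have de : d * K <= e by rewrite -ler_pdivlMr // ge_min lexx orbT.
have [N HN] := ux d d0; have [M HM] := vy d d0.
exists (maxn N M) => n; rewrite geq_max => /andP[/HN un /HM vn].
rewrite (_ : _ - _ = << u n - x | v n - y >> +
    (<< u n - x | y >> + << x | v n - y >>)); last first.
  by rewrite hinnerBl hinnerBr !hinnerBl hinnerBr; zmod.
have := nrmD << u n - x | v n - y >> (<< u n - x | y >> + << x | v n - y >>).
have := nrmD << u n - x | y >> << x | v n - y >>.
have := hilbert_CS (u n - x) (v n - y); have := hilbert_CS (u n - x) y.
have := hilbert_CS x (v n - y); have := nrm_ge0 (u n - x).
have := nrm_ge0 (v n - y); rewrite /K in de *; nra.
Qed.

Lemma dense_inner_eq E (S : set E) x y : densely_spans S ->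
  (forall s, S s -> << s | x >> = << s | y >>) -> x = y.
Proof.
move=> Sd Sxy; apply: hinner_inj => z; rewrite -hinner_star -[RHS]hinner_star.
congr (_^†); apply: (dense_eq Sd (blin_inner x) (blin_inner y)) => s Ss.
by rewrite -hinner_star Sxy // hinner_star.
Qed.

Lemma op_dense_eq E (S : set E) (T U : 'L(E)) : densely_spans S ->
  (forall s, S s -> T s = U s) -> T = U.
Proof.
move=> Sd STU; apply: adjointable_eq => x; apply: hinner_inj => y.
rewrite -!op_starPl; apply: (dense_eq Sd) x => [||s Ss]; try exact: blin_inner.
by rewrite !op_starPl STU.
Qed.

(** An adjointable operator has a closed graph, so that bounds pass from a dense
    subspace to the whole module. *)
Lemma Nb_dense E (S : set E) (T : 'L(E)) c : 0 <= c -> densely_spans S ->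
  (forall x, lspan S x -> nrm (T x) <= c * nrm x) -> Nb T c.
Proof.
move=> c0 /densely_spansP Sd Tc x.
have /choice[u Hu] n : exists y, lspan S y /\ nrm (x - y) <= n.+1%:R^-1.
  by have [|y] := Sd x n.+1%:R^-1; [|exists y].
have ux : tends u x.
  move=> e e0; have [N HN] := archi_seq e0; exists N => n Nn; rewrite nrmC.
  exact: le_trans (Hu n).2 (HN n Nn).
have lS := @lspan_idem R E S.
have [|l Tul] := @complete_seq _ E (fun n => T (u n)).
  move=> e e0; have [|N HN] := tends_cauchy ux (_ : 0 < e / (c + 1)).
    by rewrite divr_gt0 //; lra.
  exists N => n m Nn Nm; have := HN n m Nn Nm; rewrite ler_pdivlMr; last lra.
  have := Tc (u n - u m); rewrite op_sub => /(_ _) H1 H2.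
  apply: le_trans (H1 _) _; first by apply: (lspan_B lS); exact: (Hu _).1.
  have := nrm_ge0 (u n - u m); nra.
have -> : T x = l.
  apply: hinner_inj => y; rewrite -op_starPl.
  apply: (tends_unique (blin_tends (blin_inner (T^† y)) ux)).
  apply: eq_tends (blin_tends (blin_inner y) Tul) => n /=.
  by rewrite op_starPl.
apply/ler_addgt0Pr => e e0.
have [N HN] := ux (e / 2 / (c + 1)) ltac:(rewrite divr_gt0 //; lra).
have [M HM] := Tul (e / 2) ltac:(lra).
pose n := maxn N M; have := HN n (leq_maxl _ _).
rewrite ler_pdivlMr; last lra.
move=> H1; have := HM n (leq_maxr _ _).
have := Tc (u n) (Hu n).1; have := nrmD (l - T (u n)) (T (u n)).
have := ler_wpM2l c0 (nrmD (u n - x) x).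
rewrite !subrK (nrmC l); have := nrm_ge0 (u n - x); lra.
Qed.

Lemma hinner_sumr E x n (f : 'I_n -> E) :
  << x | \sum_(i < n) f i >> = \sum_(i < n) << x | f i >>.
Proof.
apply: (big_morph (fun y => << x | y >>)); first exact: hinnerDr.
exact: hinner0r.
Qed.

Lemma hinner_suml E x n (f : 'I_n -> E) :
  << \sum_(i < n) f i | x >> = \sum_(i < n) << f i | x >>.
Proof.
apply: (big_morph (fun y => << y | x >>)) => [y z|]; first exact: hinnerDl.
exact: hinner0l.
Qed.

(** The combinations of the vectors s i measure the defect in the bound. *)
Lemma gram_bound E F G (I : Type) (w : I -> E) (s : I -> F) (v : I -> G) c :
  0 <= c -> (forall i j, << w i | w j >> + << s i | s j >> =
    (c * c)%:C *: << v i | v j >>) ->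
  forall n (k : 'I_n -> R[i]) (i : 'I_n -> I),
    nrm (\sum_(j < n) k j *: w (i j)) <= c * nrm (\sum_(j < n) k j *: v (i j)).
Proof.
move=> c0 H n k i.
apply: (cpos_nrm (s := \sum_(j < n) k j *: s (i j)) c0).
rewrite !hinner_suml scaler_sumr -big_split; apply: eq_bigr => j _ /=.
rewrite !hinner_sumr scaler_sumr -big_split; apply: eq_bigr => l _ /=.
rewrite !hinnerZl !hinnerZr -!scalerDr H !scalerA.
by congr (_ *: _); ring.
Qed.

(** By duality the bound on w in terms of v gives the same bound on z in terms
    of u. Both maps extend, and the extensions are adjoint to each other. *)
Lemma adj_extend E (I J : Type) (v w : I -> E) (u z : J -> E) c : 0 <= c ->
  densely_spans (range v) -> densely_spans (range u) ->
  (forall i j, << w i | u j >> = << v i | z j >>) ->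
  (forall n (k : 'I_n -> R[i]) (i : 'I_n -> I),
    nrm (\sum_(j < n) k j *: w (i j)) <= c * nrm (\sum_(j < n) k j *: v (i j))) ->
  exists T : 'L(E), Nb T c /\ forall i, T (v i) = w i.
Proof.
move=> c0 vd ud wu wb; have [T [Tl Tc Tv]] := extend_bounded c0 vd wb.
have Tb : blin T by split=> //; exists c.
have TZ n (k : 'I_n -> R[i]) (i : 'I_n -> J) x :
    << \sum_(j < n) k j *: u (i j) | T x >> = << \sum_(j < n) k j *: z (i j) | x >>.
  move: x; apply: (dense_eq vd); first exact: blin_comp Tb (blin_inner _).
    exact: blin_inner.
  move=> _ [j _ <-]; rewrite Tv !hinner_suml; apply: eq_bigr => l _.
  by rewrite !hinnerZl -(hinner_star (w j)) wu hinner_star.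
have zb n (k : 'I_n -> R[i]) (i : 'I_n -> J) :
    nrm (\sum_(j < n) k j *: z (i j)) <= c * nrm (\sum_(j < n) k j *: u (i j)).
  set Z := \sum_(j < n) k j *: z (i j); set U := \sum_(j < n) k j *: u (i j).
  have := hilbert_CS U (T Z); rewrite TZ nrm_inner.
  have := Tc Z; have := nrm_ge0 Z; have := nrm_ge0 U.
  have [->|Z0] := eqVneq (nrm Z) 0 => U0 Z1 H1 H2; first by rewrite mulr_ge0.
  have Zp : 0 < nrm Z by rewrite lt_def Z0.
  rewrite -(ler_pM2r Zp); nra.
have [T' [Tl' Tc' Tu]] := extend_bounded c0 ud zb.
have Tb' : blin T' by split=> //; exists c.
have TP x y : << T x | y >> = << x | T' y >>.
  move: y; apply: (dense_eq ud); [exact: blin_inner|exact: blin_comp Tb' (blin_inner _)|].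
  move=> _ [j _ <-]; rewrite Tu -hinner_star -[RHS]hinner_star; congr (_^†).
  by have := TZ 1 (fun=> 1) (fun=> j) x; rewrite !big_ord1 !scale1r.
by exists (Adjointable TP); split.
Qed.

End HilbertDense.

Section DirectSum.
Context (R : realType) (B : cstarAlgType R[i]) (I : Type).
Context (X : I -> hilbertModType B) (F : direct_sum X).
Local Notation dsum_vec := (fun p : {i : I & X i} => dsum_in F (projT2 p)).

Lemma dsum_dense : densely_spans (range dsum_vec).
Proof.
have -> : range dsum_vec = [set v | exists i (x : X i), v = dsum_in F x].
  apply/seteqP; split=> [_ [[i x] _ <-]|_ [i [x ->]]]; first by exists i, x.
  by exists (existT _ i x).
exact: dsum_in_total.
Qed.

Lemma dsum_inP i k (x y : X i) :
  dsum_in F (k *: x + y) = k *: dsum_in F x + dsum_in F y.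
Proof.
apply: (dense_inner_eq dsum_dense) => _ [[j z] _ <-] /=.
rewrite hinnerDr hinnerZr.
have [ji|ji] := pselect (j = i); last by rewrite !dsum_in_orth // scaler0 addr0.
by subst j; rewrite !dsum_in_inner hinnerDr hinnerZr.
Qed.

Lemma blin_dsum i : blin (@dsum_in _ _ _ _ F i).
Proof.
split; first exact: dsum_inP.
exists 1 => // x; rewrite mul1r -(@ler_pXn2r _ 2) ?nnegrE ?nrm_ge0 //.
by rewrite -!nrm_inner dsum_in_inner.
Qed.

(** Representations on the summands add up to a representation on the sum; the
    Gram matrix with c^2 - a^† a = (c - q)^2 provides the bound. *)
Lemma dsum_rep (A : cstarAlgType R[i]) (f : forall i, A -> 'L(X i)) :
  (forall i, star_hom (f i)) -> forall a, exists T : 'L(F), Nb T (nrm a) /\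
    forall i (x : X i), T (dsum_in F x) = dsum_in F (f i a x).
Proof.
move=> fh a; have [q [qsa aq]] := defect (lexx (nrm a)).
pose w (b : A) (p : {i : I & X i}) := dsum_in F (f (projT1 p) b (projT2 p)).
pose s (p : {i : I & X i}) := dsum_in F
  ((nrm a)%:C *: projT2 p - f (projT1 p) q (projT2 p)).
have [||T [Ta TE]] := @adj_extend _ _ F _ _ dsum_vec (w a) dsum_vec (w a^†)
  (nrm a) (nrm_ge0 a) dsum_dense dsum_dense.
- move=> [i x] [j y]; rewrite /w /=.
  have [ij|ij] := pselect (i = j); last by rewrite !dsum_in_orth.
  by subst j; rewrite !dsum_in_inner op_starP (star_hom_star (fh i)).
- apply: (gram_bound (w := w a) (s := s) (v := dsum_vec) (nrm_ge0 a)).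
  move=> [i x] [j y].
  rewrite /w /s /=.
  have [ij|ij] := pselect (i = j); last by rewrite !dsum_in_orth // addr0 scaler0.
  subst j; rewrite !dsum_in_inner.
  exact: (rep_defect (fh i)).
by exists T; split=> // i x; exact: (TE (existT _ i x)).
Qed.

End DirectSum.

(** * Hilbert modules of functions with prescribed inner products *)

(** A Hilbert A-module of operators from a module H to a Hilbert module G can be
    handled without constructing H: its elements are known through their values
    on a set T of vectors of H, the inner product of w and v is the element a of
    A with gram w v a, and a in A acts by composition with shift a. *)
Record gram_space (R : realType) (A : cstarAlgType R[i]) (T : Type)
    (G : completeNormedModType R[i]) := GramSpace {
  gs_gram : (T -> G) -> (T -> G) -> A -> Prop;
  gs_shift : A -> T -> T;
  gs_const : T -> R;
  gs_dom : set (T -> G);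
  gs_fun : forall w v a b, gs_gram w v a -> gs_gram w v b -> a = b;
  gs_lin : forall w v v' a a' k, gs_gram w v a -> gs_gram w v' a' ->
    gs_gram w (k *: v + v') (k *: a + a');
  gs_star : forall w v a, gs_gram w v a -> gs_gram v w a^†;
  gs_pos : forall w a, gs_gram w w a -> cpositive a;
  gs_eval : forall w a x, gs_gram w w a -> nrm (w x) ^+ 2 <= gs_const x * nrm a;
  gs_act : forall w v a b, gs_gram w v a -> gs_gram w (v \o gs_shift b) (a ** b);
  gs_lim : forall (w v : nat -> T -> G) (a : nat -> A) w0 v0 a0,
    (forall n, gs_gram (w n) (v n) (a n)) ->
    (forall x, tends (fun n => w n x) (w0 x)) ->
    (forall x, tends (fun n => v n x) (v0 x)) -> tends a a0 -> gs_gram w0 v0 a0;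
  gs_dom0 : gs_dom 0;
  gs_domP : forall k w v, gs_dom w -> gs_dom v -> gs_dom (k *: w + v);
  gs_dom_gram : forall w v, gs_dom w -> gs_dom v -> exists a, gs_gram w v a;
  gs_dom_act : forall w a, gs_dom w -> gs_dom (w \o gs_shift a)
}.

Section GramSpace.
Context (R : realType) (A : cstarAlgType R[i]) (T : Type)
  (G : completeNormedModType R[i]) (S : gram_space A T G).
Implicit Types (w v : T -> G) (a b : A).
Local Notation gram := (gs_gram S).

Definition has_gram w v := exists a, gram w v a.
Definition gip w v : A := xget 0 [set a | gram w v a].

Lemma gipP w v : has_gram w v -> gram w v (gip w v).
Proof. by move=> [a wva]; exact: (xgetPex 0 (ex_intro _ a wva)). Qed.

Lemma gipE w v a : gram w v a -> gip w v = a.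
Proof.
move=> H; have Hwv : has_gram w v by exists a.
exact: gs_fun (gipP Hwv) H.
Qed.

Lemma gram_linl w w' v a a' k : gram w v a -> gram w' v a' ->
  gram (k *: w + w') v (k^*%R *: a + a').
Proof.
move=> /gs_star H /gs_star H'; have := gs_star (gs_lin k H H').
by rewrite astarD astarZ !astarK.
Qed.

(** The elementary theory is needed for the initial set of functions and again
    for its completion, hence for any set of this kind. *)
Definition gclosed (V : set (T -> G)) := [/\ V 0,
  forall k w v, V w -> V v -> V (k *: w + v),
  forall w v, V w -> V v -> has_gram w v &
  forall w a, V w -> V (w \o gs_shift S a)].

Definition gn w : R := Num.sqrt (nrm (gip w w)).

Lemma gn_ge0 w : 0 <= gn w. Proof. exact: sqrtr_ge0. Qed.
Lemma gn_sq w : gn w ^+ 2 = nrm (gip w w).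
Proof. by rewrite sqr_sqrtr // nrm_ge0. Qed.

Definition gconst x : R := Num.max (gs_const S x) 1.

Lemma gconst_gt0 x : 0 < gconst x.
Proof. by rewrite lt_max ltr01 orbT. Qed.

Lemma gram_eval w a x : gram w w a -> nrm (w x) <= gconst x * gn w.
Proof.
move=> H; have := gs_eval x H; rewrite -(gipE H) -gn_sq => K.
have g0 := gn_ge0 w; have c0 := ltW (gconst_gt0 x).
rewrite -(@ler_pXn2r _ 2) ?nnegrE ?nrm_ge0 ?(mulr_ge0 c0 g0) //.
apply: le_trans K _; rewrite exprMn; apply: ler_wpM2r; first exact: sqr_ge0.
have c1 : gs_const S x <= gconst x by rewrite le_max lexx.
have : 1 <= gconst x by rewrite le_max lexx orbT.
nra.
Qed.

Section Closed.
Variable V : set (T -> G).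
Hypothesis Vcl : gclosed V.

Lemma gcl0 : V 0. Proof. by case: Vcl. Qed.
Lemma gclP k w v : V w -> V v -> V (k *: w + v).
Proof. by case: Vcl => _ H _ _; exact: H. Qed.
Lemma gclD w v : V w -> V v -> V (w + v).
Proof. by move=> Vw Vv; rewrite -[w]scale1r; exact: gclP. Qed.
Lemma gclZ k w : V w -> V (k *: w).
Proof. by move=> Vw; rewrite -[_ *: _]addr0; apply: gclP gcl0. Qed.
Lemma gclB w v : V w -> V v -> V (w - v).
Proof. by move=> Vw /(gclZ (-1)); rewrite scaleN1r; exact: gclD. Qed.
Lemma gclA w a : V w -> V (w \o gs_shift S a).
Proof. by case: Vcl => _ _ _ H; exact: H. Qed.
Lemma gcl_gram w v : V w -> V v -> gram w v (gip w v).
Proof. by case: Vcl => _ _ H _ Vw Vv; exact/gipP/H. Qed.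

Lemma gipPr k u w v : V u -> V w -> V v ->
  gip u (k *: w + v) = k *: gip u w + gip u v.
Proof. by move=> Vu Vw Vv; apply: gipE; apply: gs_lin; exact: gcl_gram. Qed.
Lemma gip_star w v : V w -> V v -> (gip w v)^† = gip v w.
Proof. by move=> Vw Vv; apply/esym/gipE/gs_star; exact: gcl_gram. Qed.
Lemma gip_act w v a : V w -> V v -> gip w (v \o gs_shift S a) = gip w v ** a.
Proof. by move=> Vw Vv; apply: gipE; apply: gs_act; exact: gcl_gram. Qed.
Lemma gip_pos w : V w -> cpositive (gip w w).
Proof. by move=> Vw; apply: gs_pos (gcl_gram Vw Vw). Qed.
Lemma gipDr u w v : V u -> V w -> V v -> gip u (w + v) = gip u w + gip u v.
Proof. by move=> Vu Vw Vv; have := gipPr 1 Vu Vw Vv; rewrite !scale1r. Qed.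
Lemma gipBr u w v : V u -> V w -> V v -> gip u (w - v) = gip u w - gip u v.
Proof.
by move=> Vu Vw Vv; have := gipPr (-1) Vu Vv Vw; rewrite !scaleN1r ![- _ + _]addrC.
Qed.
Lemma gipDl u w v : V u -> V w -> V v -> gip (w + v) u = gip w u + gip v u.
Proof.
move=> Vu Vw Vv; rewrite -gip_star //; last exact: gclD.
by rewrite gipDr // astarD !gip_star.
Qed.
Lemma gipBl u w v : V u -> V w -> V v -> gip (w - v) u = gip w u - gip v u.
Proof.
move=> Vu Vw Vv; rewrite -gip_star //; last exact: gclB.
by rewrite gipBr // astarB !gip_star.
Qed.
Lemma gipZ k w : V w -> gip (k *: w) (k *: w) = (k^* * k)%R *: gip w w.
Proof.
move=> Vw; apply: gipE; have gw := gcl_gram Vw Vw.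
have := gs_lin k (gcl_gram (gclZ k Vw) Vw) (gcl_gram (gclZ k Vw) gcl0).
rewrite addr0; have -> : gip (k *: w) 0 = 0.
  by apply: (addrI (gip (k *: w) 0)); rewrite -gipDr ?addr0 //;
    [exact: gclZ|exact: gcl0|exact: gcl0].
have := gram_linl k gw (gcl_gram gcl0 Vw).
have -> : gip 0 w = 0.
  by apply: (addrI (gip 0 w)); rewrite -gipDl ?addr0 //; exact: gcl0.
by rewrite !addr0 => /gipE ->; rewrite scalerA mulrC.
Qed.
Lemma gip_actl w v a : V w -> V v -> gip (v \o gs_shift S a) w = a^† ** gip v w.
Proof.
by move=> Vw Vv; rewrite -gip_star ?gip_act ?astarM ?gip_star //; exact: gclA.
Qed.

Lemma gip_eq0 w : V w -> gip w w = 0 -> w = 0.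
Proof.
move=> Vw w0; apply/funext => x; have := gs_eval x (gcl_gram Vw Vw).
rewrite w0 nrm0 mulr0 => H; apply: nrm_le0.
by rewrite -(@ler_pXn2r _ 2) ?nnegrE ?nrm_ge0 // expr0n.
Qed.

Lemma gip_CS_pos w v (z : A) : V w -> V v ->
  cpositive (z^† ** gip w w ** z - z^† ** gip w v - (gip w v)^† ** z + gip v v).
Proof.
move=> Vw Vv; have Vz := gclA z Vw; have VB := gclB Vz Vv.
rewrite (_ : _ + _ = gip (w \o gs_shift S z - v) (w \o gs_shift S z - v)).
  exact: gip_pos.
rewrite gip_star // !gipBr // !gipBl // !gip_act // !gip_actl //; starring.
Qed.

Lemma gip_CS w v : V w -> V v -> nrm (gip w v) <= gn w * gn v.
Proof.
move=> Vw Vv; rewrite -(@ler_pXn2r _ 2) ?nnegrE ?mulr_ge0 ?gn_ge0 ?nrm_ge0 //.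
rewrite exprMn !gn_sq; apply: cs_alg; first exact: gip_pos.
by move=> z; exact: gip_CS_pos.
Qed.

Lemma gnD w v : V w -> V v -> gn (w + v) <= gn w + gn v.
Proof.
move=> Vw Vv; have w0 := gn_ge0 w; have v0 := gn_ge0 v.
rewrite -(@ler_pXn2r _ 2) ?nnegrE ?addr_ge0 ?gn_ge0 // gn_sq.
have VD := gclD Vw Vv; rewrite gipDr // !gipDl //.
have := nrmD (gip w w + gip v w) (gip w v + gip v v).
have := nrmD (gip w w) (gip v w); have := nrmD (gip w v) (gip v v).
have := gip_CS Vw Vv; have := gip_CS Vv Vw; rewrite -!gn_sq; nra.
Qed.

Lemma gnZ k w : V w -> gn (k *: w) = complex.Re `|k| * gn w.
Proof.
move=> Vw; have k0 : 0 <= complex.Re `|k| by rewrite normc_def /= sqrtr_ge0.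
apply/eqP; rewrite -(@eqrXn2 _ 2) ?mulr_ge0 ?gn_ge0 //.
rewrite exprMn !gn_sq gipZ // nrmZ normrM norm_conjC; apply/eqP; congr (_ * _).
by rewrite normc_def -rmorphM /= expr2.
Qed.

Lemma gnN w : V w -> gn (- w) = gn w.
Proof.
by move=> Vw; rewrite -scaleN1r gnZ // normrN1 /= mul1r.
Qed.

Lemma gnC w v : V w -> V v -> gn (w - v) = gn (v - w).
Proof. by move=> Vw Vv; rewrite -(gnN (gclB Vv Vw)) opprB. Qed.

Lemma gn_trans u w v : V u -> V w -> V v -> gn (w - v) <= gn (w - u) + gn (u - v).
Proof.
by move=> Vu Vw Vv; rewrite -[w - v](subrKA u); apply: gnD; exact: gclB.
Qed.

Definition gcauchy (u : nat -> T -> G) := forall e : R, 0 < e ->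
  exists N, forall n m, (N <= n)%N -> (N <= m)%N -> gn (u n - u m) <= e.

Definition ptends (u : nat -> T -> G) w := forall x, tends (fun n => u n x) (w x).

Lemma gcauchy_pt u : (forall n, V (u n)) -> gcauchy u -> exists w, ptends u w.
Proof.
move=> Vu cu; suff /choice[w Hw] : forall x, exists l, tends (fun n => u n x) l.
  by exists w.
move=> x; apply: complete_seq => e e0.
have [|N HN] := cu (e / gconst x); first by rewrite divr_gt0 // gconst_gt0.
exists N => n m Nn Nm; have := HN n m Nn Nm.
rewrite ler_pdivlMr ?gconst_gt0 // mulrC; apply: le_trans.
have Vnm := gclB (Vu n) (Vu m).
exact: (gram_eval x (gcl_gram Vnm Vnm)).
Qed.

Lemma gcauchy_bounded u : (forall n, V (u n)) -> gcauchy u ->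
  exists2 C, 0 <= C & exists N, forall n, (N <= n)%N -> gn (u n) <= C.
Proof.
move=> Vu cu; have [N HN] := cu 1 ltr01; exists (1 + gn (u N)).
  by rewrite addr_ge0 // gn_ge0.
exists N => n Nn; rewrite -(subrK (u N) (u n)).
apply: le_trans (gnD (gclB (Vu n) (Vu N)) (Vu N)) _.
by rewrite lerD2r; exact: HN.
Qed.

(** Inner products converge along gram-Cauchy sequences, and pointwise limits
    inherit them. *)
Lemma gram_limit u u' w w' : (forall n, V (u n)) -> (forall n, V (u' n)) ->
  gcauchy u -> gcauchy u' -> ptends u w -> ptends u' w' ->
  gram w w' (gip w w') /\ tends (fun n => gip (u n) (u' n)) (gip w w').
Proof.
move=> Vu Vu' cu cu' uw uw'.
have [C C0 [M HM]] := gcauchy_bounded Vu cu.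
have [C' C'0 [M' HM']] := gcauchy_bounded Vu' cu'.
have [|a ua] := @complete_seq _ A (fun n => gip (u n) (u' n)).
  move=> e e0; pose d := e / (C + C' + 1).
  have d0 : 0 < d by rewrite divr_gt0 //; lra.
  have de : d * (C + C' + 1) = e by rewrite mulfVK //; lra.
  have [N HN] := cu _ d0; have [N' HN'] := cu' _ d0.
  exists (maxn (maxn N N') (maxn M M')) => n m.
  rewrite !geq_max => /andP[/andP[Nn Nn'] /andP[Mn Mn']].
  move=> /andP[/andP[Nm Nm'] /andP[Mm Mm']].
  have -> : gip (u n) (u' n) - gip (u m) (u' m) =
      gip (u n - u m) (u' n) + gip (u m) (u' n - u' m).
    by rewrite gipBl // gipBr //; zmod.
  have := nrmD (gip (u n - u m) (u' n)) (gip (u m) (u' n - u' m)).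
  have := gip_CS (gclB (Vu n) (Vu m)) (Vu' n).
  have := gip_CS (Vu m) (gclB (Vu' n) (Vu' m)).
  have := ler_pM (gn_ge0 _) (gn_ge0 _) (HN n m Nn Nm) (HM' n Mn').
  have := ler_pM (gn_ge0 _) (gn_ge0 _) (HM m Mm) (HN' n m Nn' Nm').
  lra.
have ww' : gram w w' a by apply: gs_lim uw uw' ua => n; exact: gcl_gram.
by rewrite (gipE ww').
Qed.

End Closed.
End GramSpace.

Section GramModule.
Context (R : realType) (A : cstarAlgType R[i]) (T : Type)
  (G : completeNormedModType R[i]) (S : gram_space A T G).
Implicit Types (w v : T -> G) (a b : A).
Local Notation gram := (gs_gram S).
Local Notation V := (gs_dom S).
Local Notation gip := (gip S).
Local Notation gn := (gn S).
Local Notation gcauchy := (gcauchy S).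

(** The completion of the initial set: a Cauchy sequence for gn converges at
    every point of T by gs_eval, and is represented by its pointwise limit. *)
Definition gclosure : set (T -> G) := [set w | exists u : nat -> T -> G,
  [/\ forall n, V (u n), gcauchy u & ptends u w]].

Lemma dom_closed : gclosed S V.
Proof.
split; [exact: gs_dom0|exact: gs_domP| |exact: gs_dom_act].
exact: gs_dom_gram.
Qed.

Lemma gn0 : gn 0 = 0.
Proof.
have V0 := gs_dom0 S; rewrite /gn (gipE (a := 0)) ?nrm0 ?sqrtr0 //.
have := gs_lin (-1) (gcl_gram dom_closed V0 V0) (gcl_gram dom_closed V0 V0).
by rewrite scaler0 addr0 scaleN1r addNr.
Qed.

Lemma gcauchyP k (u v : nat -> T -> G) : (forall n, V (u n)) ->
  (forall n, V (v n)) -> gcauchy u -> gcauchy v ->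
  gcauchy (fun n => k *: u n + v n).
Proof.
move=> Vu Vv cu cv e e0; pose K := complex.Re `|k|.
have K0 : 0 <= K by rewrite /K normc_def /= sqrtr_ge0.
have d0 : 0 < e / (K + 1) by rewrite divr_gt0 //; lra.
have de : e / (K + 1) * (K + 1) = e by rewrite mulfVK //; lra.
have [N HN] := cu _ d0; have [M HM] := cv _ d0.
exists (maxn N M) => n m; rewrite !geq_max => /andP[Nn Mn] /andP[Nm Mm].
have Vunm := gclB dom_closed (Vu n) (Vu m).
have Vvnm := gclB dom_closed (Vv n) (Vv m).
rewrite (_ : _ - _ = k *: (u n - u m) + (v n - v m)); last first.
  by rewrite scalerBr; zmod.
have := gnD dom_closed (gclZ dom_closed k Vunm) Vvnm.
rewrite (gnZ dom_closed k Vunm) -/K.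
have := ler_wpM2l K0 (HN n m Nn Nm); have := HM n m Mn Mm; lra.
Qed.

Lemma ptendsP k (u v : nat -> T -> G) w w' : ptends u w -> ptends v w' ->
  ptends (fun n => k *: u n + v n) (k *: w + w').
Proof. by move=> uw vw x; exact: tendsD (tendsZ k (uw x)) (vw x). Qed.

Lemma gcauchyA (u : nat -> T -> G) a : (forall n, V (u n)) -> gcauchy u ->
  gcauchy (fun n => u n \o gs_shift S a).
Proof.
move=> Vu cu e e0; have a0 := nrm_ge0 a.
have [|N HN] := cu (e / (nrm a + 1)); first by rewrite divr_gt0 //; lra.
exists N => n m Nn Nm; have := HN n m Nn Nm.
rewrite ler_pdivlMr; last lra.
have Vnm := gclB dom_closed (Vu n) (Vu m).
have -> : (u n \o gs_shift S a) - (u m \o gs_shift S a) =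
    (u n - u m) \o gs_shift S a by [].
have VA := gclA dom_closed a Vnm.
have g0 := gn_ge0 S (u n - u m); move=> H.
rewrite -(@ler_pXn2r _ 2) ?nnegrE ?gn_ge0 //; last exact: ltW.
rewrite gn_sq (gip_act dom_closed) // (gip_actl dom_closed) //.
apply: le_trans (nrmM _ _) _; have := nrmM a^† (gip (u n - u m) (u n - u m)).
rewrite nrm_star -gn_sq.
move: (nrm (_ ** _)) (gn _) (nrm a) g0 a0 H => x g b g0 b0 H xb.
apply: le_trans (ler_wpM2r b0 xb) _.
rewrite (_ : b * g ^+ 2 * b = (g * b) ^+ 2); last by ring.
by rewrite ler_pXn2r ?nnegrE ?mulr_ge0 //; [nra|exact: ltW].
Qed.

Lemma gclosure_dom : V `<=` gclosure.
Proof.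
move=> w Vw; exists (fun=> w); split=> // [e e0|x]; last exact: tends_cst.
by exists 0 => n m _ _; rewrite subrr gn0 ltW.
Qed.

Lemma gclosure_closed : gclosed S gclosure.
Proof.
split.
- by apply: gclosure_dom; exact: gs_dom0.
- move=> k w v [u [Vu cu uw]] [u' [Vu' cu' uv]].
  exists (fun n => k *: u n + u' n); split; last exact: ptendsP.
    by move=> n; exact: gs_domP.
  exact: gcauchyP.
- move=> w v [u [Vu cu uw]] [u' [Vu' cu' uv]].
  by have [H _] := gram_limit dom_closed Vu Vu' cu cu' uw uv; exists (gip w v).
- move=> w a [u [Vu cu uw]]; exists (fun n => u n \o gs_shift S a); split.
  + by move=> n; exact: gs_dom_act.
  + exact: gcauchyA.
  + by move=> x; exact: uw.
Qed.

(** The pointwise limit is a limit for gn as well: apply gram_limit to the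
    sequence u m - u n with n fixed. *)
Lemma gclosure_near w (u : nat -> T -> G) : (forall n, V (u n)) -> gcauchy u ->
  ptends u w -> forall e, 0 < e -> exists N, forall n, (N <= n)%N -> gn (w - u n) <= e.
Proof.
move=> Vu cu uw e e0; have [N HN] := cu e e0; exists N => n Nn.
rewrite -(@ler_pXn2r _ 2) ?nnegrE ?gn_ge0 //; last exact: ltW.
pose z m := u (N + m)%N - u n.
have Vz m : V (z m) by exact: (gclB dom_closed).
have cz : gcauchy z.
  move=> d /cu[M HM]; exists M => k l Mk Ml; rewrite /z opprD addrACA opprK.
  rewrite addNr addr0.
  by apply: HM; [apply: leq_trans Mk _|apply: leq_trans Ml _]; exact: leq_addl.
have zw : ptends z (w - u n).
  move=> x; apply: tendsD; last exact: tends_cst.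
  exact: (@tends_shift _ _ (fun m => u m x)).
have [_ H] := gram_limit dom_closed Vz Vz cz cz zw zw.
rewrite gn_sq; apply: tends_le H _ => m; rewrite -gn_sq.
rewrite ler_pXn2r ?nnegrE ?gn_ge0 //; last exact: ltW.
by apply: HN => //; exact: leq_addr.
Qed.

Lemma gclosure_complete (w : nat -> T -> G) : (forall n, gclosure (w n)) ->
  gcauchy w -> exists2 l, gclosure l &
    forall e, 0 < e -> exists N, forall n, (N <= n)%N -> gn (w n - l) <= e.
Proof.
move=> Cw cw; have cl := gclosure_closed.
have /choice[v Hv] n : exists v, V v /\ gn (w n - v) <= n.+1%:R^-1.
  have [u [Vu cu uw]] := Cw n.
  have [|N HN] := gclosure_near Vu cu uw (_ : 0 < n.+1%:R^-1); first by [].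
  by exists (u N); split=> //; exact: HN.
have Vv n : V (v n) by exact: (Hv n).1.
have Cv n : gclosure (v n) by exact: gclosure_dom.
have vN e : 0 < e -> exists N, forall n, (N <= n)%N -> gn (w n - v n) <= e.
  move=> e0; have [N HN] := archi_seq e0; exists N => n Nn.
  exact: le_trans (Hv n).2 (HN n Nn).
have cv : gcauchy v.
  move=> e e0; have [|N HN] := vN (e / 3); first lra.
  have [|M HM] := cw (e / 3); first lra.
  exists (maxn N M) => n m; rewrite !geq_max => /andP[Nn Mn] /andP[Nm Mm].
  have := gn_trans cl (Cw n) (Cv n) (Cv m).
  have := gn_trans cl (Cw m) (Cw n) (Cv m).
  rewrite (gnC cl (Cv n) (Cw n)).
  have := HN n Nn; have := HN m Nm; have := HM n m Mn Mm; lra.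
have [l vl] := gcauchy_pt dom_closed Vv cv.
have Cl : gclosure l by exists v.
exists l => // e e0; have [|N HN] := vN (e / 2); first lra.
have [|M HM] := gclosure_near Vv cv vl (_ : 0 < e / 2); first lra.
exists (maxn N M) => n; rewrite geq_max => /andP[Nn Mn].
have := gn_trans cl (Cv n) (Cw n) Cl; rewrite (gnC cl (Cv n) Cl).
have := HN n Nn; have := HM n Mn; lra.
Qed.

(** The limit for gn exists by completeness, and coincides with the pointwise
    limit by gs_eval. *)
Lemma gclosure_ptends (u : nat -> T -> G) w : (forall n, gclosure (u n)) ->
  gcauchy u -> ptends u w -> gclosure w.
Proof.
move=> Cu cu uw; have cl := gclosure_closed.
have [l Cl ul] := gclosure_complete Cu cu.
suff -> : w = l by [].
apply/funext => x; apply: tends_unique (uw x) _ => e e0.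
have [|N HN] := ul (e / gconst S x); first by rewrite divr_gt0 // gconst_gt0.
exists N => n /HN; rewrite ler_pdivlMr ?gconst_gt0 // mulrC; apply: le_trans.
have Cd := gclB cl (Cu n) Cl.
exact: (gram_eval x (gcl_gram cl Cd Cd)).
Qed.

Definition gpred : {pred T -> G} := [pred w | `[< gclosure w >]].

Fact gpred_submod : GRing.submod_closed gpred.
Proof.
have [C0 CP _ _] := gclosure_closed; split; first exact/asboolP.
by move=> k w v /asboolP Cw /asboolP Cv; apply/asboolP; exact: CP.
Qed.

HB.instance Definition _ :=
  GRing.isSubmodClosed.Build R[i] (T -> G) gpred gpred_submod.

Record gmod := Gmod { gfun :> T -> G; gfun_in : gfun \in gpred }.

HB.instance Definition _ := [isSub for gfun].
HB.instance Definition _ := [Choice of gmod by <:].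
HB.instance Definition _ := [SubChoice_isSubLmodule of gmod by <:].

Lemma gfunP (m : gmod) : gclosure m.
Proof. exact/asboolP/gfun_in. Qed.

Definition gmk w (Cw : gclosure w) : gmod := Gmod (introT (asboolP _) Cw).

Lemma gmod_eq (m n : gmod) : (m : T -> G) = n -> m = n.
Proof. exact: val_inj. Qed.

End GramModule.

Section GramModuleHilbert.
Context (R : realType) (A : cstarAlgType R[i]) (T : Type)
  (G : completeNormedModType R[i]) (S : gram_space A T G).
Local Notation M := (gmod S).
Local Notation cl := (gclosure_closed S).
Implicit Types (m n : M) (a b : A).

Let Mnorm m : R[i] := (gn S m)%:C.

Fact gmod_normD m n : Mnorm (m + n) <= Mnorm m + Mnorm n.
Proof. by rewrite /Mnorm -rmorphD lecR; apply: (gnD cl); exact: gfunP. Qed.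

Fact gmod_normZ k m : Mnorm (k *: m) = `|k| * Mnorm m.
Proof.
rewrite /Mnorm (_ : gfun (k *: m) = k *: gfun m) //.
by rewrite (gnZ cl k (gfunP m)) rmorphM; congr (_ * _); rewrite normc_def.
Qed.

Fact gmod_norm_eq0 m : Mnorm m = 0 -> m = 0.
Proof.
move=> /complexI m0; apply/gmod_eq/(gip_eq0 cl (gfunP m)).
by apply: nrm_le0; rewrite -gn_sq m0 expr0n.
Qed.

HB.instance Definition _ := Lmodule_isNormed.Build R[i] M
  gmod_normD gmod_normZ gmod_norm_eq0.

Lemma gmod_nrm m : nrm m = gn S m. Proof. by []. Qed.

Fact gmod_complete (F : set_system M) : ProperFilter F -> cauchy F -> cvg F.
Proof.
apply: seq_complete => u cu.
have [|l Cl Hl] := gclosure_complete (w := fun k => gfun (u k)) (fun=> gfunP _).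
  by move=> e /cu[N HN]; exists N => n m Nn Nm; exact: (HN n m).
by exists (gmk Cl) => e /Hl[N HN]; exists N => n /HN.
Qed.

HB.instance Definition _ := Uniform_isComplete.Build M gmod_complete.

Definition gmod_act m a : M := gmk (gclA cl a (gfunP m)).
Definition gmod_inner m n : A := gip S m n.

Lemma gmodP m n : gs_gram S m n (gmod_inner m n).
Proof. by apply: (gcl_gram cl); exact: gfunP. Qed.

Lemma gmod_innerE m n a : gs_gram S m n a -> gmod_inner m n = a.
Proof. exact: gipE. Qed.

Fact gmod_inner_linearr m : linear (gmod_inner m).
Proof. by move=> k n p; apply: gmod_innerE; apply: gs_lin; exact: gmodP. Qed.

Fact gmod_inner_act m n b : gmod_inner m (gmod_act n b) = gmod_inner m n ** b.
Proof. by apply: gmod_innerE; apply: gs_act; exact: gmodP. Qed.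

Fact gmod_inner_star m n : (gmod_inner m n)^† = gmod_inner n m.
Proof. by apply/esym/gmod_innerE/gs_star; exact: gmodP. Qed.

Fact gmod_inner_ge0 m : cpositive (gmod_inner m m).
Proof. by apply: gs_pos; exact: gmodP. Qed.

Fact gmod_normE m : `|m| ^+ 2 = `|gmod_inner m m|.
Proof. by rewrite !nrmE -rmorphXn /= gmod_nrm gn_sq. Qed.

Lemma gmod_inner_inj m n : (forall p, gmod_inner p m = gmod_inner p n) -> m = n.
Proof.
move=> mn; apply/eqP; rewrite -subr_eq0; apply/eqP.
have : gmod_inner (m - n) (m - n) = 0.
  have := gmod_inner_linearr (m - n) (-1) n m.
  by rewrite !scaleN1r mn addNr [- n + m]addrC.
move=> H; apply: nrm_le0; rewrite -(@ler_pXn2r _ 2) ?nnegrE ?nrm_ge0 // expr0n /=.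
by rewrite -lecR rmorphXn /= -nrmE gmod_normE H normr0.
Qed.

Fact gmod_act_linearl a : linear (gmod_act ^~ a).
Proof. by move=> k m n; exact: gmod_eq. Qed.

Fact gmod_act_linearr m : linear (gmod_act m).
Proof.
move=> k a b; apply: gmod_inner_inj => p.
by rewrite gmod_inner_linearr !gmod_inner_act amulDr amulZr.
Qed.

Fact gmod_actA m a b : gmod_act m (a ** b) = gmod_act (gmod_act m a) b.
Proof. by apply: gmod_inner_inj => p; rewrite !gmod_inner_act amulA. Qed.

HB.instance Definition _ := isHilbertModule.Build R[i] A M
  gmod_act_linearl gmod_act_linearr gmod_actA gmod_inner_linearr gmod_inner_act
  gmod_inner_star gmod_inner_ge0 gmod_normE.

Definition gram_module : hilbertModType A := M.

Lemma gram_module_dense m (e : R) : 0 < e ->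
  exists2 n : M, gs_dom S n & nrm (m - n) <= e.
Proof.
move=> e0; have [u [Vu cu um]] := gfunP m.
have [N HN] := gclosure_near Vu cu um e0.
by exists (gmk (gclosure_dom (Vu N))); [exact: Vu|exact: HN].
Qed.

End GramModuleHilbert.

(** * Non-degeneracy of the semigroup on the compact operators *)

Section Nondegenerate.
Context (R : realType) (B : cstarAlgType R[i]) (E : hilbertModType B).
Context (P : monoidType) (alpha : P -> 'L(E) -> 'L(E)).
Hypothesis alpha_E0 : E0_semigroup alpha.
Context (KE : realization (compacts E)).

Lemma compacts_rank_one (x y : E) : compacts E (rank_one x y).
Proof.
apply/opnorm_closureP => e e0; exists (rank_one x y).
  by apply: sub_lspan; exists x, y.
by rewrite subrr; apply: Nb0; exact: ltW.
Qed.

(** A filter that converges strictly to 1 and contains the set of compact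
    operators. *)
Let approx : set_system 'L(E) := [set U | exists (xs : seq E) (e : R), 0 < e /\
  forall S, compacts E S -> S^† = S -> Nb S 1 ->
    (forall x, x \in xs -> nrm (S x - x) <= e) -> U S].

Let approx_filter : ProperFilter approx.
Proof.
apply: Build_ProperFilter_ex.
  move=> U [xs [e [e0 HU]]].
  have [u [Ku usa u1 ux]] := approximate_unit xs (real_subalgebra KE)
    (fun x => compacts_rank_one x x) e0.
  by exists u; exact: HU.
split=> [|U V [xs [e [e0 HU]]] [ys [d [d0 HV]]]|U V UV [xs [e [e0 HU]]]].
- by exists [::], 1; split.
- exists (xs ++ ys), (Num.min e d); split=> [|S KS Ssa S1 HS].
    by rewrite lt_min e0 d0.
  split; [apply: HU|apply: HV] => // x xs'; have := HS x; rewrite mem_cat xs' ?orbT.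
    by move=> /(_ isT)/le_trans; apply; rewrite ge_min lexx.
  by move=> /(_ isT)/le_trans; apply; rewrite ge_min lexx orbT.
- by exists xs, e; split=> // S KS Ssa S1 HS; apply: UV; exact: HU.
Qed.

(** Strict continuity: along approx the operators alpha s u tend strictly to
    alpha s 1 = 1. *)
Lemma E0_nondegenerate s x e : 0 < e ->
  exists u, compacts E u /\ nrm (alpha s u x - x) <= e.
Proof.
move=> e0.
have near y (V : 'L(E) -> E) : (forall S, S^† = S -> V S = S y) ->
    V S @[S --> approx] --> y.
  move=> VS U /nbhs_ballP[_ /ltC_realP[d d0 ->] yU].
  exists [:: y], (d / 2); split; first lra.
  move=> S _ Ssa _ /(_ y (mem_head _ _)) H; apply: yU.
  by rewrite -ball_normE /= nrmE ltcR VS // nrmC; lra.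
have cvg1 : strict_cvg approx (adj_id E).
  split; apply: near => S Ssa //.
  by rewrite -[in RHS]Ssa.
have /(_ s) strict := E0_strict alpha_E0.
have F1 : approx [set S | opnorm_le S 1].
  exists [::], 1; split=> // S _ _ S1 _ /=.
  by rewrite -[1]/(1%:C) //; apply/NbP.
have I1 : opnorm_le (adj_id E) 1.
  by move=> z; rewrite mul1r.
have [+ _] := strict _ approx_filter _ _ F1 I1 cvg1 x.
rewrite (E0_unital alpha_E0) /= => H.
have : nbhs x (ball x e%:C) by apply: nbhsx_ballx; rewrite ltr0C.
move=> /H Hx.
have {}Hx : approx [set u | ball x e%:C (alpha s u x)] by exact: Hx.
have FK : approx (compacts E) by exists [::], 1; split.
have FF : ProperFilter approx by exact: approx_filter.
have [u [/= xu Ku]] := filter_ex (filterI Hx FK).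
exists u; split=> //; move: xu; rewrite -ball_normE /= nrmE ltcR nrmC.
exact: ltW.
Qed.

End Nondegenerate.

(** * The operators of the crossed product *)

Section CompactOperators.
Context (R : realType) (B : cstarAlgType R[i]) (E : hilbertModType B).
Context (KE : realization (compacts E)).
Local Notation rho := (@real_op _ _ _ _ KE).
Local Notation rhoh := (real_op_hom KE).
Implicit Types (x y : E) (k : KE).

(** The operator x y^* as an element of the algebra KE. *)
Definition ket x y : KE := projT1 (cid (real_ex KE (compacts_rank_one x y))).

Lemma ketE x y : rho (ket x y) = rank_one x y.
Proof. by rewrite /ket; case: cid. Qed.

Lemma ket_star x y : (ket x y)^† = ket y x.
Proof. by apply: real_inj; rewrite (star_hom_star rhoh) !ketE rank_one_star. Qed.

Lemma ket_mull k x y : k ** ket x y = ket (rho k x) y.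
Proof.
apply: real_inj; rewrite (star_homM rhoh) !ketE -[_ ** _]/(rho k * rank_one x y).
exact: rank_one_mull.
Qed.

Lemma ket_mulr k x y : ket x y ** k = ket x (rho k^† y).
Proof. by rewrite -[LHS]astarK astarM ket_star ket_mull ket_star. Qed.

Lemma ketPl c x x' y : ket (c *: x + x') y = c *: ket x y + ket x' y.
Proof.
apply: real_inj; rewrite (star_homD rhoh) (star_homZ rhoh) !ketE.
by apply: adjointable_eq => z; rewrite opD opZ /= hact_linearl.
Qed.

Lemma ketBl x x' y : ket (x - x') y = ket x y - ket x' y.
Proof. by have := ketPl (-1) x' x y; rewrite !scaleN1r ![- _ + _]addrC. Qed.

Lemma ketBr x y y' : ket x (y - y') = ket x y - ket x y'.
Proof. by rewrite -ket_star ketBl astarB !ket_star. Qed.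

Lemma nrm_ket x y : nrm (ket x y) <= nrm x * nrm y.
Proof.
apply: real_Nb; first by rewrite mulr_ge0 // nrm_ge0.
by rewrite ketE; exact: Nb_rank_one.
Qed.

Lemma ket_dense : densely_spans [set k | exists x y, k = ket x y].
Proof.
apply/densely_spansP => k e e0.
have /opnorm_closureP/(_ e e0)[S [n [c [w [Hw ->]]]] HS] := real_in k.
have /choice[f Hf] i : exists k', w i = rho k' /\ exists x y, k' = ket x y.
  have [x [y ->]] := Hw i; exists (ket x y); split; [by rewrite ketE|by exists x, y].
exists (\sum_(i < n) c i *: f i).
  by exists n, c, f; split=> // i; exact: (Hf i).2.
apply: real_Nb; first exact: ltW.
rewrite (star_homB rhoh) (big_morph _ (star_homD rhoh) (star_hom0 rhoh)).
by rewrite (eq_bigr (fun i => c i *: w i)) // => i _; rewrite (star_homZ rhoh) (Hf i).1.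
Qed.

Lemma KE_approx x e : 0 < e -> exists k, nrm (rho k x - x) <= e.
Proof.
move=> e0; have [u [Ku _ _ Hu]] := approximate_unit [:: x] (real_subalgebra KE)
  (fun x => compacts_rank_one x x) e0.
by have [k kE] := real_ex KE Ku; exists k; rewrite kE Hu // mem_head.
Qed.

End CompactOperators.

Section CrossedProduct.
Context (R : realType) (P : monoidType).
Hypothesis P_rcancel : forall s t u : P, (t * s = u * s)%g -> t = u.
Context (B : cstarAlgType R[i]) (E : hilbertModType B).
Context (alpha : P -> 'L(E) -> 'L(E)).
Hypothesis alpha_E0 : E0_semigroup alpha.
Context (KE : realization (compacts E)) (alphaK : P -> KE -> KE).
Hypothesis alphaK_restr : forall s k, real_op (alphaK s k) = alpha s (real_op k).
Context (FK : direct_sum (fun _ : P => regular_module KE : hilbertModType KE)).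
Local Notation rho := (@real_op _ _ _ _ KE).
Local Notation inK := (fun t k => dsum_in FK (i := t) (k : regular_module KE)).
Implicit Types (s t u : P) (k : KE).

Lemma alphaK_hom s : star_hom (alphaK s).
Proof.
have [al am astar] := E0_hom alpha_E0 s; have [rl rm rs] := real_op_hom KE.
split=> [c k k'|k k'|k]; apply: real_inj.
- by rewrite alphaK_restr !rl al !alphaK_restr.
- by rewrite alphaK_restr !rm am !alphaK_restr.
- by rewrite alphaK_restr !rs astar alphaK_restr.
Qed.

Lemma alphaK_comp s t k : alphaK s (alphaK t k) = alphaK (s * t)%g k.
Proof.
by apply: real_inj; rewrite !alphaK_restr (E0_comp alpha_E0).
Qed.

(** The products alpha_s(k) x y^* = (alpha_s(k) x) y^* approximate x y^*, by
    E0_nondegenerate. *)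
Lemma alphaK_dense s :
  densely_spans [set k | exists k1 k2, k = alphaK s k1 ** k2].
Proof.
apply/densely_cspan; apply: (cspace_dense (ket_dense KE) (cspace_cspan _)).
move=> _ [x [y ->]].
apply: cspan_closed => e e0.
have [|w [Kw wx]] := E0_nondegenerate alpha_E0 KE s x (e := e / (nrm y + 1)) _.
  by rewrite divr_gt0 // ltr_wpDl // nrm_ge0.
have [k kw] := real_ex KE Kw; exists (alphaK s k ** ket KE x y).
  by apply: sub_cspan; exists k, (ket KE x y).
rewrite ket_mull alphaK_restr kw -ketBl.
apply: le_trans (nrm_ket _ _ _) _; rewrite nrmC; move: wx; rewrite ler_pdivlMr.
  by have := nrm_ge0 y; have := nrm_ge0 (alpha s w x - x); nra.
by rewrite ltr_wpDl // nrm_ge0.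
Qed.

Lemma inK_dense : densely_spans [set v | exists t k, v = inK t k].
Proof.
have := dsum_in_total FK; rewrite (_ : [set v | exists i x, v = _] =
  [set v | exists t k, v = inK t k]) //.
Qed.

(** By right cancellation t |-> t s is injective. The adjoint takes the copy of
    K at t s back to t, and vanishes on the copies at the elements outside P s. *)
Lemma translation_ex s : exists V : 'L(FK), Nb V 1 /\
  forall t k, V (inK t k) = inK (t * s)%g k.
Proof.
pose vec (p : P * KE) : FK := inK p.1 p.2.
have vd : densely_spans (range vec).
  rewrite (_ : range vec = [set v | exists t k, v = inK t k]); first exact: inK_dense.
  apply/seteqP; split=> [_ [[t k] _ <-]|_ [t [k ->]]]; first by exists t, k.
  by exists (t, k).
pose w (p : P * KE) : FK := inK (p.1 * s)%g p.2.
pose z (p : P * KE) : FK :=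
  if pselect (exists t, (t * s = p.1)%g) is left H then inK (projT1 (cid H)) p.2 else 0.
have [||V [V1 VE]] := @adj_extend _ _ FK _ _ vec w vec z 1 ler01 vd vd.
- move=> [t k] [t' k']; rewrite /w /vec /z /=; case: pselect => [H|nH].
    case: cid => t0 /= <-; have [tt|tt] := pselect (t = t0).
      by subst t0; rewrite !dsum_in_inner.
    by rewrite !dsum_in_orth // => /P_rcancel.
  rewrite hinner0r; apply: dsum_in_orth => tt; apply: nH.
  by exists t.
- apply: (gram_bound (w := w) (s := fun _ => 0 : FK) (v := vec) ler01).
  move=> [t k] [t' k']; rewrite /w /vec /= hinner0r addr0 mulr1 scale1r.
  have [tt|tt] := pselect (t = t'); first by subst t'; rewrite !dsum_in_inner.
  by rewrite !dsum_in_orth // => /P_rcancel.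
by exists V; split=> // t k; exact: (VE (t, k)).
Qed.

Lemma multiplication_ex k : exists Q : 'L(FK), Nb Q (nrm k) /\
  forall t y, Q (inK t y) = inK t (alphaK t k ** y).
Proof.
have h t : star_hom (fun k => lmul (alphaK t k)).
  have ah := alphaK_hom t; have [ll lm ls] := lmul_hom KE.
  split=> [c a b|a b|a].
  - by rewrite (star_homD ah) (star_homZ ah) ll.
  - by rewrite (star_homM ah) lm.
  - by rewrite (star_hom_star ah) ls.
by have [T [Tk TE]] := dsum_rep FK h k; exists T.
Qed.

Definition Vop s : 'L(FK) := projT1 (cid (translation_ex s)).
Definition Pi k : 'L(FK) := projT1 (cid (multiplication_ex k)).

Lemma VopE s t k : Vop s (inK t k) = inK (t * s)%g k.
Proof. by rewrite /Vop; case: cid => V [_ VE] /=. Qed.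
Lemma Nb_Vop s : Nb (Vop s) 1.
Proof. by rewrite /Vop; case: cid => V [V1 _] /=. Qed.
Lemma PiE k t y : Pi k (inK t y) = inK t (alphaK t k ** y).
Proof. by rewrite /Pi; case: cid => V [_ VE] /=. Qed.
Lemma Nb_Pi k : Nb (Pi k) (nrm k).
Proof. by rewrite /Pi; case: cid => V [V1 _] /=. Qed.

Lemma FK_op_eq (S T : 'L(FK)) :
  (forall t k, S (inK t k) = T (inK t k)) -> S = T.
Proof. by move=> ST; apply: (op_dense_eq inK_dense) => _ [t [k ->]]. Qed.

Lemma Pi_hom : star_hom Pi.
Proof.
split=> [c a b|a b|a].
- apply: FK_op_eq => t k; rewrite opD opZ !PiE -dsum_inP; congr (inK t _).
  by have [al _ _] := alphaK_hom t; rewrite al amulDl amulZl.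
- apply: FK_op_eq => t k; rewrite -[Pi a ** Pi b]/(Pi a * Pi b) opM !PiE.
  by rewrite (star_homM (alphaK_hom t)) amulA.
apply: adjointable_eq => x; apply: (dense_inner_eq inK_dense) => _ [t [k ->]].
rewrite -op_starP; move: x.
apply: (dense_eq inK_dense).
- apply: (blin_comp (f := Pi a^†)) (blin_inner _); apply: blin_op.
  by exists (nrm a^†); [exact: nrm_ge0|exact: Nb_Pi].
- exact: blin_inner.
move=> _ [t' [k' ->]]; rewrite !PiE.
have [tt|tt] := pselect (t = t'); last by rewrite !dsum_in_orth.
subst t'; rewrite !dsum_in_inner (star_hom_star (alphaK_hom t)).
by rewrite /hinner /= astarM amulA.
Qed.

(** The covariance relation of the crossed product. *)
Lemma Pi_Vop k s : Pi k * Vop s = Vop s * Pi (alphaK s k).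
Proof.
apply: FK_op_eq => t y; rewrite !opM VopE !PiE VopE; congr (inK _ _).
by rewrite alphaK_comp.
Qed.

Lemma Vop1 : Vop 1%g = 1.
Proof. by apply: FK_op_eq => t k; rewrite VopE op1 mulg1. Qed.

Context (KP : realization (crossed_product alphaK FK)).
Local Notation sigma := (@real_op _ _ _ _ KP).
Local Notation sigmah := (real_op_hom KP).

Lemma generator_in s k : crossed_product alphaK FK (Vop s * Pi k).
Proof.
move=> D Dc; apply; exists s, k, (Vop s), (Pi k); split=> //.
- by move=> t y; exact: VopE.
- by move=> t y; exact: PiE.
Qed.

(** The generator V_s pi(k) of the crossed product. *)
Definition vp s k : KP := projT1 (cid (real_ex KP (generator_in s k))).

Lemma vpE s k : sigma (vp s k) = Vop s * Pi k.
Proof. by rewrite /vp; case: cid. Qed.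

Lemma vp1E k : sigma (vp 1%g k) = Pi k.
Proof. by rewrite vpE Vop1 mul1r. Qed.

Lemma vp_mul s k k' : vp 1%g k ** vp s k' = vp s (alphaK s k ** k').
Proof.
apply: real_inj; rewrite (star_homM sigmah) vp1E !vpE (star_homM Pi_hom).
by rewrite -[Pi k ** _]/(Pi k * (Vop s * Pi k')) mulrA Pi_Vop -mulrA.
Qed.

Lemma blin_vp s : blin (vp s).
Proof.
split=> [c k k'|].
  apply: real_inj; rewrite (star_homD sigmah) (star_homZ sigmah) !vpE.
  by rewrite (star_homD Pi_hom) (star_homZ Pi_hom) mulrDr opZr.
exists 1 => // k; rewrite mul1r; apply: real_Nb; first exact: nrm_ge0.
rewrite vpE -[X in Nb _ X]mul1r; apply: NbM => //; [exact: Nb_Vop|exact: Nb_Pi].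
Qed.

(** By covariance pi(k1) V_s pi(k2) = V_s pi(alpha_s(k1) k2), and alpha_s is
    non-degenerate. *)
Lemma vp_dense s k :
  cspan [set d | exists k1 k2, d = vp 1%g k1 ** vp s k2] (vp s k).
Proof.
have /densely_cspan/(_ k) := alphaK_dense s; apply: cspan_blin; first exact: blin_vp.
move=> _ [k1 [k2 ->]]; apply: sub_cspan; exists k1, k2.
by rewrite vp_mul.
Qed.

Lemma crossed_ind (D : set 'L(FK)) : cstar_subalgebra D ->
  (forall s k, D (Vop s * Pi k)) -> forall d : KP, D (sigma d).
Proof.
move=> Dc Dg d; apply: (real_in d) => // _ [s [k [V [Q [HV HQ ->]]]]].
have -> : V = Vop s by apply: FK_op_eq => t y; rewrite HV VopE.
have -> : Q = Pi k by apply: FK_op_eq => t y; rewrite HQ PiE.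
exact: Dg.
Qed.

End CrossedProduct.

(** * The creation operators *)

Section Creation.
Context (R : realType) (Q : monoidType) (B : cstarAlgType R[i]).
Context (X : product_system B Q) (FX : direct_sum X).
Hypothesis Q_lcancel : forall s t u : Q, (s * t = s * u)%g -> t = u.
Local Notation inX := (fun t x => dsum_in FX (i := t) x).

Definition creation s (x : X s) (T : 'L(FX)) :=
  forall t (y : X t), T (inX t y) = inX (s * t)%g (ps_mul x y).

Lemma ps_mul_inner s t (x x' : X s) (y y' : X t) :
  << ps_mul x y | ps_mul x' y' >> = << y | ps_left X t << x | x' >> y' >>.
Proof. by have [H _] := ps_tensor X s t; exact: H. Qed.

Lemma ps_mulPl s t k (x x' : X s) (y : X t) :
  ps_mul (k *: x + x') y = k *: ps_mul x y + ps_mul x' y.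
Proof.
have [_ d] := ps_tensor X s t; have lh := ps_left_hom X t.
apply: (dense_inner_eq d) => _ [x'' [y'' ->]].
rewrite hinnerDr hinnerZr !ps_mul_inner hinnerDr hinnerZr (star_homD lh).
by rewrite (star_homZ lh) opD opZ hinnerDr hinnerZr.
Qed.

(** The square of a creation operator is the left action of [x, x]. *)
Lemma creation_gram s (x : X s) n (k : 'I_n -> R[i]) (i : 'I_n -> {t : Q & X t}) :
  nrm (\sum_(j < n) k j *: inX (s * projT1 (i j))%g (ps_mul x (projT2 (i j)))) <=
  nrm x * nrm (\sum_(j < n) k j *: inX (projT1 (i j)) (projT2 (i j))).
Proof.
have [L [Lb LE]] := dsum_rep FX (ps_left_hom X) << x | x >>.
set w := (X in nrm X <= _); set v := (X in _ <= _ * nrm X).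
have wv : << w | w >> = << v | L v >>.
  rewrite /w /v op_sum !hinner_suml; apply: eq_bigr => j _.
  rewrite !hinner_sumr; apply: eq_bigr => l _.
  rewrite op_scale LE !hinnerZl !hinnerZr; congr (_ *: (_ *: _)).
  case: (i j) (i l) => [t y] [t' y'] /=.
  have [tt|tt] := pselect (t = t').
    by subst t'; rewrite !dsum_in_inner ps_mul_inner.
  by rewrite !dsum_in_orth // => /Q_lcancel.
rewrite -(@ler_pXn2r _ 2) ?nnegrE ?mulr_ge0 ?nrm_ge0 // -nrm_inner wv.
apply: le_trans (hilbert_CS _ _) _; have := Lb v; rewrite nrm_inner.
have := nrm_ge0 v; nra.
Qed.

Lemma vecX_dense : densely_spans [set v | exists t (x : X t), v = inX t x].
Proof. exact: dsum_in_total. Qed.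

Lemma creation_bound s (x : X s) T : creation x T -> Nb T (nrm x).
Proof.
move=> Tx; apply: (Nb_dense (nrm_ge0 x) vecX_dense) => _ [n [k [v [Hv ->]]]].
have /choice[i Hi] j : exists p : {t : Q & X t}, v j = inX (projT1 p) (projT2 p).
  by have [t [y ->]] := Hv j; exists (existT _ t y).
have := creation_gram x k i.
have -> : \sum_(j < n) k j *: inX (s * projT1 (i j))%g (ps_mul x (projT2 (i j))) =
    \sum_(j < n) T (k j *: v j).
  by apply: eq_bigr => j _; rewrite op_scale Hi Tx.
have -> : \sum_(j < n) k j *: inX (projT1 (i j)) (projT2 (i j)) =
    \sum_(j < n) k j *: v j.
  by apply: eq_bigr => j _; rewrite Hi.
by rewrite op_sum.
Qed.

Lemma creationP s k (x x' : X s) T T' : creation x T -> creation x' T' ->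
  creation (k *: x + x') (k *: T + T').
Proof.
move=> Tx Tx' t y; rewrite opD opZ Tx Tx' -dsum_inP; congr (inX _ _).
by rewrite ps_mulPl.
Qed.

(** Additivity holds because creation_gram bounds the operator on every finite
    combination of vectors, in particular on those that vanish. *)
Lemma blin_creation s t (x : X s) : blin (fun y : X t => inX (s * t)%g (ps_mul x y)).
Proof.
split=> [k y y'|].
  apply/eqP; rewrite -subr_eq0; apply/eqP/nrm_le0.
  pose z (j : 'I_3) : X t := nth 0 [:: k *: y + y'; y; y'] j.
  pose c (j : 'I_3) : R[i] := nth 0 [:: 1; - k; -1] j.
  have := creation_gram x c (fun j => existT _ t (z j)).
  rewrite !big_ord_recr !big_ord0 /= /z /c /= !add0r !scale1r !scaleN1r !scaleNr.
  have -> : inX t (k *: y + y') - k *: inX t y - inX t y' = 0.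
    by rewrite dsum_inP; zmod.
  by rewrite nrm0 mulr0 opprD addrA.
exists (nrm x) => [|y]; first exact: nrm_ge0.
have := creation_gram x (fun _ : 'I_1 => 1) (fun=> existT _ t y).
rewrite !big_ord1 !scale1r /= => H; apply: le_trans H _.
apply: ler_wpM2l; first exact: nrm_ge0.
rewrite -(@ler_pXn2r _ 2) ?nnegrE ?nrm_ge0 // -!nrm_inner.
by rewrite dsum_in_inner.
Qed.

End Creation.

Section Tau.
Context (R : realType) (P : monoidType).
Hypothesis P_rcancel : forall s t u : P, (t * s = u * s)%g -> t = u.
Context (B : cstarAlgType R[i]) (E : hilbertModType B).
Context (alpha : P -> 'L(E) -> 'L(E)).
Hypothesis alpha_E0 : E0_semigroup alpha.
Context (KE : realization (compacts E)) (alphaK : P -> KE -> KE).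
Hypothesis alphaK_restr : forall s k, real_op (alphaK s k) = alpha s (real_op k).
Context (X : product_system B (opposite P)) (FX : direct_sum X).
Context (tau : forall s : opposite P, E -> E -> X s).
Hypothesis tau_tensor : forall s,
  is_interior_tensor (@rank_one _ B E) (alpha s) (tau s).
Hypothesis tau_mul : forall s t x y z u, ps_mul (tau s x y) (tau t z u) =
  tau (s * t)%g x (alpha t (rank_one y z) u).
Local Notation rho := (@real_op _ _ _ _ KE).
Local Notation rhoh := (real_op_hom KE).
Implicit Types (s t : P) (x y z u v : E) (k : KE).

(** The vector x^* (x) u of the fibre at t, in the direct sum of the fibres. *)
Definition tauX t x u : FX := dsum_in FX (tau t x u).

Lemma alpha_ket t x y : alpha t (rank_one x y) = rho (alphaK t (ket KE x y)).
Proof. by rewrite alphaK_restr ketE. Qed.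

Lemma tauX_inner t x u y v :
  << tauX t x u | tauX t y v >> = << u | rho (alphaK t (ket KE x y)) v >>.
Proof.
by rewrite /tauX dsum_in_inner; have [-> _] := tau_tensor t; rewrite alpha_ket.
Qed.

Lemma tauX_orth t t' x u y v : t <> t' -> << tauX t x u | tauX t' y v >> = 0.
Proof. by move=> tt; apply: dsum_in_orth. Qed.

Lemma tauX_dense : densely_spans [set v | exists t x u, v = tauX t x u].
Proof.
apply/densely_cspan; apply: (cspace_dense (dsum_in_total FX) (cspace_cspan _)).
move=> _ [t [x ->]].
have [_ /densely_cspan/(_ x)] := tau_tensor t.
apply: cspan_blin; first exact: blin_dsum.
by move=> _ [y [u ->]]; apply: sub_cspan; exists t, y, u.
Qed.

Lemma blin_tauX t x : blin (tauX t x).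
Proof.
split=> [c u v|].
  apply: (dense_inner_eq tauX_dense) => _ [t' [y [w ->]]].
  rewrite hinnerDr hinnerZr; have [tt|tt] := pselect (t' = t).
    by subst t'; rewrite !tauX_inner op_add op_scale hinnerDr hinnerZr.
  by rewrite !tauX_orth // scaler0 addr0.
pose C := nrm (alphaK t (ket KE x x)).
have C0 : 0 <= C by exact: nrm_ge0.
exists (Num.sqrt C) => [|u]; first exact: sqrtr_ge0.
rewrite -(@ler_pXn2r _ 2) ?nnegrE ?mulr_ge0 ?sqrtr_ge0 ?nrm_ge0 //.
rewrite exprMn sqr_sqrtr // -nrm_inner tauX_inner.
apply: le_trans (hilbert_CS _ _) _.
have := Nb_real (alphaK t (ket KE x x)) u; rewrite -/C; have := nrm_ge0 u; nra.
Qed.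

(** The creation operator by the vector x^* (x) y of the fibre at s; its adjoint
    takes z^* (x) u at t s to the vector y^* (x) alpha_(ts) (x z^* ) u at t. *)
Lemma creation_ex s x y : exists T : 'L(FX), creation (tau s x y) T.
Proof.
have opcancel (a b c : opposite P) : (a * b = a * c)%g -> b = c.
  exact: P_rcancel.
pose vec (p : P * E * E) : FX := tauX p.1.1 p.1.2 p.2.
have vd : densely_spans (range vec).
  rewrite (_ : range vec = [set v | exists t x u, v = tauX t x u]).
    exact: tauX_dense.
  apply/seteqP; split=> [_ [[[t z] u] _ <-]|_ [t [z [u ->]]]]; first by exists t, z, u.
  by exists (t, z, u).
pose w (p : P * E * E) : FX := tauX (p.1.1 * s)%g x (alpha p.1.1 (rank_one y p.1.2) p.2).
pose z (p : P * E * E) : FX :=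
  if pselect (exists t, (t * s = p.1.1)%g) is left H
  then tauX (projT1 (cid H)) y (alpha p.1.1 (rank_one x p.1.2) p.2) else 0.
have star t a b : (alpha t (rank_one a b))^† = alpha t (rank_one b a).
  by have [_ _ <-] := E0_hom alpha_E0 t; rewrite rank_one_star.
have [||T [Tb TE]] := @adj_extend _ _ FX _ _ vec w vec z _ (nrm_ge0 (tau s x y)) vd vd.
- move=> [[t a] u] [[r b] v]; rewrite /w /vec /z /=; case: pselect => [H|nH].
    case: cid => t0 /= <-; have [tt|tt] := pselect (t = t0).
      by subst t0; rewrite !tauX_inner -!alpha_ket op_starP star.
    by rewrite !tauX_orth // => /P_rcancel.
  by rewrite hinner0r tauX_orth // => tt; apply: nH; exists t.
- move=> n k i; have := creation_gram FX opcancel (tau s x y) k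
    (fun j => existT (fun t : opposite P => X t) (i j).1.1
      (tau (i j).1.1 (i j).1.2 (i j).2)).
  rewrite (eq_bigr (fun j => k j *: w (i j))) // => j _ /=.
  by rewrite tau_mul.
exists T => t v; have [_ d] := tau_tensor t; move: v.
apply: (dense_eq d (f := T \o dsum_in FX (i := t))) => [||_ [a [u ->]] /=].
- apply: blin_comp (blin_dsum FX t) (blin_op _).
  by exists (nrm (tau s x y)); [exact: nrm_ge0|exact: Tb].
- exact: blin_creation.
- by have := TE (t, a, u); rewrite /vec /w /tauX /= tau_mul.
Qed.

End Tau.

(** * The operators from H to the direct sum of the fibres *)

Section Equivalence.
Context (R : realType) (P : monoidType).
Hypothesis P_rcancel : forall s t u : P, (t * s = u * s)%g -> t = u.
Context (B : cstarAlgType R[i]) (E : hilbertModType B).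
Context (alpha : P -> 'L(E) -> 'L(E)).
Hypothesis alpha_E0 : E0_semigroup alpha.
Context (KE : realization (compacts E)) (alphaK : P -> KE -> KE).
Hypothesis alphaK_restr : forall s k, real_op (alphaK s k) = alpha s (real_op k).
Context (FK : direct_sum (fun _ : P => regular_module KE : hilbertModType KE)).
Context (KP : realization (crossed_product alphaK FK)).
Context (X : product_system B (opposite P)) (FX : direct_sum X).
Context (tau : forall s : opposite P, E -> E -> X s).
Hypothesis tau_tensor : forall s,
  is_interior_tensor (@rank_one _ B E) (alpha s) (tau s).
Hypothesis tau_mul : forall s t x y z u, ps_mul (tau s x y) (tau t z u) =
  tau (s * t)%g x (alpha t (rank_one y z) u).
Context (CX : realization (reduced_algebra FX)).
Local Notation rho := (@real_op _ _ _ _ KE).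
Local Notation rhoh := (real_op_hom KE).
Local Notation sigma := (@real_op _ _ _ _ KP).
Local Notation sigmah := (real_op_hom KP).
Local Notation kappa := (@real_op _ _ _ _ CX).
Local Notation kappah := (real_op_hom CX).
Local Notation inK := (fun t k => dsum_in FK (i := t) (k : regular_module KE)).
Local Notation ket := (@ket _ _ _ KE).
Local Notation Vop := (Vop P_rcancel FK).
Local Notation Pi := (Pi alpha_E0 alphaK_restr FK).
Local Notation vp := (vp P_rcancel alpha_E0 alphaK_restr KP).
Local Notation tauX := (tauX FX tau).
Local Notation tauX_dense := (tauX_dense FX tau_tensor).
Local Notation tauX_inner := (tauX_inner alphaK_restr FX tau_tensor).
Local Notation blin_tauX := (blin_tauX alphaK_restr FX tau_tensor).
Local Notation MK := (regular_module KE : hilbertModType KE).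
Implicit Types (s t : P) (x y z u : E) (k : KE) (xi eta : FK) (d : KP) (c : CX).

(** The creation operator of the vector x^* (x) y of the fibre at s. *)
Definition phi s x y : 'L(FX) :=
  projT1 (cid (creation_ex P_rcancel alpha_E0 alphaK_restr FX tau_tensor tau_mul s x y)).

Lemma phi_creation s x y : creation (tau s x y) (phi s x y).
Proof. by rewrite /phi; case: cid. Qed.

Lemma phi_tauX s x y t z u :
  phi s x y (tauX t z u) = tauX (t * s)%g x (alpha t (rank_one y z) u).
Proof. by rewrite /tauX phi_creation tau_mul. Qed.

Lemma phi_in s x y : reduced_algebra FX (phi s x y).
Proof. by move=> D _; apply; exists s, (tau s x y); exact: phi_creation. Qed.

(** The operator phi s x y as an element of the reduced algebra. *)
Definition cr s x y : CX := projT1 (cid (real_ex CX (phi_in s x y))).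

Lemma crE s x y : kappa (cr s x y) = phi s x y.
Proof. by rewrite /cr; case: cid. Qed.

Let opcancel (a b c : opposite P) : (a * b = a * c)%g -> b = c.
Proof. exact: P_rcancel. Qed.

(** The vectors x^* (x) y are total in the fibre at s, so that every creation
    operator is a norm limit of combinations of the operators phi. *)
Lemma reduced_ind (D : set 'L(FX)) : cstar_subalgebra D ->
  (forall s x y, D (phi s x y)) -> forall c, D (kappa c).
Proof.
move=> Dc Dphi c; have [Dlin _ _ Dcl] := Dc.
apply: (real_in c) => // T [s [x Tx]]; apply: Dcl; apply/opnorm_closureP => e e0.
have [_ /densely_spansP/(_ x e e0)[x' Sx' xx']] := tau_tensor s.
have [T' [DT' Tx'']] : exists T', D T' /\ creation x' T'.
  have sub : lspan [set z | exists y u, z = tau s y u] `<=`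
      [set x' | exists T', D T' /\ creation x' T']; last exact: sub.
    apply: lspan_ind => /=.
    - exists 0; split=> [|t y]; first exact: lspan_0.
      have -> : ps_mul (0 : X s) y = 0.
        by have := ps_mulPl (-1) (0 : X s) 0 y; rewrite scaler0 addr0 scaleN1r addNr.
      by rewrite op0 (blin_0 (blin_dsum FX _)).
    - move=> k y y' [U [DU Uy]] [U' [DU' Uy']]; exists (k *: U + U'); split.
        exact: lspan_lin.
      exact: creationP.
    - by move=> _ [y [z ->]]; exists (phi s y z); split=> //; exact: phi_creation.
exists T' => //; have := creationP (-1) Tx'' Tx.
rewrite !scaleN1r ![- _ + _]addrC => H; apply: Nbw xx' _.
exact: (creation_bound opcancel H).
Qed.

Lemma blin_form u v : blin (fun k => << u | rho k v >>).
Proof. exact: blin_comp (blin_real KE v) (blin_inner u). Qed.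

Lemma blin_sum (V W : normedModType R[i]) (f : V -> W) n (F : 'I_n -> V) :
  blin f -> f (\sum_(j < n) F j) = \sum_(j < n) f (F j).
Proof. by move=> fb; apply: (big_morph f (blin_add fb) (blin_0 fb)). Qed.

Lemma form_star (T : 'L(FK)) xi u eta v :
  << u | rho << xi | T eta >> v >>^† = << v | rho << eta | T^† xi >> u >>.
Proof.
by rewrite hinner_star op_starP -(star_hom_star rhoh) hinner_star op_starP.
Qed.

Lemma tauX_gram t k t' k' x y u v :
  << tauX t x (rho k u) | tauX t' y (rho k' v) >> =
  << u | rho << inK t k | Pi (ket x y) (inK t' k') >> v >>.
Proof.
rewrite PiE; have [tt|tt] := pselect (t = t'); last first.
  by rewrite tauX_orth // dsum_in_orth // (star_hom0 rhoh) op0 hinner0r.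
subst t'; rewrite tauX_inner dsum_in_inner op_starP -(star_hom_star rhoh).
have -> : @hinner _ _ MK k (alphaK t (ket x y) ** k') =
  k^† ** (alphaK t (ket x y) ** k') by [].
by rewrite !(star_homM rhoh).
Qed.

(** The images of the vectors inK t k are prescribed. By tauX_gram their Gram
    matrix is that of the operator pi(x x^* ), of norm at most the square of the
    norm of x, which bounds the map. *)
Lemma Theta_ex x u : exists T : FK -> FX,
  [/\ forall (a : R[i]) xi eta, T (a *: xi + eta) = a *: T xi + T eta,
    forall xi, nrm (T xi) <= nrm x * nrm u * nrm xi &
    forall t k, T (inK t k) = tauX t x (rho k u)].
Proof.
have C0 : 0 <= nrm x * nrm u by rewrite mulr_ge0 // nrm_ge0.
pose v (p : P * KE) : FK := inK p.1 p.2.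
pose w (p : P * KE) : FX := tauX p.1 x (rho p.2 u).
have vd : densely_spans (range v).
  rewrite (_ : range v = [set v | exists t k, v = inK t k]); first exact: inK_dense.
  apply/seteqP; split=> [_ [[t k] _ <-]|_ [t [k ->]]]; first by exists t, k.
  by exists (t, k).
have [|T [Tl Tb TE]] := extend_bounded (v := v) (w := w) C0 vd.
  move=> n k i; set W := (X in nrm X <= _); set V := (X in _ <= _ * nrm X).
  have WV : << W | W >> = << u | rho << V | Pi (ket x x) V >> u >>.
    rewrite /W /V op_sum !hinner_suml (blin_sum _ (blin_form u u)).
    apply: eq_bigr => j _; rewrite !hinner_sumr (blin_sum _ (blin_form u u)).
    apply: eq_bigr => l _.
    rewrite op_scale !hinnerZl !hinnerZr !(blin_scale (blin_form u u)).
    by rewrite tauX_gram.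
  rewrite -(@ler_pXn2r _ 2) ?nnegrE ?mulr_ge0 ?nrm_ge0 // -nrm_inner WV.
  apply: le_trans (hilbert_CS _ _) _.
  have H1 := Nb_real << V | Pi (ket x x) V >> u.
  have H2 := hilbert_CS V (Pi (ket x x) V).
  have H3 := Nb_Pi alpha_E0 alphaK_restr (ket x x) V.
  have H4 := nrm_ket KE x x.
  have u0 := nrm_ge0 u; have x0 := nrm_ge0 x; have V0 := nrm_ge0 V.
  have H5 : nrm << V | Pi (ket x x) V >> <= nrm V * (nrm x * nrm x * nrm V).
    apply: le_trans H2 _; apply: ler_wpM2l => //; apply: le_trans H3 _.
    exact: ler_wpM2r.
  apply: le_trans (ler_wpM2l u0 (le_trans H1 (ler_wpM2r u0 H5))) _.
  by rewrite le_eqVlt; apply/orP; left; apply/eqP; ring.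
by exists T; split=> // t k; exact: (TE (t, k)).
Qed.

(** The operator v |-> x^* (x) v from the module H to the direct sum of the
    fibres, on the elementary tensors xi (x) u of H. *)
Definition Theta x xi u : FX := projT1 (cid (Theta_ex x u)) xi.

Lemma ThetaE x t k u : Theta x (inK t k) u = tauX t x (rho k u).
Proof. by rewrite /Theta; case: cid => T [/= _ _ ->]. Qed.

Lemma blin_Theta x u : blin (fun xi => Theta x xi u).
Proof.
rewrite /Theta; case: cid => T [/= Tl Tb _]; split=> //.
by exists (nrm x * nrm u) => //; rewrite mulr_ge0 // nrm_ge0.
Qed.

Lemma blin_form_xi (T : 'L(FK)) xi u v : bd T ->
  blin (fun eta => << u | rho << xi | T eta >> v >>).
Proof.
move=> Tb; apply: (blin_comp (f := fun eta => << xi | T eta >>)) (blin_form u v).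
exact: blin_comp (blin_op Tb) (blin_inner xi).
Qed.

(** This is the relation Theta_x^* Theta_y = pi(x y^* ). *)
Lemma Theta_gram x y xi u eta v :
  << Theta x xi u | Theta y eta v >> =
  << u | rho << xi | Pi (ket x y) eta >> v >>.
Proof.
have Pb a : bd (Pi a) by exists (nrm a); [exact: nrm_ge0|exact: Nb_Pi].
have H a b t k w w' eta' : << Theta a (inK t k) w | Theta b eta' w' >> =
    << w | rho << inK t k | Pi (ket a b) eta' >> w' >>.
  move: eta'; apply: (dense_eq (inK_dense FK)).
  - exact: blin_comp (blin_Theta b w') (blin_inner _).
  - exact: blin_form_xi.
  - by move=> _ [t' [k' ->]]; rewrite !ThetaE tauX_gram.
rewrite -[LHS]hinner_star -[RHS]astarK form_star; congr (_^†).
rewrite -(star_hom_star (Pi_hom _ _ FK)) ket_star.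
move: xi; apply: (dense_eq (inK_dense FK)).
- exact: blin_comp (blin_Theta x u) (blin_inner _).
- exact: blin_form_xi.
move=> _ [t [k ->]]; rewrite -[LHS]hinner_star H form_star.
by rewrite -(star_hom_star (Pi_hom _ _ FK)) ket_star.
Qed.

(** * The bimodule *)

Local Notation W := ((FK * E)%type -> FX).

Lemma vec_eq (a b : KP) : (forall xi u eta v,
  << u | rho << xi | sigma a eta >> v >> = << u | rho << xi | sigma b eta >> v >>) ->
  a = b.
Proof.
move=> ab; apply: real_inj; apply: adjointable_eq => eta.
apply: hinner_inj => xi; apply: real_inj; apply: adjointable_eq => v.
by apply: hinner_inj => u; exact: ab.
Qed.

(** The negative part w of a would give vectors xi with
    [xi, a xi] = - [w eta, w eta]. *)
Lemma vec_positive (a : KP) : a^† = a ->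
  (forall xi u, cpositive << u | rho << xi | sigma a xi >> u >>) -> cpositive a.
Proof.
move=> asa ap; have [n [v [w [nsa vsa wsa naw wv]]]] := alg_negative_part asa.
suff w0 : w = 0 by exists v; rewrite vsa; exact: wv.
apply: real_inj; rewrite (star_hom0 sigmah); apply: adjointable_eq => eta.
rewrite op0; apply: hinner_eq0.
have : << sigma n eta | sigma a (sigma n eta) >> = - << sigma w eta | sigma w eta >>.
  rewrite !op_starP -!(star_hom_star sigmah) nsa wsa -!opM -hinnerNr -opN.
  congr << _ | _ >>; congr (adj_fun _ eta).
  rewrite -[LHS]/(sigma n ** sigma a ** sigma n) -!(star_homM sigmah) naw.
  by rewrite (star_homN sigmah) (star_homM sigmah).
have := ap (sigma n eta) => {}ap H; rewrite H in ap.
have [c wc] : cpositive << sigma w eta | sigma w eta >> by exact: hinner_ge0.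
suff c0 : c = 0 by rewrite wc c0 amul0.
apply: real_inj; rewrite (star_hom0 rhoh); apply: adjointable_eq => u.
rewrite op0; apply: hinner_eq0; apply: cpos_oppK; first exact: hinner_ge0.
have -> : - << rho c u | rho c u >> =
    << u | rho (- << sigma w eta | sigma w eta >>) u >>; last exact: ap.
rewrite wc (star_homN rhoh) opN hinnerNr (star_homM rhoh) op_starP.
by rewrite -(star_hom_star rhoh).
Qed.

(** The inner product a of w and v, viewed as operators from H to the direct sum
    of the fibres, given by the operator w^* v of H. *)
Definition ggram (w v : W) (a : KP) := forall xi u eta v',
  << w (xi, u) | v (eta, v') >> = << u | rho << xi | sigma a eta >> v' >>.

(** The operator a (x) 1 of H on elementary tensors. *)
Definition gshift (a : KP) (p : FK * E) : FK * E := (sigma a p.1, p.2).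
Definition th x : W := fun p => Theta x p.1 p.2.
Definition gdom : set W := lspan [set w | exists x d, w = th x \o gshift d].

Fact ggram_lin w v v' a a' (k : R[i]) : ggram w v a -> ggram w v' a' ->
  ggram w (k *: v + v') (k *: a + a').
Proof.
move=> H H' xi u eta u'; rewrite -[(k *: v + v') _]/(k *: v _ + v' _).
rewrite hinnerDr hinnerZr H H' (star_homD sigmah) (star_homZ sigmah) opD opZ.
rewrite (hinnerDr xi) (hinnerZr _ xi) (star_homD rhoh) (star_homZ rhoh) opD opZ.
by rewrite hinnerDr hinnerZr.
Qed.

Fact ggram_star w v a : ggram w v a -> ggram v w a^†.
Proof.
move=> H xi u eta u'.
by rewrite -[LHS]hinner_star H form_star -(star_hom_star sigmah).
Qed.

Fact ggram_fun w v a b : ggram w v a -> ggram w v b -> a = b.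
Proof. by move=> H H'; apply: vec_eq => xi u eta u'; rewrite -H -H'. Qed.

Fact ggram_pos w a : ggram w w a -> cpositive a.
Proof.
move=> H; apply: vec_positive; first exact: ggram_fun (ggram_star H) H.
by move=> xi u; rewrite -H; exact: hinner_ge0.
Qed.

Fact ggram_eval w a p : ggram w w a ->
  nrm (w p) ^+ 2 <= (nrm p.1 ^+ 2 * nrm p.2 ^+ 2) * nrm a.
Proof.
case: p => xi u H; rewrite -nrm_inner H /=.
apply: le_trans (hilbert_CS _ _) _.
have H1 := Nb_real << xi | sigma a xi >> u.
have H2 := hilbert_CS xi (sigma a xi).
have H3 := Nb_real a xi.
have u0 := nrm_ge0 u; have x0 := nrm_ge0 xi; have a0 := nrm_ge0 a.
have H5 := le_trans H2 (ler_wpM2l x0 H3).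
apply: le_trans (ler_wpM2l u0 (le_trans H1 (ler_wpM2r u0 H5))) _.
by rewrite le_eqVlt; apply/orP; left; apply/eqP; ring.
Qed.

Fact ggram_act w v a b : ggram w v a -> ggram w (v \o gshift b) (a ** b).
Proof.
by move=> H xi u eta u'; rewrite /gshift /= H /= (star_homM sigmah) -opM.
Qed.

Fact blin_ggram xi u eta v :
  blin (fun a : KP => << u | rho << xi | sigma a eta >> v >>).
Proof.
apply: (blin_comp (f := fun a : KP => << xi | sigma a eta >>)) (blin_form u v).
exact: blin_comp (blin_real KP eta) (blin_inner xi).
Qed.

Fact ggram_lim (w v : nat -> W) (a : nat -> KP) w0 v0 a0 :
  (forall n, ggram (w n) (v n) (a n)) ->
  (forall p, tends (fun n => w n p) (w0 p)) ->
  (forall p, tends (fun n => v n p) (v0 p)) -> tends a a0 -> ggram w0 v0 a0.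
Proof.
move=> H ww vv aa xi u eta u'.
apply: tends_unique (tends_inner (ww (xi, u)) (vv (eta, u'))) _.
apply: eq_tends (blin_tends (blin_ggram xi u eta u') aa) => n.
by rewrite /= H.
Qed.

Lemma th_gram x y d d' :
  ggram (th x \o gshift d) (th y \o gshift d') (d^† ** vp 1%g (ket x y) ** d').
Proof.
move=> xi u eta v; rewrite /th /gshift /= Theta_gram !(star_homM sigmah) vp1E.
by rewrite (star_hom_star sigmah) op_starP.
Qed.

Fact gdom0 : gdom 0. Proof. exact: lspan_0 (@lspan_idem _ _ _). Qed.
Fact gdomP (k : R[i]) w v : gdom w -> gdom v -> gdom (k *: w + v).
Proof. exact: lspan_lin (@lspan_idem _ _ _) _ _ _. Qed.

Fact ggram0 w : ggram w 0 0.
Proof.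
move=> xi u eta v; rewrite (star_hom0 sigmah) op0 hinner0r (hinner0r xi).
by rewrite (star_hom0 rhoh) op0 hinner0r.
Qed.

Fact gdom_gram w v : gdom w -> gdom v -> exists a, ggram w v a.
Proof.
move=> + gv; move: w; apply: lspan_ind => [|k w w' [a H] [a' H']|_ [x [d ->]]].
- by exists 0^†; apply: ggram_star; exact: ggram0.
- exists (k *: a^† + a'^†)^†; apply: ggram_star.
  by apply: ggram_lin; exact: ggram_star.
move: v gv; apply: lspan_ind => [|k w w' [a H] [a' H']|_ [y [d' ->]]].
- by exists 0; exact: ggram0.
- by exists (k *: a + a'); exact: ggram_lin.
by eexists; exact: th_gram.
Qed.

Fact gdom_act w a : gdom w -> gdom (w \o gshift a).
Proof.
move: w; apply: lspan_ind => [|k w w' H H'|_ [x [d ->]]]; first exact: gdom0.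
  exact: gdomP H H'.
apply: sub_lspan; exists x, (d ** a); apply/funext => p.
by rewrite /gshift /= (star_homM sigmah).
Qed.

Definition gspace : gram_space KP (FK * E)%type FX := GramSpace ggram_fun
  ggram_lin ggram_star ggram_pos ggram_eval ggram_act ggram_lim gdom0 gdomP
  gdom_gram gdom_act.

Local Notation GS := gspace.
Local Notation M := (gram_module GS).
Local Notation gclosure := (gclosure GS).
Local Notation gcl := (gclosure_closed GS).
Local Notation vp1E := (vp1E P_rcancel alpha_E0 alphaK_restr KP).
Local Notation vpE := (vpE P_rcancel alpha_E0 alphaK_restr KP).
Local Notation vp_mul := (vp_mul P_rcancel alpha_E0 alphaK_restr KP).
Local Notation blin_vp := (blin_vp P_rcancel alpha_E0 alphaK_restr KP).
Local Notation vp_dense := (vp_dense P_rcancel alpha_E0 alphaK_restr KP).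
Implicit Types (w : W) (m n p : M).

Lemma Theta_dense : densely_spans [set v | exists x xi u, v = Theta x xi u].
Proof.
apply/densely_cspan; apply: (cspace_dense tauX_dense (cspace_cspan _)).
move=> _ [t [x [u ->]]].
apply: cspan_closed => e e0; have [_ [C C0 HC]] := blin_tauX t x.
have [|k Hk] := KE_approx KE u (e := e / (C + 1)) _; first by rewrite divr_gt0 //; lra.
exists (Theta x (inK t k) u); first by apply: sub_cspan; exists x, (inK t k), u.
rewrite ThetaE nrmC -(blin_sub (blin_tauX t x)); apply: le_trans (HC _) _.
move: Hk; rewrite ler_pdivlMr; last lra.
have := nrm_ge0 (rho k u - u); nra.
Qed.

Lemma Theta_eq (v v' : FX) :
  (forall x xi u, << Theta x xi u | v >> = << Theta x xi u | v' >>) -> v = v'.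
Proof.
by move=> H; apply: (dense_inner_eq Theta_dense) => _ [x [xi [u ->]]].
Qed.

Lemma th_gram1 x y : ggram (th x) (th y) (vp 1%g (ket x y)).
Proof. by move=> xi u eta v; rewrite /th /= Theta_gram vp1E. Qed.

Lemma thB x y : th (x - y) = th x - th y.
Proof.
apply/funext => -[xi u]; rewrite -[(th x - th y) _]/(th x _ - th y _) /th /=.
apply: Theta_eq => z eta v; rewrite hinnerBr !Theta_gram ketBr.
rewrite (star_homB (Pi_hom _ _ FK)) opB (hinnerBr _ (Pi _ xi)).
by rewrite (star_homB rhoh) opB hinnerBr.
Qed.

Lemma th_shift x k : th x \o gshift (vp 1%g k) = th (rho k^† x).
Proof.
apply/funext => -[xi u]; rewrite /th /gshift /= vp1E.
apply: Theta_eq => z eta v; rewrite !Theta_gram -opM -[Pi _ * Pi _]/(Pi _ ** Pi _).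
by rewrite -(star_homM (Pi_hom _ _ FK)) ket_mulr.
Qed.

Lemma nrm_gip_th x : gn GS (th x) <= nrm x.
Proof.
rewrite -(@ler_pXn2r _ 2) ?nnegrE ?gn_ge0 ?nrm_ge0 // gn_sq.
rewrite (gipE (S := GS) (@th_gram1 x x)).
have H := Nb_Pi alpha_E0 alphaK_restr (ket x x) : Nb (Pi _) _.
apply: (@le_trans _ _ (nrm (ket x x))); last by rewrite expr2; exact: nrm_ket.
by apply: real_Nb; [exact: nrm_ge0|rewrite vp1E].
Qed.

(** Theta_x is the limit of Theta_(k x) = Theta_x pi(k^* ), where k runs through
    an approximate unit. *)
Lemma th_in x : gclosure (th x).
Proof.
have /choice[k Hk] i : exists k, nrm (rho k^† x - x) <= i.+1%:R^-1.
  have [|k Hk] := KE_approx KE x (e := i.+1%:R^-1) _; first by rewrite invr_gt0.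
  by exists k^†; rewrite astarK.
have near e : 0 < e -> exists N, forall i, (N <= i)%N -> nrm (rho (k i)^† x - x) <= e.
  move=> e0; have [N HN] := archi_seq e0; exists N => i Ni.
  exact: le_trans (Hk i) (HN i Ni).
exists (fun i => th (rho (k i)^† x)); split.
- by move=> i; rewrite -th_shift; apply: sub_lspan; exists x, (vp 1%g (k i)).
- move=> e e0; have [|N HN] := near (e / 2); first lra.
  exists N => i j Ni Nj; rewrite -thB; apply: le_trans (nrm_gip_th _) _.
  have := nrm_trans x (rho (k i)^† x) (rho (k j)^† x).
  have := HN i Ni; have := HN j Nj; rewrite (nrmC x); lra.
move=> q e e0.
have [|N HN] := near (e / gconst GS q); first by rewrite divr_gt0 // gconst_gt0.
exists N => i /HN; rewrite ler_pdivlMr ?gconst_gt0 // mulrC; apply: le_trans.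
rewrite -[th _ q - th _ q]/((th _ - th _) q) -thB; set y := _ - _.
apply: le_trans (gram_eval (S := GS) q (@th_gram1 y y)) _.
by apply: ler_wpM2l (nrm_gip_th y); apply/ltW/gconst_gt0.
Qed.

(** The operator v |-> x^* (x) v, as a vector of the bimodule. *)
Definition Th x : M := gmk (th_in x).

Lemma Th_inner x y : << Th x | Th y >> = vp 1%g (ket x y).
Proof. by apply: (@gmod_innerE _ _ _ _ GS); exact: th_gram1. Qed.

Lemma Th_dense m : cspan [set m | exists x d, m = Th x <* d] m.
Proof.
apply: cspan_closed => e e0; have [n Vn mn] := gram_module_dense m e0.
exists n => //; move: mn => _.
suff [n' [nn' Sn']] : exists n' : M, gfun n' = gfun n /\
    cspan [set m : M | exists x d, m = Th x <* d] n'.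
  by have -> : n = n' by exact/esym/gmod_eq.
move: (gfun n) Vn; apply: lspan_ind => [|a w w' [l [<- Sl]] [l' [<- Sl']]|_ [x [d ->]]].
- by exists 0; split=> //; exact: cspan0.
- exists (a *: l + l'); split; last exact: cspanP.
  exact: erefl.
- by exists (Th x <* d); split=> //; apply: sub_cspan; exists x, d.
Qed.

(** * The left action *)

Lemma vp_mulr s k k' : vp s k ** vp 1%g k' = vp s (k ** k').
Proof.
apply: real_inj; rewrite (star_homM sigmah) vp1E !vpE (star_homM (Pi_hom _ _ FK)).
exact/esym/(mulrA (Vop s) (Pi k) (Pi k')).
Qed.

Lemma vp1_star k : (vp 1%g k)^† = vp 1%g k^†.
Proof.
apply: real_inj; rewrite (star_hom_star sigmah) !vp1E.
by rewrite (star_hom_star (Pi_hom _ _ FK)).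
Qed.

(** This is the relation phi(x^* (x) y) Theta_z = Theta_x V_s pi(y z^* ). *)
Lemma phi_Theta s x y z xi u :
  phi s x y (Theta z xi u) = Theta x (sigma (vp s (ket y z)) xi) u.
Proof.
have bphi : bd (phi s x y) by rewrite -crE; exact: bd_real.
move: xi; apply: (dense_eq (inK_dense FK)).
- exact: blin_comp (blin_Theta z u) (blin_op bphi).
- exact: blin_comp (blin_op (bd_real _)) (blin_Theta x u).
move=> _ [t [k ->]]; rewrite ThetaE phi_tauX vpE opM PiE VopE ThetaE.
by rewrite (alpha_ket alphaK_restr) (star_homM rhoh).
Qed.

(** The relation phi(x^* (x) y)^* Theta_z = Theta_y (V_s pi(alpha_s(z x^* )))^*
    follows from phi_Theta and covariance. *)
Lemma phi_star_Theta s x y z xi u : (phi s x y)^† (Theta z xi u) =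
  Theta y (sigma (vp s (alphaK s (ket z x)))^† xi) u.
Proof.
apply: Theta_eq => a eta v; rewrite -op_starP phi_Theta !Theta_gram.
congr << v | rho _ u >>; rewrite op_starP -!vp1E -!opM; congr << eta | _ >>.
congr (adj_fun _ xi).
rewrite -(star_hom_star sigmah) -[LHS]/(sigma _ ** sigma _) -[RHS]/(sigma _ ** sigma _).
rewrite -!(star_homM sigmah); congr sigma; apply: (can_inj (@astarK _ _)).
by rewrite !astarM !astarK !vp1_star !ket_star vp_mul vp_mulr.
Qed.

(** With S^† S = r ^+ 2 - T^† T as in op_defect, the inner product of S w with
    itself is that of w times r ^+ 2, minus that of T w. *)
Lemma gn_op (T : 'L(FX)) (r : R) w : 0 <= r -> Nb T r -> gclosure w ->
  gclosure (T \o w) -> gn GS (T \o w) <= r * gn GS w.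
Proof.
move=> r0 Tr Cw CTw; have [S HS] := op_defect r0 Tr.
rewrite -(@ler_pXn2r _ 2) ?nnegrE ?gn_ge0 ?mulr_ge0 ?gn_ge0 //.
rewrite exprMn !gn_sq; set a := gip _ w w; set b := gip _ _ _.
have ga : ggram w w a by exact: (gcl_gram gcl).
have gb : ggram (T \o w) (T \o w) b by exact: (gcl_gram gcl).
rewrite expr2 -nrmZr ?mulr_ge0 //; apply: cpos_mono.
  exact: (ggram_pos gb).
apply: (ggram_pos (w := S \o w)) => xi u eta v /=.
have := HS (w (xi, u)) (w (eta, v)); rewrite ga (gb xi u eta v) => H.
rewrite (star_homB sigmah) (star_homZ sigmah) opB opZ (hinnerBr xi).
rewrite (hinnerZr _ xi) (star_homB rhoh) (star_homZ rhoh) opB opZ hinnerBr hinnerZr.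
by rewrite -H addrC addKr.
Qed.

Lemma op_closure_lim (T : 'L(FX)) :
  (forall e : R, 0 < e ->
    exists2 S : 'L(FX), (forall w, gclosure w -> gclosure (S \o w)) &
    Nb (T - S) e) ->
  forall w, gclosure w -> gclosure (T \o w).
Proof.
move=> HT w Cw; have /choice[S HS] i : exists S : 'L(FX),
    (forall w, gclosure w -> gclosure (S \o w)) /\ Nb (T - S) i.+1%:R^-1.
  have [|S CS TS] := HT i.+1%:R^-1; first by rewrite invr_gt0.
  by exists S.
have SN e : 0 < e -> exists N, forall i, (N <= i)%N -> Nb (T - S i) e.
  move=> e0; have [N HN] := archi_seq e0; exists N => i Ni.
  exact: Nbw (HN i Ni) (HS i).2.
have CSw i : gclosure (S i \o w) by exact: (HS i).1.
apply: (@gclosure_ptends _ _ _ _ GS (fun i => S i \o w)) => // [e e0|q e e0].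
  have w0 := gn_ge0 GS w; pose r := e / (2 * (gn GS w + 1)).
  have r0 : 0 < r by rewrite divr_gt0 //; lra.
  have re : r * (2 * (gn GS w + 1)) = e by rewrite mulfVK //; lra.
  have [N HN] := SN r r0; exists N => i j Ni Nj.
  have -> : (S i \o w) - (S j \o w) = (S i - S j) \o w.
    by apply/funext => q; exact/esym/opB.
  have Nbij : Nb (S i - S j) (r + r).
    rewrite -[S i - S j](subrKA T); apply: NbD; last exact: HN.
    by apply: NbC; exact: HN.
  apply: le_trans (gn_op _ Nbij Cw _) _; [lra| |nra].
  have -> : (S i - S j) \o w = (S i \o w) - (S j \o w).
    by apply/funext => q; exact: opB.
  exact: (gclB gcl).
have w0 := nrm_ge0 (w q); have [|N HN] := SN (e / (nrm (w q) + 1)).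
  by rewrite divr_gt0 //; lra.
exists N => i Ni; rewrite nrmC /= -opB; apply: le_trans (HN i Ni _) _.
have d0 : 0 < e / (nrm (w q) + 1) by rewrite divr_gt0 //; lra.
have : e / (nrm (w q) + 1) * (nrm (w q) + 1) = e by rewrite mulfVK //; lra.
nra.
Qed.

Lemma op_closure_th (T : 'L(FX)) : bd T -> (forall x, gclosure (T \o th x)) ->
  forall w, gclosure w -> gclosure (T \o w).
Proof.
move=> Tb Tth; have [C0 CP _ CA] := gcl.
have Cdom : gs_dom GS `<=` [set w : W | gclosure (T \o w)].
  apply: lspan_ind => /= [|a w w' Cw Cw'|_ [x [d ->]]]; last exact: (CA _ d (Tth x)).
    by rewrite (_ : T \o 0 = 0) //; apply/funext => q /=; rewrite op_0.
  rewrite (_ : T \o _ = a *: (T \o w) + (T \o w')); first exact: CP.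
  by apply/funext => q; rewrite /= op_add op_scale.
move=> w [u [Vu cu uw]]; have [r r0 Tr] := Tb.
have Cu i : gclosure (u i) by exact: gclosure_dom.
apply: (@gclosure_ptends _ _ _ _ GS (fun i => T \o u i)).
- by move=> i; exact: Cdom.
- move=> e e0; have [|N HN] := cu (e / (r + 1)); first by rewrite divr_gt0 //; lra.
  exists N => i j Ni Nj.
  have E1 : (T \o u i) - (T \o u j) = T \o (u i - u j).
    by apply/funext => q /=; rewrite op_sub.
  rewrite E1; apply: le_trans (gn_op r0 Tr _ _) _; first exact: (gclB gcl).
    by rewrite -E1; apply: (gclB gcl); exact: Cdom.
  have := HN i j Ni Nj; rewrite ler_pdivlMr; last lra.
  have := gn_ge0 GS (u i - u j); nra.
- by move=> q; exact: (blin_tends (blin_op Tb) (uw q)).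
Qed.

(** The operators that preserve the bimodule together with their adjoints form a
    C*-subalgebra. It contains the creation operators by phi_Theta and
    phi_star_Theta. *)
Lemma kappa_closure c w : gclosure w -> gclosure (kappa c \o w).
Proof.
pose Q := [set T : 'L(FX) | (forall w, gclosure w -> gclosure (T \o w)) /\
  (forall w, gclosure w -> gclosure (T^† \o w))].
have [C0 CP _ CA] := gcl.
have lin (S T : 'L(FX)) (a : R[i]) w' : gclosure (S \o w') -> gclosure (T \o w') ->
    gclosure ((a *: S + T) \o w').
  by move=> CS CT; rewrite (_ : _ \o w' = a *: (S \o w') + (T \o w')) //; exact: CP.
suff : Q (kappa c) by case=> + _; exact.
apply: reduced_ind.
  split.
  - apply: lin_lspan => [|a S T [HS HS'] [HT HT']].
      have Z w' : gclosure ((0 : 'L(FX)) \o w') by rewrite (_ : _ \o w' = 0).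
      by split=> w' _; rewrite ?star0.
    split=> w' Cw'; first by apply: lin; [exact: HS|exact: HT].
    by rewrite starD starZ; apply: lin; [exact: HS'|exact: HT'].
  - move=> S T [HS HS'] [HT HT']; split=> w' Cw'.
      exact: (HS _ (HT _ Cw')).
    by rewrite astarM; exact: (HT' _ (HS' _ Cw')).
  - by move=> T [HT HT']; split=> //; rewrite astarK.
  - move=> T /opnorm_closureP HT; split; apply: op_closure_lim => e e0.
      by have [S [HS _] TS] := HT e e0; exists S.
    have [S [_ HS] TS] := HT e e0; exists S^† => //.
    by rewrite -starB; apply: Nb_star TS; [exact: hilbert_CS|exact: ltW].
move=> s x y; split; apply: op_closure_th.
- by rewrite -crE; exact: bd_real.
- move=> z; rewrite (_ : _ \o th z = th x \o gshift (vp s (ket y z))).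
    by apply: CA; exact: th_in.
  by apply/funext => -[xi u]; exact: phi_Theta.
- by rewrite -crE -(star_hom_star kappah); exact: bd_real.
- move=> z.
  rewrite (_ : _ \o th z = th y \o gshift (vp s (alphaK s (ket z x)))^†).
    by apply: CA; exact: th_in.
  by apply/funext => -[xi u]; exact: phi_star_Theta.
Qed.

Implicit Types (a b : CX).

Definition cact c m : M := gmk (kappa_closure c (gfunP m)).

Lemma cactE c m q : gfun (cact c m) q = kappa c (gfun m q). Proof. by []. Qed.

Lemma cact_linearl m : linear (cact ^~ m).
Proof.
move=> k a b; apply: gmod_eq; apply/funext => q.
by rewrite cactE (star_homD kappah) (star_homZ kappah).
Qed.

Lemma cact_linearr c : linear (cact c).
Proof.
move=> k m n; apply: gmod_eq; apply/funext => q; rewrite cactE.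
by rewrite -[gfun (k *: m + n) q]/(k *: gfun m q + gfun n q) op_add op_scale.
Qed.

Lemma cactM a b m : cact (a ** b) m = cact a (cact b m).
Proof.
by apply: gmod_eq; apply/funext => q; rewrite !cactE (star_homM kappah).
Qed.

Lemma cact_hact c m d : cact c (m <* d) = cact c m <* d.
Proof. exact: gmod_eq. Qed.

Lemma cact_adj c m n : << cact c m | n >> = << m | cact c^† n >>.
Proof.
apply: (@gmod_innerE _ _ _ _ GS) => xi u eta v.
rewrite -(gmodP m (cact c^† n) xi u eta v) !cactE (star_hom_star kappah).
exact: op_starP.
Qed.

Definition Lact c : 'L(M) := Adjointable (cact_adj c).

Lemma Lact_hom : star_hom Lact.
Proof.
split=> [k a b|a b|a]; apply: adjointable_eq => m /=.
- exact: cact_linearl.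
- exact: cactM.
- by [].
Qed.

Lemma cact_cr s x y z : cact (cr s x y) (Th z) = Th x <* vp s (ket y z).
Proof.
apply: gmod_eq; apply/funext => -[xi u]; rewrite cactE crE.
exact: phi_Theta.
Qed.

Lemma cact_cr_star s x y z :
  cact (cr s x y)^† (Th z) = Th y <* (vp s (alphaK s (ket z x)))^†.
Proof.
apply: gmod_eq; apply/funext => -[xi u]; rewrite cactE (star_hom_star kappah) crE.
exact: phi_star_Theta.
Qed.

Lemma cact_eq0 c : (forall m, cact c m = 0) -> c = 0.
Proof.
move=> c0; apply: real_inj; rewrite (star_hom0 kappah).
apply: (op_dense_eq Theta_dense) => _ [x [xi [u ->]]].
have /(congr1 (fun m : M => gfun m (xi, u))) := c0 (Th x).
by rewrite cactE.
Qed.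

Lemma bd_Lact c : bd (Lact c).
Proof.
exists (nrm c); first exact: nrm_ge0.
exact: rep_contractive Lact_hom c.
Qed.

(** As in vec_positive, the negative part w of e would give vectors n m with
    [n m, e (n m)] = - [w m, w m]. *)
Lemma left_positive e : e^† = e -> (forall m, cpositive << m | cact e m >>) ->
  cpositive e.
Proof.
move=> esa ep; have [n [v [w [nsa vsa wsa new wv]]]] := alg_negative_part esa.
suff w0 : w = 0 by exists v; rewrite vsa; exact: wv.
apply: cact_eq0 => m; apply: hinner_eq0; apply: cpos_oppK; first exact: hinner_ge0.
have -> : - << cact w m | cact w m >> = << cact n m | cact e (cact n m) >>.
  rewrite !cact_adj nsa wsa -!cactM new -[cact (- _) m]/(Lact _ m).
  by rewrite (star_homN Lact_hom) opN hinnerNr.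
exact: ep.
Qed.

Lemma cact_star_mul a m : << m | cact (a^† ** a) m >> = << cact a m | cact a m >>.
Proof. by rewrite cactM cact_adj. Qed.

(** The left action is isometric. If c acts with norm at most r, then op_defect
    makes r ^+ 2 x^† x - (c x)^† (c x) positive; the choice x = c^† turns this
    into a bound on the fourth power of the norm of c. *)
Lemma nrm_le_cact c r : 0 <= r -> (forall m, nrm (cact c m) <= r * nrm m) ->
  nrm c <= r.
Proof.
move=> r0 cr; have [S HS] := op_defect (T := Lact c) r0 cr.
pose x := c^†; pose e := (r * r)%:C *: (x^† ** x) - (c ** x)^† ** (c ** x).
have ep : cpositive e.
  apply: left_positive.
    by rewrite /e astarB astarZ conjrC !astarM !astarK.
  move=> m; rewrite -[cact e m]/(Lact e m) /e (star_homB Lact_hom).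
  rewrite (star_homZ Lact_hom) opB opZ hinnerBr hinnerZr /= !cact_star_mul cactM.
  have := HS (cact x m) (cact x m) => /= <-.
  by rewrite addrC addKr; exact: hinner_ge0.
have := cpos_mono (cpos_star_mul (c ** x)) ep.
rewrite nrmZr ?mulr_ge0 // !nrm_star_mul /x nrm_star.
have -> : nrm (c ** c^†) = nrm c ^+ 2 by rewrite -{1}[c]astarK nrm_star_mul nrm_star.
have := nrm_ge0 c; move: (nrm c) => t t0 H.
have [->|tn0] := eqVneq t 0; first by [].
have t1 : 0 < t by rewrite lt_def tn0.
rewrite -(@ler_pXn2r _ 2) ?nnegrE // -(ler_pM2r (exprn_gt0 2 t1)).
by move: H; rewrite -!expr2.
Qed.

(** * The left inner product *)

(** The left inner product c is the operator m n^* of the bimodule. *)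
Definition left_gram m n c := forall p, cact c p = m <* << n | p >>.

Lemma left_gram_uniq m n a b : left_gram m n a -> left_gram m n b -> a = b.
Proof.
move=> ma mb; apply/eqP; rewrite -subr_eq0; apply/eqP.
apply: cact_eq0 => p.
by rewrite -[cact _ p]/(Lact _ p) (star_homB Lact_hom) opB /= ma mb subrr.
Qed.

Lemma left_gramP (k : R[i]) m m' n a b : left_gram m n a -> left_gram m' n b ->
  left_gram (k *: m + m') n (k *: a + b).
Proof.
by move=> ma mb p; rewrite (cact_linearl p) ma mb hact_linearl.
Qed.

Lemma left_gram_star m n c : left_gram m n c -> left_gram n m c^†.
Proof.
move=> mc p; apply: hinner_inj => q; rewrite -cact_adj mc.
by rewrite hinner_actl hinner_star hinner_act.
Qed.

Lemma left_gram_cact a m n c : left_gram m n c -> left_gram (cact a m) n (a ** c).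
Proof. by move=> mc p; rewrite cactM mc cact_hact. Qed.

Lemma left_gram_hact m n c d : left_gram (m <* d) n c <-> left_gram m (n <* d^†) c.
Proof.
suff H p : m <* d <* << n | p >> = m <* << n <* d^† | p >>.
  by split=> mc p; rewrite mc H.
by rewrite hinner_actl astarK hactA.
Qed.

Lemma left_gram_bound m n c : left_gram m n c -> nrm c <= nrm m * nrm n.
Proof.
move=> mc; apply: nrm_le_cact => [|p]; first by rewrite mulr_ge0 ?nrm_ge0.
rewrite mc -mulrA; apply: le_trans (nrm_act _ _) _.
by rewrite ler_wpM2l ?nrm_ge0 // hilbert_CS.
Qed.

Lemma left_gram_ge0 m c : left_gram m m c -> cpositive c.
Proof.
move=> mc; apply: left_positive => [|p].
  exact: left_gram_uniq (left_gram_star mc) mc.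
rewrite mc hinner_act -[<< p | m >>]hinner_star; exact: cpos_star_mul.
Qed.

Lemma left_gram_norm m c : left_gram m m c -> nrm c = nrm m ^+ 2.
Proof.
move=> mc; apply/eqP; rewrite eq_le expr2 left_gram_bound //=.
have H : nrm << m | cact c m >> = nrm m ^+ 2 * nrm m ^+ 2.
  rewrite mc hinner_act -{1}[<< m | m >>]hinner_star nrm_star_mul nrm_inner.
  by rewrite expr2.
have := hilbert_CS m (cact c m); rewrite H.
have := rep_contractive Lact_hom c m.
rewrite /=; have := nrm_ge0 m; have := nrm_ge0 c.
move: (nrm m) (nrm c) (nrm (cact c m)) => t r q r0 t0 qr tq.
have [->|tn0] := eqVneq t 0; first by rewrite mulr0.
have t1 : 0 < t by rewrite lt_def tn0.
rewrite -(ler_pM2r (mulr_gt0 t1 t1)); have := ler_wpM2l t0 qr.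
by move: tq; rewrite !expr2; nra.
Qed.

Lemma blin_cact c : blin (cact c).
Proof. exact: blin_op (bd_Lact c). Qed.

Lemma blin_cactl p : blin (fun c => cact c p).
Proof.
split; first exact: cact_linearl.
exists (nrm p) => [|c]; first exact: nrm_ge0.
by rewrite mulrC; exact: (rep_contractive Lact_hom c p).
Qed.

(** By left_gram_bound the inner products with n of a convergent sequence form a
    Cauchy sequence. *)
Lemma left_gram_lim m n : (forall e, 0 < e -> exists m' c,
  left_gram m' n c /\ nrm (m - m') <= e) -> exists c, left_gram m n c.
Proof.
move=> H; have /choice[f Hf] i : exists q : M * CX,
    left_gram q.1 n q.2 /\ nrm (m - q.1) <= i.+1%:R^-1.
  have [|m' [c [mc mm]]] := H i.+1%:R^-1; first by rewrite invr_gt0.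
  by exists (m', c).
have fm : tends (fun i => (f i).1) m.
  move=> e e0; have [N HN] := archi_seq e0; exists N => i Ni.
  by rewrite nrmC; exact: le_trans (Hf i).2 (HN i Ni).
have n0 := nrm_ge0 n.
have [|c fc] := @complete_seq _ CX (fun i => (f i).2).
  move=> e e0; have [|N HN] := tends_cauchy fm (e := e / (nrm n + 1)) _.
    by rewrite divr_gt0 //; lra.
  exists N => i j Ni Nj; have := left_gramP (-1) (Hf j).1 (Hf i).1.
  rewrite !scaleN1r ![- _ + _]addrC => /left_gram_bound H1.
  have := HN i j Ni Nj; rewrite ler_pdivlMr; last lra.
  have := nrm_ge0 ((f i).1 - (f j).1); nra.
exists c => p; apply: tends_unique (blin_tends (blin_cactl p) fc) _.
have := blin_tends (blin_hactl M << n | p >>) fm; apply: eq_tends => i.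
by rewrite /= (Hf i).1.
Qed.

Let has_left m n := exists c, left_gram m n c.

Lemma cspace_left n : cspace [set m | has_left m n].
Proof.
split=> [|k m m' [a ma] [b mb]|m Hm] /=.
- exists 0 => p; rewrite -[cact _ p]/(Lact _ p) (star_hom0 Lact_hom) op0.
  by rewrite (blin_0 (blin_hactl M _)).
- by exists (k *: a + b); exact: left_gramP.
apply: left_gram_lim => e /Hm[m' [c mc] mm]; exists m', c; split=> //.
Qed.

Lemma left_gram_ext m n c :
  (forall z, cact c (Th z) = m <* << n | Th z >>) -> left_gram m n c.
Proof.
move=> H p; move: p; apply: (dense_eq (S := [set m | exists z d, m = Th z <* d])).
- by apply/densely_cspan => p; exact: Th_dense.
- exact: blin_cact.
- exact: blin_comp (blin_inner n) (blin_hactr m).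
by move=> _ [z [d ->]]; rewrite cact_hact H hinner_act hactA.
Qed.

(** This is the relation Theta_x Theta_y^* = phi(x^* (x) y), in the fibre at the
    identity. *)
Lemma left_gram_Th x y : left_gram (Th x) (Th y) (cr 1%g x y).
Proof. by apply: left_gram_ext => z; rewrite cact_cr Th_inner. Qed.

Definition left_span : set M := cspan [set m | exists c u, m = cact c (Th u)].

Lemma left_span_cact c m : left_span m -> left_span (cact c m).
Proof.
move: m; apply: cspan_blin; first exact: blin_cact.
by move=> _ [a [u ->]]; apply: sub_cspan; exists (c ** a), u; rewrite cactM.
Qed.

Let stable d := forall x, left_span (Th x <* d).

Lemma cspace_stable : cspace stable.
Proof.
have H x := cspace_preimage (blin_hactr (Th x)) (cspace_cspan
  [set m | exists c u, m = cact c (Th u)]).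
split=> [x|k d d' Hd Hd' x|d Hd x].
- by have [? _ _] := H x.
- by have [_ HP _] := H x; apply: HP; [exact: Hd|exact: Hd'].
- by have [_ _ Hc] := H x; apply: Hc => e /Hd[d' Hd' dd']; exists d'; first exact: Hd'.
Qed.

Lemma stableM d d' : stable d -> stable d' -> stable (d ** d').
Proof.
move=> Hd Hd' x; rewrite hactA; apply: (cspan_blin (blin_hactl M d')) (Hd x).
move=> _ [c [u ->]]; rewrite -cact_hact; apply: left_span_cact; exact: Hd'.
Qed.

Lemma stable_vp s k : stable (vp s k).
Proof.
apply: (cspace_dense (ket_dense KE) (T := [set k | stable (vp s k)])) => /=.
  exact: cspace_preimage (blin_vp s) cspace_stable.
move=> _ [z [u ->]] x; apply: sub_cspan; exists (cr s x z), u.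
by rewrite cact_cr.
Qed.

(** By non-degeneracy k may be taken of the form alpha_s(a b^* ) z w^*. Then
    Theta_x (V_s pi(k))^* = (Theta_x pi(w z^* )) (V_s pi(alpha_s(a b^* )))^* =
    phi(x^* (x) w) Theta_z (V_s pi(alpha_s(a b^* )))^*, where the first factor
    belongs to the fibre at the identity, and phi_star_Theta applies to the last
    two. *)
Lemma stable_vp_star s k : stable (vp s k)^†.
Proof.
have cS : cspace [set k | stable (vp s k)^†].
  apply: (cspace_preimage (f := vp s)) (cspace_star cspace_stable).
  exact: blin_vp.
apply: (cspace_dense (alphaK_dense alpha_E0 alphaK_restr s) cS).
move=> _ [k1 [k2 ->]] /=.
have ca : blin (alphaK s).
  have ah := alphaK_hom alpha_E0 alphaK_restr s.
  split; first by case: ah.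
  by exists 1 => // k'; rewrite mul1r; exact: star_hom_contractive.
have cS1 := cspace_preimage (blin_comp ca (blin_amull k2)) cS.
apply: (cspace_dense (ket_dense KE) cS1) k1 => _ [a [b ->]].
have cS2 := cspace_preimage (blin_amulr (alphaK s (ket a b))) cS.
refine (cspace_dense (ket_dense KE) cS2 _ k2).
move=> _ [z [w ->]] x; rewrite -vp_mulr astarM vp1_star ket_star hactA.
rewrite -(cact_cr 1%g x w z) -cact_hact -cact_cr_star.
by apply: sub_cspan; exists (cr 1%g x w ** (cr s b z)^†), a; rewrite cactM.
Qed.

Lemma stable_all d : stable d.
Proof.
pose S := stable `&` [set d | stable d^†].
suff [d' [Hd' _] /real_inj <-] : [set sigma d | d in S] (sigma d) by [].
apply: (crossed_ind (P_rcancel := P_rcancel) (alpha_E0 := alpha_E0)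
  (alphaK_restr := alphaK_restr)) => [|s k].
  apply: image_subalgebra.
  - exact: cspaceI cspace_stable (cspace_star cspace_stable).
  - move=> d1 d2 [H1 H1'] [H2 H2']; split; first exact: stableM H1 H2.
    by rewrite /= astarM; apply: stableM H2' H1'.
  - by move=> d1 [H1 H1']; split; rewrite /= ?astarK.
exists (vp s k); last exact: vpE.
by split; [exact: stable_vp|exact: stable_vp_star].
Qed.

(** It suffices to pair Theta_x d with Theta_y. By stable_all Theta_x d is a
    limit of combinations of vectors c Theta_u, and (c Theta_u) Theta_y^* = c
    phi(u^* (x) y). *)
Lemma left_gram_ex m n : exists c, left_gram m n c.
Proof.
apply: (cspace_ind (cspace_left n)) (Th_dense m) => _ [x [d ->]] /=.
suff : has_left n (Th x <* d).
  by move=> [c nc]; exists c^†; exact: left_gram_star.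
apply: (cspace_ind (cspace_left (Th x <* d))) (Th_dense n) => _ [y [d' ->]] /=.
suff [c H] : has_left (Th x <* (d ** d'^†)) (Th y).
  exists c^†; apply: left_gram_star; move: H.
  by rewrite hactA => /left_gram_hact; rewrite astarK.
apply: (cspace_ind (cspace_left (Th y))) (stable_all _ x) => _ [a [u ->]] /=.
by exists (a ** cr 1%g u y); apply: left_gram_cact; exact: left_gram_Th.
Qed.

Definition linner m n : CX := projT1 (cid (left_gram_ex m n)).

Lemma linnerP m n : left_gram m n (linner m n).
Proof. by rewrite /linner; case: cid. Qed.

Lemma linnerE m n c : left_gram m n c -> linner m n = c.
Proof. exact: left_gram_uniq (linnerP m n). Qed.

Lemma linner_linearl n : linear (linner ^~ n).
Proof. by move=> k m m'; apply: linnerE; apply: left_gramP; exact: linnerP. Qed.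

Lemma linner_cact c m n : linner (cact c m) n = c ** linner m n.
Proof. by apply: linnerE; apply: left_gram_cact; exact: linnerP. Qed.

Lemma linner_star m n : (linner m n)^† = linner n m.
Proof. by apply/esym/linnerE/left_gram_star; exact: linnerP. Qed.

Lemma linner_hact m n d : linner (m <* d) n = linner m (n <* d^†).
Proof. by apply: linnerE; apply/left_gram_hact; exact: linnerP. Qed.

Lemma linner_norm m : `|m| ^+ 2 = `|linner m m|.
Proof.
by rewrite !nrmE -rmorphXn; congr (_%:C); exact/esym/left_gram_norm/linnerP.
Qed.

Lemma nrm_tauB s x x' y :
  nrm (tau s x y - tau s x' y) <= nrm (x - x') * nrm y.
Proof.
have [ip td] := tau_tensor s; have ah := alphaK_hom alpha_E0 alphaK_restr s.
have -> : tau s x y - tau s x' y = tau s (x - x') y.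
  apply: (dense_inner_eq td) => _ [z [u ->]].
  rewrite hinnerBr !ip !(alpha_ket alphaK_restr) ketBr (star_homB ah).
  by rewrite (star_homB rhoh) opB hinnerBr.
set z := x - x'; have y0 := nrm_ge0 y; have z0 := nrm_ge0 z.
rewrite -(@ler_pXn2r _ 2) ?nnegrE ?mulr_ge0 ?nrm_ge0 // -nrm_inner ip.
rewrite (alpha_ket alphaK_restr); apply: le_trans (hilbert_CS _ _) _.
have H1 := Nb_real (alphaK s (ket z z)) y.
have H2 := le_trans (star_hom_contractive ah (ket z z)) (nrm_ket KE z z).
apply: le_trans (ler_wpM2l y0 (le_trans H1 (ler_wpM2r y0 H2))) _.
by rewrite le_eqVlt; apply/orP; left; apply/eqP; ring.
Qed.

Lemma nrm_crB s x x' y : nrm (cr s x y - cr s x' y) <= nrm (x - x') * nrm y.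
Proof.
apply: le_trans (nrm_tauB s x x' y).
apply: real_Nb; rewrite ?nrm_ge0 // (star_homB kappah) !crE.
have phiC z := phi_creation s z y.
have := creationP (-1) (phiC x') (phiC x).
rewrite !scaleN1r ![- _ + _]addrC => H.
by apply: (creation_bound _ H) => a b c; exact: P_rcancel.
Qed.

Let left_ideal : set CX := cspan [set c | exists m n, c = linner m n].

Lemma left_ideal_mul a b : left_ideal b -> left_ideal (a ** b).
Proof.
apply: (cspan_blin (blin_amulr a)) => _ [m [n ->]]; apply: sub_cspan.
by exists (cact a m), n; rewrite linner_cact.
Qed.

Lemma left_ideal_star a : left_ideal a -> left_ideal a^†.
Proof.
apply: (cspace_ind (cspace_star (cspace_cspan _))) => _ [m [n ->]] /=.
by apply: sub_cspan; exists n, m; rewrite linner_star.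
Qed.

Lemma Th_act x k : Th x <* vp 1%g k = Th (rho k^† x).
Proof. exact/gmod_eq/th_shift. Qed.

(** Every x is a limit of vectors k x with k compact, and the creation operator
    of (k x)^* (x) y is (Theta_x V_s pi(alpha_s(k^* ))) Theta_y^*. *)
Lemma left_ideal_cr s x y : left_ideal (cr s x y).
Proof.
apply: cspan_closed => e e0; have y0 := nrm_ge0 y.
have [|k Hk] := KE_approx KE x (e := e / (nrm y + 1)) _.
  by rewrite divr_gt0 //; lra.
exists (cr s (rho k x) y); last first.
  apply: le_trans (nrm_crB _ _ _ _) _; rewrite nrmC.
  move: Hk; rewrite ler_pdivlMr; last lra.
  have := nrm_ge0 (rho k x - x); nra.
apply: sub_cspan; exists (Th x <* vp s (alphaK s k^†)), (Th y).
apply/esym/linnerE/left_gram_ext => z; rewrite cact_cr Th_inner.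
by rewrite -hactA vp_mulr -vp_mul hactA Th_act astarK.
Qed.

Lemma left_full : densely_spans [set c | exists m n, c = linner m n].
Proof.
apply/densely_cspan => c.
suff [c' Hc' /real_inj <-] : [set kappa c | c in left_ideal] (kappa c) by [].
apply: reduced_ind.
  apply: image_subalgebra; first exact: cspace_cspan.
  - by move=> a b _; exact: left_ideal_mul.
  - exact: left_ideal_star.
by move=> s x y; exists (cr s x y); [exact: left_ideal_cr|exact: crE].
Qed.

(** The inner products span a closed ideal that contains Theta_x^* Theta_y =
    pi(x y^* ), hence pi(K) V_s pi(K), and by vp_dense all generators. *)
Lemma right_full : full_module M.
Proof.
apply/densely_cspan => d.
pose S : set KP := cspan [set d | exists m n : M, d = << m | n >>].
have SM d1 d2 : S d1 -> S (d1 ** d2).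
  apply: (cspan_blin (blin_amull d2)) => _ [m [n ->]]; apply: sub_cspan.
  by exists m, (n <* d2); rewrite hinner_act.
have Sstar d1 : S d1 -> S d1^†.
  apply: (cspace_ind (cspace_star (cspace_cspan _))) => _ [m [n ->]] /=.
  by apply: sub_cspan; exists n, m; rewrite hinner_star.
suff [d' Hd' /real_inj <-] : [set sigma d | d in S] (sigma d) by [].
apply: (crossed_ind (P_rcancel := P_rcancel) (alpha_E0 := alpha_E0)
  (alphaK_restr := alphaK_restr)) => [|s k].
  apply: image_subalgebra => //; first exact: cspace_cspan.
  by move=> d1 d2 + _; exact: SM.
exists (vp s k); last exact: vpE.
apply: (cspace_ind (cspace_cspan _)) (vp_dense s k) => _ [k1 [k2 ->]].
apply: SM; have cS := cspace_preimage (blin_vp 1%g) (cspace_cspan _ : cspace S).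
refine (cspace_dense (ket_dense KE) cS _ k1) => _ [x [y ->]] /=.
by apply: sub_cspan; exists (Th x), (Th y); rewrite Th_inner.
Qed.

Definition equivalence_bimodule : imprimitivity_bimodule CX KP :=
  ImprimitivityBimodule right_full cact_linearl cact_linearr cactM
    linner_linearl linner_cact linner_star
    (fun m => left_gram_ge0 (linnerP m m)) linner_norm left_full
    cact_hact cact_adj linner_hact linnerP.

End Equivalence.

Theorem theorem1p1 (R : realType) (P : monoidType)
    (P_countable : countable [set: P])
    (P_lcancel : forall s t u : P, (s * t = s * u)%g -> t = u)
    (P_rcancel : forall s t u : P, (t * s = u * s)%g -> t = u)
    (B : cstarAlgType R[i]) (B_separable : separable B)
    (E : hilbertModType B) (E_countably_generated : countably_generated E)
    (E_full : full_module E)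
    (alpha : P -> 'L(E) -> 'L(E)) (alpha_E0 : E0_semigroup alpha)
    (alpha_compact : compact_type alpha)
    (X : product_system B (opposite P))
    (X_alpha : associated_product_system alpha X)
    (FX : direct_sum X)
    (CredX : realization (reduced_algebra FX))
    (KE : realization (compacts E))
    (alphaK : P -> KE -> KE)
    (alphaK_restr : forall s k,
       real_op (alphaK s k) = alpha s (real_op k))
    (FK : direct_sum (fun _ : P => regular_module KE : hilbertModType KE))
    (KE_P : realization (crossed_product alphaK FK)) :
  morita_equivalent CredX KE_P.
Proof.
have [tau [tau_tensor _ tau_mul _]] := X_alpha.
exact: inhabits (equivalence_bimodule P_rcancel alpha_E0 alphaK_restr KE_P
  tau_tensor tau_mul CredX).
Qed.
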